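(* Let $B_1,\dots,B_M\subset\mathbb{R}^3$ be open, bounded, simply connected sets with Lipschitz boundaries, each containing the origin, with uniformly bounded sizes and Lipschitz constants. Let $\epsilon>0$, $z_1,\dots,z_M\in\mathbb{R}^3$, and $D_m:=\epsilon B_m+z_m$ for $m=1,\dots,M$. Let $\lambda,\mu$ be real constants with $\mu>0$ and $3\lambda+2\mu>0$. Let $C_m$ be the elastic capacitance matrix of $D_m$, and let $\lambda^{\min}_{eig_m}$ and $\lambda^{\max}_{eig_m}$ denote its minimal and maximal eigenvalues. Then there exist two constants $c(Lip)>0$ and $C(Lip)>0$, depending only on the Lipschitz character of $B_1,\dots,B_M$ (in particular independent of $\epsilon$, of the $z_m$, and of $\lambda,\mu$), such that for every $m=1,\dots,M$ $$ c(Lip)\,(\lambda+2\mu)^{-1}\lambda^{\max}_{eig_m}\;\le\;\frac{|\partial D_m|}{\epsilon}\;\le\; C(Lip)\,\mu^{-1}\lambda^{\min}_{eig_m}. $$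
   Context: $|\partial D_m|$ denotes the surface area of $\partial D_m$. Lipschitz character: the Lipschitz character of a bounded Lipschitz domain consists of the number of local coordinate cylinders used to cover its boundary, the sizes of these cylinders, and the bound on the Lipschitz constants of the functions whose graphs describe the boundary in them (so it carries information on the scale of the domain). ''Depending only on the Lipschitz character of $B_1,\dots,B_M$'' means that the constants can be chosen the same for all families of reference bodies with the same bounds on these data. Elastic capacitance: let $\Gamma^0$ be the static (zero-frequency, Kelvin) fundamental matrix of the Lamé operator $\mu\Delta+(\lambda+\mu)\nabla\operatorname{div}$ in $\mathbb{R}^3$, i.e. $$\Gamma^0(x,y)=\frac{1}{8\pi}\Big(\frac1\mu+\frac1{\lambda+2\mu}\Big)\frac{1}{|x-y|}\mathbf{I}+\frac{1}{8\pi}\Big(\frac1\mu-\frac1{\lambda+2\mu}\Big)\frac{(x-y)(x-y)^{\top}}{|x-y|^3},$$ with $\mathbf{I}$ the $3\times3$ identity matrix. Let $\sigma_m$ be the ($3\times 3$ matrix-valued, $L^2(\partial D_m)$) solution of the first-kind integral equation $$\int_{\partial D_m}\Gamma^0(s_m,s)\,\sigma_m(s)\,ds=\mathbf{I},\qquad s_m\in\partial D_m .$$ The elastic capacitance matrix of $D_m$ is $C_m:=\int_{\partial D_m}\sigma_m(s)\,ds\in\mathbb{R}^{3\times3}$. *)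

(* Defs.v *)
From HB Require Import structures.
From mathcomp Require Import all_boot all_order all_algebra.
From mathcomp Require Import all_classical all_reals all_analysis.

Set Implicit Arguments.
Unset Strict Implicit.
Unset Printing Implicit Defensive.

Import Order.TTheory GRing.Theory Num.Theory.
Import numFieldNormedType.Exports.

Local Open Scope classical_set_scope.
Local Open Scope ring_scope.

(* The norm of the normed module 'rV[R]_n is the sup norm, hence a separate
   Euclidean norm; both induce the same topology and the same bounded sets. *)
Definition enorm (R : realType) (n : nat) (x : 'rV[R]_n) : R :=
  Num.sqrt (\sum_(i < n) x ord0 i ^+ 2).

Definition boundary (T : topologicalType) (A : set T) : set T :=
  closure A `\` interior A.

Section hausdorff_measure.
Context (R : realType) (n : nat).
Implicit Types (A : set 'rV[R]_n) (d : R).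
Local Open Scope ereal_scope.

(* The maximum with 0 only matters for the empty set. *)
Definition ediam A : \bar R :=
  maxe 0 (ereal_sup [set (enorm (p.1 - p.2))%:E | p in A `*` A]).

Definition delta_cover d A : set ((set 'rV[R]_n)^nat) :=
  [set F | (forall k, ediam (F k) <= d%:E) /\ A `<=` \bigcup_k F k].

Definition hausdorff2_delta d A : \bar R :=
  ereal_inf [set \sum_(k <oo) ((pi / 4)%:E * ediam (F k) ^+ 2)
            | F in delta_cover d A].

(* Two-dimensional Hausdorff measure: the factor pi / 4 is the normalization
   for which it is the usual area on Lipschitz surfaces. *)
Definition hausdorff2 A : \bar R :=
  ereal_sup [set hausdorff2_delta d A | d in [set d | (0 < d)%R]].

Let gauge A : \bar R := (pi / 4)%:E * ediam A ^+ 2.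

Let ediam_ge0 A : 0 <= ediam A.
Proof. by rewrite /ediam le_max lexx. Qed.

Let gauge_ge0 A : 0 <= gauge A.
Proof.
apply: mule_ge0; last exact: expe_ge0.
by rewrite lee_fin divr_ge0// pi_ge0.
Qed.

Let ediam0 : ediam set0 = 0.
Proof.
have E : [set (enorm (p.1 - p.2))%:E | p in (set0 : set 'rV[R]_n) `*` set0] = set0.
  by apply/seteqP; split=> // x [p []].
by rewrite /ediam E ereal_sup0; apply/max_idPl; rewrite leNye.
Qed.

Let gauge0 : gauge set0 = 0.
Proof. by rewrite /gauge ediam0 expe2 mul0e mule0. Qed.

Let hd_ge0 d A : 0 <= hausdorff2_delta d A.
Proof.
apply: le_ereal_inf_tmp => _ [F _ <-].
by apply: nneseries_ge0 => k _ _; exact: gauge_ge0.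
Qed.

Let hd_mono d A B : A `<=` B -> hausdorff2_delta d A <= hausdorff2_delta d B.
Proof.
move=> AB; apply/ereal_inf_le_tmp => _ [F [Fd BF] <-].
by exists F => //; split => //; exact: subset_trans BF.
Qed.

Let hd_sub d : sigma_subadditive (hausdorff2_delta d).
Proof.
move=> A; have [[i ioo]|] := pselect (exists i, hausdorff2_delta d (A i) = +oo).
  rewrite (eseries_pinfty _ _ ioo) ?leey// => k _.
  by rewrite -ltNye (lt_le_trans _ (hd_ge0 _ _)).
rewrite -forallNE => Aoo.
suff add2e (e : {posnum R}) : hausdorff2_delta d (\bigcup_k A k) <=
    \sum_(i <oo) hausdorff2_delta d (A i) + e%:num%:E.
  by apply/lee_addgt0Pr => _/posnumP[].
rewrite (le_trans _ (epsilon_trick _ _ _))//.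
pose P k (B : (set 'rV[R]_n)^nat) := delta_cover d (A k) B /\
  \sum_(j <oo) gauge (B j) <=
    hausdorff2_delta d (A k) + (e%:num / (2 ^ k.+1)%:R)%:E.
have [G PG] : {G : ((set 'rV[R]_n)^nat)^nat & forall k, P k (G k)}.
  apply: (@choice _ _ P) => k; rewrite /P.
  have en1 : (0 < e%:num / (2 ^ k.+1)%:R)%R by [].
  have hfin : hausdorff2_delta d (A k) \is a fin_num.
    by rewrite ge0_fin_numE// ltey; apply/eqP/Aoo.
  have [x [B dB <-] xS] := lb_ereal_inf_adherent en1 hfin.
  by exists B; split => //; exact/ltW.
apply: (@le_trans _ _ (\esum_(i in setT) (gauge \o uncurry G) i)).
  apply: ereal_inf_lbound => /=.
  have /card_esym/ppcard_eqP[f] := card_nat2.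
  exists (uncurry G \o f).
    split => [i|t [i _ /(proj2 (PG i).1)[j _ Gij]]].
      by rewrite /= /uncurry; case: (f i) => a b; exact: (PG a).1.1.
    by exists (f^-1%FUN (i, j)) => //=; rewrite invK ?inE.
  rewrite -(esum_pred_image (gauge \o uncurry G) _ xpredT) ?[fun=> _]set_true//.
    by rewrite image_eq.
  by move=> ? _; exact: gauge_ge0.
rewrite (_ : esum _ _ = \sum_(i <oo) \sum_(j <oo) gauge (G i j)); last first.
  have G0 i : 0 <= \sum_(j <oo) gauge (G i j).
    by apply: nneseries_ge0 => *; exact: gauge_ge0.
  rewrite (nneseries_esumT G0).
  rewrite (eq_esum (fun i _ => nneseries_esumT (fun j => gauge_ge0 (G i j)))).
  rewrite esum_esum//=.
  congr (esum _ _); last by apply/funext => -[].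
  by apply/seteqP; split.
apply: lee_nneseries => [k _ _|k _]; [|exact: (PG k).2].
by apply: nneseries_ge0 => *; exact: gauge_ge0.
Qed.

Let hausdorff2_0 : hausdorff2 set0 = 0.
Proof.
apply/eqP; rewrite eq_le; apply/andP; split; last first.
  apply: le_trans (hd_ge0 1 set0) _.
  by apply: ereal_sup_ubound; exists 1%R => /=.
apply: ge_ereal_sup => _ [d /= d0 <-]; apply: ereal_inf_lbound.
exists (fun=> set0).
  by split=> // k; rewrite ediam0 lee_fin ltW.
by rewrite eseries0// => k _ _; exact: gauge0.
Qed.

Let hausdorff2_ge0 A : 0 <= hausdorff2 A.
Proof.
apply: le_trans (hd_ge0 1 A) _.
by apply: ereal_sup_ubound; exists 1%R => /=.
Qed.

Let hausdorff2_mono : {homo hausdorff2 : A B / A `<=` B >-> A <= B}.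
Proof.
move=> A B AB; apply: ge_ereal_sup => _ [d d0 <-].
apply: le_trans (hd_mono _ AB) _.
by apply: ereal_sup_ubound; exists d.
Qed.

Let hausdorff2_sub : sigma_subadditive hausdorff2.
Proof.
move=> F; apply: ge_ereal_sup => _ [d d0 <-].
apply: le_trans (hd_sub _ _) _; apply: lee_nneseries => [k _ _|k _]; first exact: hd_ge0.
by apply: ereal_sup_ubound; exists d.
Qed.

HB.instance Definition _ := isOuterMeasure.Build R 'rV[R]_n hausdorff2
  hausdorff2_0 hausdorff2_ge0 hausdorff2_mono hausdorff2_sub.

End hausdorff_measure.

Definition area_outer_measure (R : realType) :
    {outer_measure set 'rV[R]_3 -> \bar R} :=
  @hausdorff2 R 3.

(* Surfaces in R^3 are integrated over with the measure obtained from the outer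
   measure hausdorff2; its sigma-algebra (the Caratheodory-measurable sets)
   contains the Borel sets, hausdorff2 being a metric outer measure. *)
Definition surface_space (R : realType) :=
  caratheodory_type (area_outer_measure R).

Definition surface_measure (R : realType) :
    {measure set (surface_space R) -> \bar R} :=
  [the {measure set (surface_space R) -> \bar R} of
    (area_outer_measure R : set (surface_space R) -> \bar R)].

Section simply_connected.
Context (R : realType) (T : topologicalType).
Implicit Types B : set T.

Definition path_in B (x y : T) (g : R -> T) : Prop :=
  [/\ {within `[0, 1], continuous g}, g @` `[0, 1] `<=` B, g 0 = x & g 1 = y].

Definition path_connected B : Prop :=
  B !=set0 /\ forall x y, B x -> B y -> exists g, path_in B x y g.

Definition contractible_loop B (x : T) (g : R -> T) : Prop :=
  exists H : R * R -> T,
    [/\ {within `[0, 1] `*` `[0, 1], continuous H},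
        H @` (`[0, 1] `*` `[0, 1]) `<=` B,
        forall t, t \in `[0, 1] -> H (0, t) = g t /\ H (1, t) = x &
        forall s, s \in `[0, 1] -> H (s, 0) = x /\ H (s, 1) = x].

Definition simply_connected B : Prop :=
  path_connected B /\
  forall x g, path_in B x x g -> contractible_loop B x g.

End simply_connected.
Arguments simply_connected R {T} B.

Section lipschitz_domain.
Context (R : realType).
Implicit Types (B : set 'rV[R]_3).

(* A cylinder of R^3 with a function over its base. The cylinder has centre
   [centre], radius [base_radius] and half-height [half_height]; the columns of [frame]
   are the axes of its rectangular coordinate system, the last one being the
   axis of the cylinder. *)
Record graph_cylinder := GraphCylinder {
  centre : 'rV[R]_3;
  frame : 'M[R]_3;
  base_radius : R;
  half_height : R;
  graph : 'rV[R]_2 -> R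
}.
Implicit Types Z : graph_cylinder.

Definition local_coord Z (x : 'rV[R]_3) : 'rV[R]_(2 + 1) :=
  (x - centre Z) *m frame Z.

Definition base_coord Z (x : 'rV[R]_3) : 'rV[R]_2 := lsubmx (local_coord Z x).

Definition axis_coord Z (x : 'rV[R]_3) : R := rsubmx (local_coord Z x) 0 0.

Definition cylinder Z : set 'rV[R]_3 :=
  [set x | enorm (base_coord Z x) < base_radius Z /\ `|axis_coord Z x| < half_height Z].

Definition cylinder_bases Z : set 'rV[R]_3 :=
  [set x | enorm (base_coord Z x) <= base_radius Z /\ `|axis_coord Z x| = half_height Z].

(* Coordinate cylinder of B, centred at a boundary point, with radius and
   half-height between r0 and r1, in which B is the part above the graph of a
   Lipschitz function with constant at most L. As the boundary is closed, being
   disjoint from the (compact) bases is being at positive distance of them. *)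
Record coordinate_cylinder (r0 r1 L : R) B Z : Prop := {
  cc_frame : frame Z *m (frame Z)^T = 1%:M;
  cc_radius : r0 <= base_radius Z <= r1;
  cc_height : r0 <= half_height Z <= r1;
  cc_centre : boundary B (centre Z);
  cc_graph0 : graph Z 0 = 0;
  cc_lipschitz : forall y y', `|graph Z y - graph Z y'| <= L * enorm (y - y');
  cc_bases : cylinder_bases Z `&` boundary B = set0;
  cc_above : cylinder Z `&` B =
    cylinder Z `&` [set x | graph Z (base_coord Z x) < axis_coord Z x]
}.

(* The Lipschitz character of B is bounded by (N, r0, r1, L): the boundary is
   covered by at most N coordinate cylinders of sizes in [r0, r1] and Lipschitz
   constants at most L. *)
Definition lipschitz_character_le (N : nat) (r0 r1 L : R) B : Prop :=
  exists k (Z : 'I_k -> graph_cylinder),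
    [/\ (k <= N)%N,
        forall i, coordinate_cylinder r0 r1 L B (Z i) &
        boundary B `<=` \bigcup_i cylinder (Z i)].

End lipschitz_domain.

Definition scaled_copy (R : realType) (eps : R) (z : 'rV[R]_3)
    (B : set 'rV[R]_3) : set 'rV[R]_3 :=
  [set eps *: x + z | x in B].

Section elastic_capacitance.
Context (R : realType).
Implicit Types (lambda mu : R) (D : set 'rV[R]_3).

Definition kelvin lambda mu (x y : 'rV[R]_3) : 'M[R]_3 :=
  ((8 * pi)^-1 * (mu^-1 + (lambda + 2 * mu)^-1) / enorm (x - y))%:M +
  ((8 * pi)^-1 * (mu^-1 - (lambda + 2 * mu)^-1) / enorm (x - y) ^+ 3) *:
    ((x - y)^T *m (x - y)).

Definition surface_integral_mx D (F : 'rV[R]_3 -> 'M[R]_3) : 'M[R]_3 :=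
  \matrix_(i, j)
    \int[surface_measure R]_(s in (boundary D : set (surface_space R))) F s i j.

Definition L2_mx D (F : 'rV[R]_3 -> 'M[R]_3) : Prop :=
  forall i j, let f (s : surface_space R) := F s i j in
    measurable_fun (boundary D : set (surface_space R)) f /\
    (surface_measure R).-integrable (boundary D) (fun s => (f s ^+ 2)%:E).

(* The equation is one between L^2 densities: it holds almost everywhere. *)
Definition capacitance_density lambda mu D (sigma : 'rV[R]_3 -> 'M[R]_3) :=
  L2_mx D sigma /\
  {ae surface_measure R, forall x : surface_space R, boundary D x ->
    surface_integral_mx D (fun s => kelvin lambda mu x s *m sigma s) = 1%:M}.

Definition elastic_capacitance lambda mu D (C : 'M[R]_3) : Prop :=
  exists sigma, capacitance_density lambda mu D sigma /\
                C = surface_integral_mx D sigma.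

End elastic_capacitance.

Definition min_eigenvalue (R : realType) (n : nat) (A : 'M[R]_n) (a : R) :=
  eigenvalue A a /\ forall b, eigenvalue A b -> a <= b.

Definition max_eigenvalue (R : realType) (n : nat) (A : 'M[R]_n) (a : R) :=
  eigenvalue A a /\ forall b, eigenvalue A b -> b <= a.

(* Main.v *)
Require Import Defs.
From mathcomp Require Import all_boot all_order all_algebra.
From mathcomp Require Import all_classical all_reals all_analysis.
From mathcomp Require Import measurable_realfun ring lra.
Import Order.TTheory GRing.Theory Num.Theory.
Import numFieldNormedType.Exports.
Local Open Scope classical_set_scope.
Local Open Scope ring_scope.

Set Implicit Arguments.
Unset Strict Implicit.
Unset Printing Implicit Defensive.

(* Write the Kelvin matrix as (1/8pi) [(1/mu - 1/l') P + (2/l') I/r] with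
   l' = lambda + 2 mu, r = |x - y| and P = I/r + (x-y)(x-y)^T/r^3.  Subordinating
   1/r to Gaussians shows that P is a positive definite kernel and that 1/r
   dominates a multiple of 1/rho on charges carried by a cube of half-side rho.
   Hence, if phi = sigma v^T for a unit row eigenvector v of C with eigenvalue l,
   the energy of phi is v C v^T = l and is at least |int phi|^2 / (c l' rho); as
   int phi = l v this bounds l above by c l' rho.  Positivity of the energy of
   phi - t v, together with the Schur-type bound Q / mu on the energy density of
   constants, where Q bounds the potential int 1/|x - y|, bounds l below by a
   multiple of mu |bD| / Q, where b stands for the boundary.

   The geometry enters through rho and Q, both of order eps, and |bD|, of order
   eps^2.  A coordinate hyperplane crossing a path in B from 0 to x also meets
   bB, and the projection of bB to an axis is covered by N intervals of length
   4 r1; so the diameter of B is bounded by the Lipschitz character.  Covering by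
   graphs gives |bD cap ball(x, r)| <= K r^2, whence Q by summing over dyadic
   shells, and the projection of one graph onto its base gives the lower bound on
   the area. *)

(** Positivity is proved for finite systems of point charges, where only sums of Gaussian integrals
    occur. The obstacle is the diagonal: a point charge has infinite energy under the true kernel.
    Hence |u| is smoothed to [rdist d u], the square root of d^2 + |u|^2, whose inverse is still an
    exact Gaussian average, and P is smoothed so as to stay exactly positive. A density is then
    replaced by charges at the corners of a grid; the grid is refined at fixed d, and only
    afterwards does d tend to 0. The lower bound in 1/rho survives both limits because its error
    involves only the L^1 mass of the charges times (d/rho)^2.

    The ellipticity hypotheses act through mu <= l', that is 1/mu - 1/l' >= 0: this allows P to be
    dropped, leaving the factor 1/l', while the pointwise size of the kernel is governed by 1/mu.
    The densities are only square integrable and the integral equation holds only almost everywhere,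
    so both are used only inside double integrals. *)

Section has_integral.
Context {d} {T : measurableType d} {R : realType}.
Variable mu : {measure set T -> \bar R}.
Implicit Types (f g : T -> R) (F G : R).

(** The real-valued integral is total, so integrability travels with the value; linear combinations
    are then integrated by assembling a term. *)
Definition has_integral f F : Prop :=
  mu.-integrable setT (EFin \o f) /\ \int[mu]_x f x = F.

Lemma has_integralZ k f F : has_integral f F ->
  has_integral (fun x => k * f x) (k * F).
Proof.
move=> [fi fF]; split; last by rewrite RintegralZl// fF.
rewrite [X in integrable _ _ X](_ : _ = (fun x => k%:E * (EFin \o f) x)%E)//.
exact: integrableZl.
Qed.

Lemma has_integralD f g F G : has_integral f F -> has_integral g G ->
  has_integral (fun x => f x + g x) (F + G).
Proof.
move=> [fi fF] [gi gG]; split; last by rewrite RintegralD// fF gG.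
rewrite [X in integrable _ _ X](_ : _ = (EFin \o f) \+ (EFin \o g))%E//.
exact: integrableD.
Qed.

Lemma has_integral_sum (I : Type) (s : seq I) (f : I -> T -> R) (F : I -> R) :
  (forall i, has_integral (f i) (F i)) ->
  has_integral (fun x => \sum_(i <- s) f i x) (\sum_(i <- s) F i).
Proof.
move=> fF; elim: s => [|i s IH].
  under [in X in has_integral X]eq_fun do rewrite big_nil.
  rewrite big_nil; split; first exact: integrable0.
  by rewrite Rintegral_cst// mul0r.
under [in X in has_integral X]eq_fun do rewrite big_cons.
by rewrite big_cons; exact: has_integralD.
Qed.

Lemma le_has_integral f g F G : (forall x, f x <= g x) ->
  has_integral f F -> has_integral g G -> F <= G.
Proof. by move=> fg [fi <-] [gi <-]; apply: le_Rintegral. Qed.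

End has_integral.

(** * Positive definite kernels *)

Section gauss_integral.
Context {R : realType}.
Local Notation mu := (@lebesgue_measure R).

Lemma has_integral_indic (L m : R) : 0 <= L ->
  has_integral mu (fun x => m * (`|x| <= L)%R%:R) (2 * L * m).
Proof.
move=> L0; have E : (fun x => (`|x| <= L)%R%:R) = \1_(`[- L, L]%classic) :> (R -> R).
  by apply/funext => x; rewrite indicE mem_setE in_itv/= ler_norml.
rewrite mulrC; apply: has_integralZ; rewrite E; split.
  by apply: integrable_indic_itv.
rewrite /Rintegral integral_indic//= setIT lebesgue_measure_itv/= lte_fin.
have [->|L1] := eqVneq L 0; first by rewrite oppr0 ltxx mulr0.
have Lp : 0 < L by rewrite lt_neqAle eq_sym L1.
by rewrite gtrN//= opprK; ring.
Qed.

Lemma has_integral_gauss (a c : R) : 0 < a ->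
  has_integral mu (fun x => expR (- (a * (x - c) ^+ 2))) (Num.sqrt (pi / a)).
Proof.
move=> a0; pose s : R := Num.sqrt (2 * a)^-1.
have s2 : s ^+ 2 *+ 2 = a^-1.
  rewrite sqr_sqrtr ?invr_ge0 ?mulr_ge0 ?ltW// -mulr_natl.
  by field; rewrite gt_eqF.
have s0 : s != 0 by rewrite gt_eqF// sqrtr_gt0 invr_gt0 mulr_gt0.
have E x : normal_fun c s x = expR (- (a * (x - c) ^+ 2)).
  by rewrite /normal_fun s2 invrK mulNr mulrC.
have P : normal_peak s = (Num.sqrt (pi / a))^-1.
  by rewrite /normal_peak -mulrnAl s2 mulrC.
have P0 : Num.sqrt (pi / a) != 0 by rewrite gt_eqF// sqrtr_gt0 divr_gt0 ?pi_gt0.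
have -> : (fun x => expR (- (a * (x - c) ^+ 2))) =
          (fun x => Num.sqrt (pi / a) * normal_pdf c s x).
  apply/funext => x; rewrite normal_pdfE//= P E. by rewrite mulVKf.
rewrite -[X in has_integral _ _ X]mulr1; apply: has_integralZ; split.
  exact: integrable_normal_pdf.
by rewrite /Rintegral integral_normal_pdf.
Qed.

Lemma has_integral_expR_quadratic (a b k : R) : 0 < a ->
  has_integral mu (fun x => expR (- (a * x ^+ 2) + 2 * b * x + k))
    (Num.sqrt (pi / a) * expR (b ^+ 2 / a + k)).
Proof.
move=> a0; rewrite [X in has_integral _ _ X]mulrC.
under [in X in has_integral _ X _]eq_fun => x.
  rewrite (_ : _ + k = b ^+ 2 / a + k + - (a * (x - b / a) ^+ 2)); last first.
    by field; rewrite gt_eqF.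
  rewrite expRD; over.
by apply: has_integralZ; exact: has_integral_gauss.
Qed.

End gauss_integral.

Section gauss_1d.
Context {R : realType} (I : finType).
Variables (c s : I -> R) (b : R).
Hypothesis b0 : 0 < b.

Let g : R := Num.sqrt (pi / b).
Let A (x : R) : R := \sum_i c i * expR (- (2 * b * (x - s i) ^+ 2)).
Let B (x : R) : R := \sum_i `|c i| * expR (- (b * (x - s i) ^+ 2)).
Let Q : R := \sum_i \sum_j c i * c j * expR (- (b * (s i - s j) ^+ 2)).

Let g_gt0 : 0 < g. Proof. by rewrite sqrtr_gt0 divr_gt0 ?pi_gt0. Qed.

Let g2 : g ^+ 2 = pi / b.
Proof. by rewrite sqr_sqrtr// divr_ge0 ?pi_ge0// ltW. Qed.

(** The product of two Gaussians of rate 2b centred at s i and s j is exp(-b (s i - s j)^2) times a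
    Gaussian of rate 4b centred at their midpoint. Thus [Q] is, up to a factor, a squared L^2
    norm. *)
Let has_integral_sqrA : has_integral (@lebesgue_measure R) (fun x => A x ^+ 2) (g / 2 * Q).
Proof.
have -> : g / 2 * Q = \sum_i \sum_j
    c i * c j * expR (- (b * (s i - s j) ^+ 2)) * Num.sqrt (pi / (4 * b)).
  have -> : Num.sqrt (pi / (4 * b)) = g / 2.
    rewrite -[RHS]ger0_norm ?divr_ge0 ?(ltW g_gt0)// -sqrtr_sqr expr_div_n g2.
    by congr Num.sqrt; field; rewrite gt_eqF.
  rewrite /Q mulr_sumr; apply: eq_bigr => i _; rewrite mulr_sumr.
  by apply: eq_bigr => j _; rewrite mulrC.
have -> : (fun x => A x ^+ 2) = fun x => \sum_i \sum_j
    c i * c j * expR (- (b * (s i - s j) ^+ 2)) *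
    expR (- (4 * b * (x - (s i + s j) / 2) ^+ 2)).
  apply/funext => x; rewrite expr2 mulr_suml; apply: eq_bigr => i _.
  rewrite mulr_sumr; apply: eq_bigr => j _.
  rewrite mulrACA -[RHS]mulrA -!expRD; congr (_ * expR _).
  by field.
do 2 (apply: has_integral_sum => ?); apply: has_integralZ.
by apply: has_integral_gauss; rewrite mulr_gt0.
Qed.

Lemma gauss_1d_ge0 : 0 <= Q.
Proof.
have : 0 <= g / 2 * Q.
  rewrite -has_integral_sqrA.2; apply: Rintegral_ge0 => x _; exact: sqr_ge0.
by rewrite pmulr_rge0// divr_gt0.
Qed.

(* Testing the square integrable function [A], whose total mass is
   proportional to [\sum_i c i], against the indicator of [-L, L]. *)
Lemma gauss_1d_ge (L : R) : 0 < L -> (forall i, `|s i| <= L / 2) ->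
  g / (2 * L) * ((\sum_i c i) ^+ 2
    - 4 * expR (- (b * L ^+ 2 / 4)) * (\sum_i `|c i|) ^+ 2) <= Q.
Proof.
move=> L0 sL; set C : R := \sum_i c i; set S : R := \sum_i `|c i|.
set e := expR _; pose h : R := Num.sqrt (pi / (2 * b)).
have h0 : 0 < h by rewrite sqrtr_gt0 divr_gt0 ?pi_gt0// mulr_gt0.
have h2 : h ^+ 2 = g ^+ 2 / 2.
  rewrite g2 sqr_sqrtr; first by field; rewrite gt_eqF.
  by rewrite divr_ge0 ?pi_ge0// mulr_ge0// ltW.
have hg : h <= g.
  rewrite ler_wsqrtr// ler_pM2l ?pi_gt0// lef_pV2 ?posrE ?mulr_gt0//.
  by rewrite ler_peMl ?ler1n// ltW.
have CS : `|C| <= S by exact: ler_norm_sum.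
(* The maximizer of 2 t (C h) - 2 L t^2, that is the total mass C h of [A] averaged over [-L, L]. *)
pose t := C * h / (2 * L).
have IA : has_integral (@lebesgue_measure R) A (C * h).
  rewrite mulr_suml; apply: has_integral_sum => i; apply: has_integralZ.
  by apply: has_integral_gauss; rewrite mulr_gt0.
have IB : has_integral (@lebesgue_measure R) B (S * g).
  rewrite mulr_suml; apply: has_integral_sum => i; apply: has_integralZ.
  exact: has_integral_gauss.
(* Inside [-L, L] this is (A - t)^2 >= 0. Outside, |x - s i| >= L/2: half of each exponent of [A]
   yields the factor [e], the other half is the Gaussian of [B], and the last term absorbs the cross
   term. *)
have /(@le_has_integral _ _ _ lebesgue_measure) : forall x, - t ^+ 2 * (`|x| <= L)%R%:R <=
    A x ^+ 2 + (- (2 * t) * A x + 2 * `|t| * e * B x).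
  move=> x; have B0 : 0 <= 2 * `|t| * e * B x.
    rewrite mulr_ge0 ?mulr_ge0 ?expR_ge0//.
    by apply: sumr_ge0 => i _; rewrite mulr_ge0 ?expR_ge0.
  case: (leP `|x| L) => [_|Lx] /=.
    by have := sqr_ge0 (A x - t); rewrite mulr1; nra.
  rewrite mulr0; suff AB : `|A x| <= e * B x.
    have K : t * A x <= `|t| * (e * B x).
      apply: le_trans (ler_norm _) _; rewrite normrM. by rewrite ler_wpM2l.
    have -> : A x ^+ 2 + (- (2 * t) * A x + 2 * `|t| * e * B x) =
      A x ^+ 2 + 2 * (`|t| * (e * B x) - t * A x) by ring.
    by rewrite addr_ge0 ?sqr_ge0// mulr_ge0// subr_ge0.
  rewrite mulr_sumr; apply: le_trans (ler_norm_sum _ _ _) _.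
  apply: ler_sum => i _; rewrite normrM [leRHS]mulrCA; apply: ler_pM => //.
  rewrite (ger0_norm (expR_ge0 _)) /e -expRD ler_expR.
  have H : L / 2 <= `|x - s i|.
    by have := ler_normD (x - s i) (s i); have := sL i; rewrite subrK; lra.
  have {}H : L / 2 * (L / 2) <= (x - s i) ^+ 2.
    by rewrite -[leRHS]real_normK ?num_real// expr2 ler_pM// divr_ge0// ltW.
  have {}H : b * (L / 2 * (L / 2)) <= b * (x - s i) ^+ 2.
    by rewrite ler_wpM2l// ltW.
  by move: H; rewrite !expr2; lra.
move=> /(_ _ _ (has_integral_indic (- t ^+ 2) (ltW L0))
  (has_integralD has_integral_sqrA (has_integralD (has_integralZ _ IA)
    (has_integralZ _ IB)))).
have nt : `|t| = `|C| * h / (2 * L).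
  by rewrite /t !normrM normfV (gtr0_norm h0) (gtr0_norm (mulr_gt0 _ L0)).
rewrite nt => H.
have {}H : g / 2 * (g / (2 * L)) * (C ^+ 2 - 4 * e * S ^+ 2) <= g / 2 * Q.
  have E1 : 2 * t * (C * h) - 2 * L * t ^+ 2 = g / 2 * (g / (2 * L)) * C ^+ 2.
    have -> : 2 * t * (C * h) - 2 * L * t ^+ 2 = h ^+ 2 * C ^+ 2 / (2 * L).
      by rewrite /t; field; rewrite gt_eqF.
    by rewrite h2; field; rewrite gt_eqF.
  have E2 : 2 * (`|C| * h / (2 * L)) * e * (S * g) <= 
      g / 2 * (g / (2 * L)) * (4 * e * S ^+ 2).
    have -> : g / 2 * (g / (2 * L)) * (4 * e * S ^+ 2) =
       (g * e * S / L) * (g * S) by field; rewrite gt_eqF.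
    have -> : 2 * (`|C| * h / (2 * L)) * e * (S * g) =
       (g * e * S / L) * (h * `|C|) by field; rewrite gt_eqF.
    have S0 : 0 <= S by exact: le_trans CS.
    have E3 : h * `|C| <= g * S by rewrite ler_pM// ltW.
    by rewrite ler_wpM2l// !mulr_ge0// ?invr_ge0 ?expR_ge0// ltW.
  lra.
by move: H; rewrite -mulrA ler_pM2l// divr_gt0.
Qed.

End gauss_1d.

Section gauss_3d.
Context {R : realType} (I : finType).
Implicit Types (C a b k : I -> R) (m : R).

(** Integrates out one variable, 2 being the length of [-1, 1]; the variables still to be integrated
    enter through [m], [b] and [k]. *)
Lemma le_sum_gauss C a b k m : (forall i, 0 < a i) ->
  (forall w : R, m * (`|w| <= 1)%R%:R <=
    \sum_i C i * expR (- (a i * w ^+ 2) + 2 * b i * w + k i)) ->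
  2 * m <= \sum_i C i * (Num.sqrt (pi / a i) * expR (b i ^+ 2 / a i + k i)).
Proof.
move=> a0 /(@le_has_integral _ _ _ lebesgue_measure)/(_ (has_integral_indic _ ler01)); rewrite mulr1; apply.
by apply: has_integral_sum => i; apply: has_integralZ; exact: has_integral_expR_quadratic.
Qed.

Variables (C d1 d2 d3 z1 z2 z3 : I -> R) (b : R).
Hypothesis b0 : 0 <= b.

(* Three successive one-dimensional Gaussian integrations. *)
Lemma le_sum_gauss3 m : 0 <= m ->
  (forall w1 w2 w3 : R, m * (`|w1| <= 1)%R%:R * (`|w2| <= 1)%R%:R * (`|w3| <= 1)%R%:R <=
    \sum_i C i * expR (- (w1 ^+ 2 + w2 ^+ 2 + w3 ^+ 2)
       - b * (w1 * d1 i + w2 * d2 i + w3 * d3 i) ^+ 2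
       + 2 * (w1 * z1 i + w2 * z2 i + w3 * z3 i))) ->
  8 * m <= \sum_i C i *
    (pi * Num.sqrt pi / Num.sqrt (1 + b * (d1 i ^+ 2 + d2 i ^+ 2 + d3 i ^+ 2)) *
    expR (z1 i ^+ 2 + z2 i ^+ 2 + z3 i ^+ 2 -
      b * (z1 i * d1 i + z2 i * d2 i + z3 i * d3 i) ^+ 2 /
      (1 + b * (d1 i ^+ 2 + d2 i ^+ 2 + d3 i ^+ 2)))).
Proof.
move=> m0 H.
(* These are the leading principal minors of I + b d d^T, so their quotients are its elimination
   pivots. The final exponent is z (I + b d d^T)^-1 z^T in Sherman-Morrison form. *)
pose n1 i := 1 + b * d1 i ^+ 2; pose n2 i := n1 i + b * d2 i ^+ 2.
pose n3 i := n2 i + b * d3 i ^+ 2.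
have n1_gt0 i : 0 < n1 i by rewrite ltr_pwDl// mulr_ge0// sqr_ge0.
have n2_gt0 i : 0 < n2 i by rewrite ltr_pwDl// mulr_ge0// sqr_ge0.
have n3_gt0 i : 0 < n3 i by rewrite ltr_pwDl// mulr_ge0// sqr_ge0.
have H1 (w2 w3 : R) : 2 * (m * (`|w2| <= 1)%R%:R * (`|w3| <= 1)%R%:R) <=
    \sum_i C i * Num.sqrt (pi / n1 i) * expR (- (n2 i / n1 i * w2 ^+ 2) +
      2 * (z2 i - b * z1 i * d1 i * d2 i / n1 i - b / n1 i * d2 i * d3 i * w3) * w2 +
      (z1 i ^+ 2 / n1 i - 2 * b * z1 i * d1 i * d3 i * w3 / n1 i - w3 ^+ 2
       - b / n1 i * d3 i ^+ 2 * w3 ^+ 2 + 2 * w3 * z3 i)).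
  under eq_bigr => i _.
    rewrite [X in expR X](_ : _ = (z1 i - b * d1 i * (w2 * d2 i + w3 * d3 i)) ^+ 2 / n1 i +
      (- (w2 ^+ 2 + w3 ^+ 2) - b * (w2 * d2 i + w3 * d3 i) ^+ 2 +
       2 * (w2 * z2 i + w3 * z3 i))); last first.
      by have := n1_gt0 i; rewrite /n2 /n1 => /lt0r_neq0 ?; field.
    rewrite -mulrA; over.
  apply: le_sum_gauss => // w1.
  rewrite [leLHS](_ : _ = m * (`|w1| <= 1)%R%:R * (`|w2| <= 1)%R%:R * (`|w3| <= 1)%R%:R); last by ring.
  apply: le_trans (H w1 w2 w3) _.
  by apply: ler_sum => i _; rewrite le_eqVlt; apply/orP; left; apply/eqP;
     congr (_ * expR _); rewrite /n1; ring.
have H2 (w3 : R) : 2 * (2 * (m * (`|w3| <= 1)%R%:R)) <=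
    \sum_i C i * Num.sqrt (pi / n1 i) * Num.sqrt (pi / (n2 i / n1 i)) *
     expR (- (n3 i / n2 i * w3 ^+ 2) +
      2 * (z3 i - b * (z1 i * d1 i + z2 i * d2 i) * d3 i / n2 i) * w3 +
      (z1 i ^+ 2 + z2 i ^+ 2 - b * (z1 i * d1 i + z2 i * d2 i) ^+ 2 / n2 i)).
  under eq_bigr => i _.
    rewrite [X in expR X](_ : _ = 
      (z2 i - b * z1 i * d1 i * d2 i / n1 i - b / n1 i * d2 i * d3 i * w3) ^+ 2
       / (n2 i / n1 i) +
      (z1 i ^+ 2 / n1 i - 2 * b * z1 i * d1 i * d3 i * w3 / n1 i - w3 ^+ 2
       - b / n1 i * d3 i ^+ 2 * w3 ^+ 2 + 2 * w3 * z3 i)); last first.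
      have := n1_gt0 i; have := n2_gt0 i; rewrite /n3 /n2 /n1.
      by move=> /lt0r_neq0 ? /lt0r_neq0 ?; field; apply/andP.
    rewrite -mulrA; over.
  apply: le_sum_gauss => [i|w2]; first by rewrite divr_gt0.
  apply: le_trans (H1 w2 w3); rewrite le_eqVlt; apply/orP; left; apply/eqP; ring.
have : 2 * (2 * (2 * m)) <= \sum_i C i * Num.sqrt (pi / n1 i) *
     Num.sqrt (pi / (n2 i / n1 i)) * (Num.sqrt (pi / (n3 i / n2 i)) *
     expR ((z3 i - b * (z1 i * d1 i + z2 i * d2 i) * d3 i / n2 i) ^+ 2 / (n3 i / n2 i) +
      (z1 i ^+ 2 + z2 i ^+ 2 - b * (z1 i * d1 i + z2 i * d2 i) ^+ 2 / n2 i))).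
  apply: le_sum_gauss => [i|w3]; first by rewrite divr_gt0.
  apply: le_trans (H2 w3); rewrite le_eqVlt; apply/orP; left; apply/eqP; ring.
rewrite (_ : 2 * (2 * (2 * m)) = 8 * m); last by ring.
move=> /le_trans; apply; apply: ler_sum => i _; rewrite le_eqVlt; apply/orP; left.
apply/eqP; have R3 (c s1 s2 s3 e : R) : c * s1 * s2 * (s3 * e) = c * (s1 * s2 * s3 * e).
  by ring.
rewrite R3; congr (C i * (_ * expR _)).
  rewrite -!sqrtrM ?divr_ge0 ?pi_ge0 ?ltW ?divr_gt0//.
  rewrite -(_ : n3 i = 1 + b * (d1 i ^+ 2 + d2 i ^+ 2 + d3 i ^+ 2)); last first.
    by rewrite /n3 /n2 /n1; ring.
  have -> : pi * Num.sqrt pi / Num.sqrt (n3 i) = Num.sqrt (pi ^+ 2 * (pi / n3 i)).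
    rewrite (sqrtrM _ (sqr_ge0 _)) sqrtr_sqr (ger0_norm (pi_ge0 _)).
    by rewrite (sqrtrM _ (pi_ge0 _)) sqrtrV ?mulrA// ltW.
  have F (p x y z : R) : 0 < x -> 0 < y -> 0 < z ->
      p / x * (p / (y / x)) * (p / (z / y)) = p ^+ 2 * (p / z).
    by move=> /lt0r_neq0 x0 /lt0r_neq0 y0 /lt0r_neq0 z0; field; rewrite x0 y0 z0.
  by rewrite F.
  by rewrite mulr_gt0 ?divr_gt0 ?pi_gt0.
have F (x y z p q r n : R) : 0 < n -> 0 < n + b * z ^+ 2 ->
    (r - b * (p * x + q * y) * z / n) ^+ 2 / ((n + b * z ^+ 2) / n) + (p ^+ 2 + q ^+ 2 - b * (p * x + q * y) ^+ 2 / n) =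
    p ^+ 2 + q ^+ 2 + r ^+ 2 - b * (p * x + q * y + r * z) ^+ 2 / (n + b * z ^+ 2).
  by move=> /lt0r_neq0 n0 /lt0r_neq0 n'0; field; rewrite n0 n'0.
apply: etrans (F (d1 i) (d2 i) (d3 i) (z1 i) (z2 i) (z3 i) (n2 i) (n2_gt0 i) (n3_gt0 i)) _.
by congr (_ - _ / _); rewrite /n2 /n1; ring.
Qed.

End gauss_3d.

Section vectors3.
Context {R : realType}.
Implicit Types (u v w x y : 'rV[R]_3).

Definition dot u v : R := \sum_(i < 3) u 0 i * v 0 i.

Definition row3 (a b c : R) : 'rV[R]_3 := \row_(i < 3) [:: a; b; c]`_i.

Local Notation i1 := (lift ord0 ord0 : 'I_3).
Local Notation i2 := (lift ord0 (lift ord0 ord0) : 'I_3).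

Lemma dotE u v : dot u v = u 0 0 * v 0 0 + u 0 i1 * v 0 i1 + u 0 i2 * v 0 i2.
Proof. by rewrite /dot !big_ord_recl big_ord0 addr0 addrA. Qed.

Lemma dotvv u : dot u u = u 0 0 ^+ 2 + u 0 i1 ^+ 2 + u 0 i2 ^+ 2.
Proof. by rewrite dotE !expr2. Qed.

Lemma row3E a b c :
  (row3 a b c 0 0 = a) * (row3 a b c 0 i1 = b) * (row3 a b c 0 i2 = c).
Proof. by rewrite !mxE. Qed.

Lemma dot_ge0 u : 0 <= dot u u.
Proof. by apply: sumr_ge0 => i _; rewrite -expr2 sqr_ge0. Qed.

End vectors3.

Section positive_definite_kernels.
Context {R : realType}.
Implicit Types (u v w : 'rV[R]_3) (d : R).

Local Notation i1 := (lift ord0 ord0 : 'I_3).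
Local Notation i2 := (lift ord0 (lift ord0 ord0) : 'I_3).

Definition rdist d u : R := Num.sqrt (d ^+ 2 + dot u u).

Lemma rdist_gt0 d u : 0 < d -> 0 < rdist d u.
Proof.
by move=> d0; rewrite sqrtr_gt0 ltr_pwDl ?dot_ge0// exprn_gt0.
Qed.

Lemma rdist2 d u : rdist d u ^+ 2 = d ^+ 2 + dot u u.
Proof. by rewrite sqr_sqrtr// addr_ge0 ?sqr_ge0 ?dot_ge0. Qed.

Lemma sqrt_rdist d u : 0 < d -> Num.sqrt (1 + (d ^+ 2)^-1 * dot u u) = rdist d u / d.
Proof.
move=> d0; rewrite -[RHS]ger0_norm ?divr_ge0 ?ltW ?rdist_gt0// -sqrtr_sqr.
by congr Num.sqrt; rewrite expr_div_n rdist2; field; rewrite gt_eqF.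
Qed.

(** Up to a factor independent of u, 1 / [rdist d u] is the integral over w of exp(-|w|^2 - (w.u)^2
    / d^2). For fixed w the double sum is a one-dimensional Gaussian sum at the points w.x a:
    nonnegative for all w, and bounded below by [gauss_1d_ge] on the cube |w_i| <= 1, whose volume
    is 8 and where exp(-|w|^2) >= exp(-3). *)
Lemma psd_inv_rdist_margin (I : finType) (x : I -> 'rV[R]_3) (c : I -> R) (d rho : R) :
  0 < d -> 0 < rho -> (forall a i, `|x a 0 i| <= rho) ->
  8 * expR (-3) / (12 * pi) / rho *
    ((\sum_a c a) ^+ 2 - 4 * expR (- (9 * rho ^+ 2 / d ^+ 2)) * (\sum_a `|c a|) ^+ 2)
  <= \sum_a \sum_b c a * c b / rdist d (x a - x b).
Proof.
move=> d0 rho0 xrho; set M : R := _ - _.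
have d2 : 0 < d ^+ 2 by rewrite exprn_gt0.
(* [M] may be negative while [le_sum_gauss3] asks for a nonnegative [m]; the Gaussian sum dominates
   both arguments of the maximum. *)
pose m := Num.max 0 (Num.sqrt (pi / (d ^+ 2)^-1) / (2 * (6 * rho)) * M).
have m0 : 0 <= m by rewrite /m le_max lexx.
have b0 : 0 <= (d ^+ 2)^-1 by rewrite invr_ge0 ltW.
have := @le_sum_gauss3 R (I * I)%type (fun p => c p.1 * c p.2)
  (fun p => (x p.1 - x p.2) 0 0) (fun p => (x p.1 - x p.2) 0 i1)
  (fun p => (x p.1 - x p.2) 0 i2) (fun=> 0) (fun=> 0) (fun=> 0) _ b0 (expR (-3) * m).
rewrite mulr_ge0 ?expR_ge0// => /(_ isT).
have K (w1 w2 w3 : R) : expR (-3) * m * (`|w1| <= 1)%R%:R * (`|w2| <= 1)%R%:R * (`|w3| <= 1)%R%:R <=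
  \sum_(p : I * I) c p.1 * c p.2 * expR (- (w1 ^+ 2 + w2 ^+ 2 + w3 ^+ 2)
    - (d ^+ 2)^-1 * (w1 * (x p.1 - x p.2) 0 0 + w2 * (x p.1 - x p.2) 0 i1 +
        w3 * (x p.1 - x p.2) 0 i2) ^+ 2 + 2 * (w1 * 0 + w2 * 0 + w3 * 0)).
  pose s a := w1 * x a 0 0 + w2 * x a 0 i1 + w3 * x a 0 i2.
  rewrite [leRHS](_ : _ = expR (- (w1 ^+ 2 + w2 ^+ 2 + w3 ^+ 2)) *
      \sum_a \sum_b c a * c b * expR (- ((d ^+ 2)^-1 * (s a - s b) ^+ 2))); last first.
    rewrite pair_bigA mulr_sumr; apply: eq_bigr => -[a b] _ /=.
    rewrite [RHS]mulrCA -expRD; congr (_ * expR _); rewrite !mxE /s; ring.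
  have Q0 := gauss_1d_ge0 c s (ltac:(by rewrite invr_gt0) : 0 < (d ^+ 2)^-1).
  have [/and3P[h1 h2 h3]|] := boolP [&& `|w1| <= 1, `|w2| <= 1 & `|w3| <= 1]; last first.
    move=> nh; rewrite [leLHS](_ : _ = 0) ?mulr_ge0 ?expR_ge0//.
    by move: nh; do 3 case: (_ <= 1) => //=; rewrite ?(mulr0, mul0r).
  rewrite h1 h2 h3 !mulr1; apply: ler_pM; rewrite ?expR_ge0//.
    have s1 (w : R) : `|w| <= 1 -> w ^+ 2 <= 1 by move=> ?; rewrite -real_normK ?num_real// expr_le1.
    rewrite ler_expR lerN2; have := s1 _ h1; have := s1 _ h2; have := s1 _ h3; lra.
  rewrite /m ge_max Q0/=.
  (* On the cube |w.x a| <= 3 rho, so L = 6 rho: this is the origin of 12 = 2 * 6 and of 9 = 6^2 / 4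
     in the statement. *)
  have sL a : `|s a| <= 6 * rho / 2.
    have F (w : R) i : `|w| <= 1 -> `|w * x a 0 i| <= rho.
      by move=> w1'; rewrite normrM -[leRHS]mul1r ler_pM.
    rewrite (_ : 6 * rho / 2 = rho + rho + rho); last by field.
    apply: le_trans (ler_normD _ _) _; apply: lerD; last exact: F.
    by apply: le_trans (ler_normD _ _) _; apply: lerD; exact: F.
  have b1 : 0 < (d ^+ 2)^-1 by rewrite invr_gt0.
  have := @gauss_1d_ge R I c s _ b1 _ (mulr_gt0 (ltr0Sn _ 5) rho0) sL.
  by rewrite (_ : _ / 4 = 9 * rho ^+ 2 / d ^+ 2)//; field; rewrite gt_eqF.
move=> /(_ K) {}K.
have {K} : 8 * (expR (-3) * m) <= d * (pi * Num.sqrt pi) *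
    \sum_a \sum_b c a * c b / rdist d (x a - x b).
  apply: le_trans K _; rewrite le_eqVlt; apply/orP; left; apply/eqP.
  rewrite pair_bigA mulr_sumr; apply: eq_bigr => -[a b] _ /=.
  rewrite -dotvv sqrt_rdist// !mul0r !addr0 !expr0n /= !addr0 mulr0 mul0r subrr expR0.
  field; rewrite !gt_eqF ?rdist_gt0//.
have Mm : Num.sqrt (pi / (d ^+ 2)^-1) / (2 * (6 * rho)) * M <= m by rewrite /m le_max lexx orbT.
rewrite invrK sqrtrM ?pi_ge0// sqrtr_sqr ger0_norm in Mm; last exact: ltW.
move=> H; have {}H : 8 * (expR (-3) * (Num.sqrt pi * d / (2 * (6 * rho)) * M)) <=
   d * (pi * Num.sqrt pi) * \sum_a \sum_b c a * c b / rdist d (x a - x b).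
  by apply: le_trans H; rewrite !ler_pM2l ?expR_gt0.
have P0 : 0 < d * (pi * Num.sqrt pi) by rewrite !mulr_gt0 ?sqrtr_gt0 ?pi_gt0.
rewrite -(ler_pM2l P0); apply: le_trans H; rewrite le_eqVlt; apply/orP; left; apply/eqP.
move: (pi_gt0 R); move: (pi : R) (Num.sqrt pi) => p q p0.
by field; rewrite !gt_eqF.
Qed.

End positive_definite_kernels.

Section psd_stokeslet.
Context {R : realType}.
Implicit Types (u v w : 'rV[R]_3) (d : R).
Local Notation i1 := (lift ord0 ord0 : 'I_3).
Local Notation i2 := (lift ord0 (lift ord0 ord0) : 'I_3).

(** Since exp(-t) >= 1 - t, it suffices to compare with 1 / (1 - t); clearing the denominator leaves
    t^2 (1 - 2 t) >= 0. *)
Let expR_le_quadratic (t : R) : t <= 2^-1 -> expR t <= 1 + t + 2 * t ^+ 2.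
Proof.
move=> th; have t1 : 0 < 1 - t by lra.
have : expR t <= (1 - t)^-1.
  by rewrite -[leLHS]invrK lef_pV2 ?posrE ?invr_gt0 ?expR_gt0// -expRN expR_ge1Dx.
move/le_trans; apply; rewrite -[leLHS]mul1r ler_pdivrMr//.
have := sqr_ge0 t; nra.
Qed.

Let ge0_of_perturbation (F G t0 : R) : 0 < t0 ->
  (forall t, 0 < t -> t <= t0 -> 0 <= F + t * G) -> 0 <= F.
Proof.
move=> t00 H; rewrite leNgt; apply/negP => F0.
pose t := Num.min t0 (- F / (2 * (`|G| + 1))).
have G1 : 0 < `|G| + 1 by rewrite ltr_wpDl.
have t_gt0 : 0 < t by rewrite lt_min t00 divr_gt0 ?oppr_gt0 ?mulr_gt0.
have := H t t_gt0; rewrite ge_min lexx => /(_ isT).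
have : t * G <= - F / 2.
  apply: le_trans (_ : t * (`|G| + 1) <= _).
    by rewrite ler_wpM2l ?(ltW t_gt0)// (le_trans (ler_norm _))// lerDl.
  by rewrite -ler_pdivlMr// /t ge_min -mulrA -invfM lexx orbT.
lra.
Qed.

(* [d |u| -> rdist d u] is convex, with Hessian [I / R - u u^T / R^3]. *)
Definition hessian_form d u v w : R :=
  dot v w / rdist d u - dot v u * dot w u / rdist d u ^+ 3.

(* The tilted point masses [exp (2 h w.(+-v))] give this quadratic form as
   a limit of nonnegative ones when [h -> 0]; [t] stands for [h ^ 2]. *)
Lemma psd_hessian_form (I : finType) (x v : I -> 'rV[R]_3) d : 0 < d ->
  0 <= \sum_a \sum_b hessian_form d (x a - x b) (v a) (v b).
Proof.
move=> d0; have d2 : 0 < d ^+ 2 by rewrite exprn_gt0.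
have b0 : 0 < (d ^+ 2)^-1 by rewrite invr_gt0.
(* The exponent z (I + u u^T / d^2)^-1 z^T produced by the Gaussian integration. *)
pose N u z := dot z z - (d ^+ 2)^-1 * dot z u ^+ 2 / (1 + (d ^+ 2)^-1 * dot u u).
pose u a b := x a - x b.
pose Z a b := (rdist d (u a b))^-1.
have Z0 a b : 0 <= Z a b by rewrite invr_ge0 ltW// rdist_gt0.
have NN p z : N p (- z) = N p z by rewrite /N !dotE !mxE; congr (_ - _ * _ / _); ring.
(* Each x a carries a charge +1 and a charge -1, tilted by exp(2 h w.v a) and exp(-2 h w.v a). Equal
   signs pair to v a + v b, opposite signs to v a - v b, up to an overall sign that [N] ignores. *)
have main h : 0 <= \sum_a \sum_b Z a b *
    (expR (h ^+ 2 * N (u a b) (v a + v b)) - expR (h ^+ 2 * N (u a b) (v a - v b))).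
  pose sg (s : bool) : R := (-1) ^+ s.
  pose J : finType := (I * bool)%type.
  pose z (p : J * J) := h *: (sg p.1.2 *: v p.1.1 + sg p.2.2 *: v p.2.1).
  have := @le_sum_gauss3 R (J * J)%type (fun p => sg p.1.2 * sg p.2.2)
    (fun p => (u p.1.1 p.2.1) 0 0) (fun p => (u p.1.1 p.2.1) 0 i1)
    (fun p => (u p.1.1 p.2.1) 0 i2) (fun p => z p 0 0) (fun p => z p 0 i1)
    (fun p => z p 0 i2) _ (ltW b0) 0 (lexx _).
  have K (w1 w2 w3 : R) : 0 * (`|w1| <= 1)%R%:R * (`|w2| <= 1)%R%:R * (`|w3| <= 1)%R%:R <=
    \sum_(p : J * J) sg p.1.2 * sg p.2.2 * expR (- (w1 ^+ 2 + w2 ^+ 2 + w3 ^+ 2)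
      - (d ^+ 2)^-1 * (w1 * (u p.1.1 p.2.1) 0 0 + w2 * (u p.1.1 p.2.1) 0 i1 +
        w3 * (u p.1.1 p.2.1) 0 i2) ^+ 2 + 2 * (w1 * z p 0 0 + w2 * z p 0 i1 + w3 * z p 0 i2)).
    rewrite !mul0r; pose s (p : J) := w1 * x p.1 0 0 + w2 * x p.1 0 i1 + w3 * x p.1 0 i2.
    pose e (p : J) := w1 * v p.1 0 0 + w2 * v p.1 0 i1 + w3 * v p.1 0 i2.
    rewrite [leRHS](_ : _ = expR (- (w1 ^+ 2 + w2 ^+ 2 + w3 ^+ 2)) *
      \sum_p \sum_q (sg p.2 * expR (2 * h * sg p.2 * e p)) *
         (sg q.2 * expR (2 * h * sg q.2 * e q)) *
         expR (- ((d ^+ 2)^-1 * (s p - s q) ^+ 2))); last first.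
      rewrite pair_bigA mulr_sumr; apply: eq_bigr => -[p q] _ /=.
      have R4 (r t W A B D : R) : expR W * (r * expR A * (t * expR B) * expR D) =
          r * t * expR (W + D + A + B) by rewrite !expRD; ring.
      by rewrite R4; congr (_ * expR _); rewrite /z /u !mxE /s /e /=; ring.
    by rewrite mulr_ge0 ?expR_ge0// gauss_1d_ge0.
  move=> /(_ K); rewrite mulr0 (_ : \sum_(p : J * J) _ =
     2 * (d * (pi * Num.sqrt pi)) * \sum_a \sum_b Z a b *
    (expR (h ^+ 2 * N (u a b) (v a + v b)) - expR (h ^+ 2 * N (u a b) (v a - v b)))).
    by rewrite pmulr_rge0// !mulr_gt0 ?sqrtr_gt0 ?pi_gt0.
  rewrite -(pair_bigA _ (fun p q => sg p.2 * sg q.2 *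
    (pi * Num.sqrt pi / Num.sqrt (1 + (d ^+ 2)^-1 * (u p.1 q.1 0 0 ^+ 2 + u p.1 q.1 0 i1 ^+ 2 + u p.1 q.1 0 i2 ^+ 2)) *
    expR (z (p, q) 0 0 ^+ 2 + z (p, q) 0 i1 ^+ 2 + z (p, q) 0 i2 ^+ 2 -
     (d ^+ 2)^-1 * (z (p, q) 0 0 * u p.1 q.1 0 0 + z (p, q) 0 i1 * u p.1 q.1 0 i1 + z (p, q) 0 i2 * u p.1 q.1 0 i2) ^+ 2
     / (1 + (d ^+ 2)^-1 * (u p.1 q.1 0 0 ^+ 2 + u p.1 q.1 0 i1 ^+ 2 + u p.1 q.1 0 i2 ^+ 2)))))).
  transitivity (\sum_(p : J) \sum_(q : J) sg p.2 * sg q.2 * (d * (pi * Num.sqrt pi)) *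
     (Z p.1 q.1 * expR (h ^+ 2 * N (u p.1 q.1) (sg p.2 *: v p.1 + sg q.2 *: v q.1)))).
    apply: eq_bigr => p _; apply: eq_bigr => q _.
    rewrite -!dotvv -dotE sqrt_rdist// /Z.
    rewrite -!mulrA; congr (_ * (_ * _)); rewrite invf_div !mulrA.
    rewrite (_ : _ - _ = h ^+ 2 * N (u p.1 q.1) (sg p.2 *: v p.1 + sg q.2 *: v q.1)); last first.
      by rewrite /N /z !dotE !mxE; ring.
    by ring.
  rewrite -(pair_bigA _ (fun a s => \sum_(q : J) sg s * sg q.2 * (d * (pi * Num.sqrt pi)) *
     (Z a q.1 * expR (h ^+ 2 * N (u a q.1) (sg s *: v a + sg q.2 *: v q.1))))).
  rewrite mulr_sumr; apply: eq_bigr => a _.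
  under eq_bigr => s _ do rewrite -(pair_bigA _ (fun b t => sg s * sg t * (d * (pi * Num.sqrt pi)) *
     (Z a b * expR (h ^+ 2 * N (u a b) (sg s *: v a + sg t *: v b))))).
  rewrite exchange_big mulr_sumr; apply: eq_bigr => b _.
  rewrite !big_bool /sg /= !expr0 !expr1 !scaleN1r !scale1r.
  rewrite -opprD NN (_ : - v a + v b = - (v a - v b)); last by rewrite opprB addrC.
  by rewrite NN; ring.
pose T := 1 + \sum_a \sum_b (`|N (u a b) (v a + v b)|).
have T0 : 0 < T.
  by rewrite ltr_pwDl//; apply: sumr_ge0 => a _; apply: sumr_ge0.
(* Polarization: the first-order term in h^2 is four times the bilinear form of [N u], which divided
   by [rdist] is [hessian_form]. *)
have lin : \sum_a \sum_b hessian_form d (x a - x b) (v a) (v b) =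
    4^-1 * \sum_a \sum_b Z a b * (N (u a b) (v a + v b) - N (u a b) (v a - v b)).
  rewrite mulr_sumr; apply: eq_bigr => a _; rewrite mulr_sumr; apply: eq_bigr => b _.
  rewrite /hessian_form -/(u a b) /Z.
  have r0 := rdist_gt0 (u a b) d0.
  have E : 1 + (d ^+ 2)^-1 * dot (u a b) (u a b) = rdist d (u a b) ^+ 2 / d ^+ 2.
    by rewrite rdist2; field; rewrite gt_eqF.
  rewrite /N E; move: r0; move: (rdist d (u a b)) => r r0.
  have -> : dot (v a + v b) (v a + v b) = dot (v a - v b) (v a - v b) + 4 * dot (v a) (v b).
    by rewrite !dotE !mxE; ring.
  have -> : dot (v a + v b) (u a b) = dot (v a) (u a b) + dot (v b) (u a b).
    by rewrite !dotE !mxE; ring.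
  have -> : dot (v a - v b) (u a b) = dot (v a) (u a b) - dot (v b) (u a b).
    by rewrite !dotE !mxE; ring.
  by field; rewrite !gt_eqF.
rewrite lin mulr_ge0//.
(* For t <= 1 / (2 T) each exponent t N(v a + v b) is at most 1/2. The added exponentials are
   bounded above by [expR_le_quadratic] and the subtracted ones below by 1 + x, so [main] becomes t
   (F + t G) >= 0 with G collecting the quadratic remainders. *)
apply: (@ge0_of_perturbation _
  (2 * \sum_a \sum_b Z a b * N (u a b) (v a + v b) ^+ 2) (2 * T)^-1).
  by rewrite invr_gt0 mulr_gt0.
move=> t t_gt0 tT; rewrite -(pmulr_rge0 _ t_gt0); apply: le_trans (main (Num.sqrt t)) _.
rewrite sqr_sqrtr; last exact: ltW.
rewrite mulrDr !mulr_sumr -big_split /=; apply: ler_sum => a _.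
rewrite !mulr_sumr -big_split /=; apply: ler_sum => b _.
have NT : t * N (u a b) (v a + v b) <= 2^-1.
  apply: le_trans (ler_norm _) _; rewrite normrM (gtr0_norm t_gt0).
  apply: le_trans (_ : t * T <= _).
    rewrite ler_wpM2l ?(ltW t_gt0)// /T (bigD1 a)//= (bigD1 b)//= addrCA -addrA lerDl.
    apply: addr_ge0; first exact: sumr_ge0.
    by apply: addr_ge0 => //; apply: sumr_ge0 => i _; apply: sumr_ge0.
  apply: le_trans (_ : (2 * T)^-1 * T <= _); first by rewrite ler_wpM2r// ltW.
  by rewrite invfM -mulrA mulVf ?mulr1// gt_eqF.
have := expR_le_quadratic NT; have := expR_ge1Dx (t * N (u a b) (v a - v b)).
move: (expR _) (expR _) => e1 e2 H1 H2.
rewrite [leRHS](_ : _ = Z a b * (t * N (u a b) (v a + v b) - t * N (u a b) (v a - v b)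
   + 2 * (t * N (u a b) (v a + v b)) ^+ 2)); last by ring.
apply: ler_wpM2l => //; lra.
Qed.

(** The vectors fed to [hessian_form] are the cross products e x v with the three unit vectors e.
    Summed over e, the first term gives 2 v.w and the second (v x u).(w x u) = (v.w)|u|^2 -
    (v.u)(w.u). This is P = (Laplacian I - Hessian) |u|, and it dictates the smoothing 2/R -
    |u|^2/R^3 of 1/|u|. *)
Lemma psd_stokeslet (I : finType) (x v : I -> 'rV[R]_3) d : 0 < d ->
  0 <= \sum_a \sum_b
    (dot (v a) (v b) * (2 / rdist d (x a - x b)
       - dot (x a - x b) (x a - x b) / rdist d (x a - x b) ^+ 3)
     + dot (v a) (x a - x b) * dot (v b) (x a - x b) / rdist d (x a - x b) ^+ 3).
Proof.
move=> d0; rewrite (_ : \sum_a _ =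
  \sum_a \sum_b hessian_form d (x a - x b) (row3 0 (- v a 0 i2) (v a 0 i1)) (row3 0 (- v b 0 i2) (v b 0 i1)) +
  (\sum_a \sum_b hessian_form d (x a - x b) (row3 (v a 0 i2) 0 (- v a 0 0)) (row3 (v b 0 i2) 0 (- v b 0 0)) +
  \sum_a \sum_b hessian_form d (x a - x b) (row3 (- v a 0 i1) (v a 0 0) 0) (row3 (- v b 0 i1) (v b 0 0) 0))).
  by rewrite !addr_ge0 ?psd_hessian_form.
rewrite -!big_split; apply: eq_bigr => a _; rewrite -!big_split; apply: eq_bigr => b _.
rewrite /hessian_form /=; move: (rdist _ _)^-1 (rdist d (x a - x b) ^+ 3)^-1 => r r3.
by rewrite !dotE !row3E; ring.
Qed.

End psd_stokeslet.

Section kelvin_kernel.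
Context {R : realType}.
Implicit Types (u v : 'rV[R]_3) (d mu lp : R) (i j : 'I_3).

Lemma sqr_le_dot u i : u 0 i ^+ 2 <= dot u u.
Proof.
rewrite /dot (bigD1 i)//= -expr2 lerDl; apply: sumr_ge0 => k _.
by rewrite -expr2 sqr_ge0.
Qed.

Lemma norm_le_rdist d u i : `|u 0 i| <= rdist d u.
Proof.
rewrite -sqrtr_sqr ler_wsqrtr// (le_trans (sqr_le_dot u i))//.
by rewrite lerDr sqr_ge0.
Qed.

Lemma rdist_ge0 d u : 0 <= rdist d u. Proof. exact: sqrtr_ge0. Qed.

Lemma rdist_ge_rdist0 d u : rdist 0 u <= rdist d u.
Proof. by rewrite ler_wsqrtr// expr0n/= add0r lerDr sqr_ge0. Qed.

Lemma rdist_ge_reg d u : 0 <= d -> d <= rdist d u.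
Proof.
by move=> d0; rewrite -[leLHS]ger0_norm// -sqrtr_sqr ler_wsqrtr// lerDl dot_ge0.
Qed.

(* For [d = 0] this is the Kelvin matrix, with [lp] for [lambda + 2 mu]. *)
Definition kelvin_reg mu lp d u i j : R :=
  (8 * pi)^-1 * ((mu^-1 - lp^-1) *
     ((i == j)%:R * (2 / rdist d u - dot u u / rdist d u ^+ 3)
      + u 0 i * u 0 j / rdist d u ^+ 3)
   + lp^-1 * (2 * (i == j)%:R / rdist d u)).

Lemma norm_kelvin_reg_le mu lp d u i j : 0 < mu -> mu <= lp ->
  `|kelvin_reg mu lp d u i j| <= mu^-1 / rdist d u.
Proof.
move=> mu0 mulp; have lp0 : 0 < lp by exact: lt_le_trans mulp.
(* When r = 0 the convention 0^-1 = 0 makes both sides vanish, so the bound holds on the diagonal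
   too. *)
set r := rdist d u; have [r0|r0] := eqVneq r 0.
  by rewrite /kelvin_reg -/r r0 expr0n/= !invr0 !(mulr0, subr0, addr0) normr0.
have rp : 0 < r by rewrite lt_neqAle eq_sym r0 rdist_ge0.
have A0 : 0 <= mu^-1 - lp^-1 by rewrite subr_ge0 lef_pV2.
have B0 : 0 <= lp^-1 by rewrite invr_ge0 ltW.
have E1 : 0 <= dot u u / r ^+ 3 <= r^-1.
  apply/andP; split; first by rewrite divr_ge0 ?dot_ge0 ?exprn_ge0 ?ltW.
  rewrite ler_pdivrMr ?exprn_gt0// (_ : r^-1 * r ^+ 3 = r ^+ 2); last by field.
  by rewrite /r rdist2 lerDr sqr_ge0.
have E2 : `|u 0 i * u 0 j / r ^+ 3| <= r^-1.
  rewrite normf_div (ger0_norm (exprn_ge0 3 (ltW rp))).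
  rewrite ler_pdivrMr ?exprn_gt0// (_ : r^-1 * r ^+ 3 = r * r); last by field.
  by rewrite normrM ler_pM ?norm_le_rdist.
have Hb : `|(i == j)%:R : R| <= 1 by case: (i == j); rewrite ?normr1 ?normr0.
have E3 : `|(i == j)%:R * (2 / r - dot u u / r ^+ 3)| <= 2 / r.
  rewrite normrM; apply: le_trans (_ : 1 * `|2 / r - dot u u / r ^+ 3| <= _).
    by rewrite ler_wpM2r.
  move/andP: E1 => [? ?]; rewrite mul1r ler_norml; apply/andP; split; lra.
have E4 : `|2 * (i == j)%:R / r| <= 2 / r.
  rewrite normf_div normrM (gtr0_norm rp) ger0_norm//.
  by rewrite ler_wpM2r ?invr_ge0 ?(ltW rp)// -[leRHS]mulr1 ler_wpM2l.
have p8 : 0 < (8 * pi : R) by rewrite mulr_gt0 ?pi_gt0.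
have p81 : (8 * pi : R)^-1 * 3 <= 1.
  rewrite mulrC ler_pdivrMr// mul1r; have := pi_ge2 R; lra.
rewrite /kelvin_reg -/r normrM gtr0_norm ?invr_gt0//.
apply: le_trans (_ : (8 * pi)^-1 * (3 * (mu^-1 / r)) <= _); last first.
  by rewrite mulrA -[leRHS]mul1r ler_wpM2r// divr_ge0 ?invr_ge0// ltW.
rewrite ler_pM2l ?invr_gt0//.
apply: le_trans (_ : (mu^-1 - lp^-1) * (3 / r) + lp^-1 * (2 / r) <= _); last first.
  rewrite -subr_ge0 (_ : _ - _ = lp^-1 / r); last by ring.
  by rewrite divr_ge0 ?(ltW rp).
apply: le_trans (ler_normD _ _) _; rewrite !normrM (ger0_norm A0) (ger0_norm B0).
apply: lerD; last by rewrite -!normrM ler_wpM2l.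
rewrite ler_wpM2l//; apply: le_trans (ler_normD _ _) _.
rewrite (_ : 3 / r = 2 / r + r^-1); last by ring.
exact: lerD.
Qed.

(** Serves twice: at fixed d > 0 with positions converging along the grids, then at a fixed
    off-diagonal position with d tending to 0. *)
Lemma cvg_kelvin_reg mu lp (d_ : R^nat) (u_ : nat -> 'rV[R]_3) d u i j :
  d_ @ \oo --> d -> (forall k, u_ n 0 k @[n --> \oo] --> u 0 k) ->
  rdist d u != 0 ->
  kelvin_reg mu lp (d_ n) (u_ n) i j @[n --> \oo] --> kelvin_reg mu lp d u i j.
Proof.
move=> dd uu r0.
have Ddot : dot (u_ n) (u_ n) @[n --> \oo] --> dot u u.
  rewrite dotE; under eq_fun do rewrite dotE.
  by apply: cvgD; [apply: cvgD|]; apply: cvgM.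
have Dr : rdist (d_ n) (u_ n) @[n --> \oo] --> rdist d u.
  apply: (cvg_comp _ Num.sqrt); last exact: sqrt_continuous.
  apply: cvgD => //; rewrite expr2; under eq_fun do rewrite expr2; exact: cvgM.
have Dr1 : (rdist (d_ n) (u_ n))^-1 @[n --> \oo] --> (rdist d u)^-1 by exact: cvgV.
have Dr3 : (rdist (d_ n) (u_ n) ^+ 3)^-1 @[n --> \oo] --> (rdist d u ^+ 3)^-1.
  rewrite -exprVn !exprS expr0 mulr1; under eq_fun do rewrite -exprVn !exprS expr0 mulr1.
  by do 2 (apply: cvgM => //).
have D1 : (i == j)%:R * (2 / rdist (d_ n) (u_ n)
      - dot (u_ n) (u_ n) / rdist (d_ n) (u_ n) ^+ 3) @[n --> \oo] -->
    (i == j)%:R * (2 / rdist d u - dot u u / rdist d u ^+ 3).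
  apply: cvgM; first exact: cvg_cst.
  by apply: cvgB; [apply: cvgM => //; exact: cvg_cst|exact: cvgM].
have D2 : u_ n 0 i * u_ n 0 j / rdist (d_ n) (u_ n) ^+ 3 @[n --> \oo] -->
    u 0 i * u 0 j / rdist d u ^+ 3.
  by apply: cvgM => //; apply: cvgM.
apply: cvgM; first exact: cvg_cst.
apply: cvgD; apply: cvgM; [exact: cvg_cst|exact: cvgD|exact: cvg_cst|].
by apply: cvgM => //; exact: cvg_cst.
Qed.

(** The constant of [psd_inv_rdist_margin] times 2 / (8 pi), the weight of the isotropic term I /
    (l' r) of the Kelvin matrix. *)
Definition margin_const : R := 8 * expR (-3) / (12 * pi) / (4 * pi).

Lemma margin_const_gt0 : 0 < margin_const.
Proof. by rewrite !divr_gt0 ?mulr_gt0 ?expR_gt0 ?pi_gt0. Qed.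

(** The P part, of weight 1/mu - 1/lp >= 0, is dropped and the isotropic part kept. The error exp(-9
    rho^2/d^2) is weakened to d^2/rho^2 through exp(y) >= 1 + y; it still vanishes with d. *)
Lemma kelvin_reg_margin (I : finType) (x : I -> 'rV[R]_3) (v : I -> 'I_3 -> R) mu lp d rho :
  0 < mu -> mu <= lp -> 0 < d -> 0 < rho -> (forall a i, `|x a 0 i| <= rho) ->
  margin_const / (lp * rho) *
    \sum_i ((\sum_a v a i) ^+ 2 - 4 * (d ^+ 2 / rho ^+ 2) * (\sum_a `|v a i|) ^+ 2)
  <= \sum_a \sum_b \sum_i \sum_j v a i * v b j * kelvin_reg mu lp d (x a - x b) i j.
Proof.
move=> mu0 mulp d0 rho0 xr; have lp0 : 0 < lp by exact: lt_le_trans mulp.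
pose w a : 'rV[R]_3 := \row_i v a i.
have -> : \sum_a \sum_b \sum_i \sum_j v a i * v b j * kelvin_reg mu lp d (x a - x b) i j =
  (8 * pi)^-1 * (mu^-1 - lp^-1) * \sum_a \sum_b
    (dot (w a) (w b) * (2 / rdist d (x a - x b)
       - dot (x a - x b) (x a - x b) / rdist d (x a - x b) ^+ 3)
     + dot (w a) (x a - x b) * dot (w b) (x a - x b) / rdist d (x a - x b) ^+ 3) +
  \sum_i ((4 * pi)^-1 * lp^-1 * \sum_a \sum_b v a i * v b i / rdist d (x a - x b)).
  rewrite -[X in _ = _ + X]mulr_sumr [X in _ = _ + _ * X]exchange_big/= !mulr_sumr.
  rewrite -big_split; apply: eq_bigr => a _ /=.
  rewrite [X in _ = _ + _ * X]exchange_big/= !mulr_sumr.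
  rewrite -big_split; apply: eq_bigr => b _ /=.
  rewrite /kelvin_reg; move: (rdist _ _)^-1 (rdist d (x a - x b) ^+ 3)^-1 => r r3.
  move: (dot (x a - x b) (x a - x b)) => r2.
  have -> : (8 * pi : R)^-1 = (4 * pi)^-1 / 2 by rewrite -invfM; congr (_ ^-1); ring.
  move: (4 * pi)^-1 => p4.
  by rewrite !dotE !big_ord_recl !big_ord0 !mxE /=; field; rewrite !gt_eqF.
have P := psd_stokeslet x w d0.
apply: le_trans (_ : 0 + \sum_i ((4 * pi)^-1 * lp^-1 * (8 * expR (-3) / (12 * pi) / rho *
   ((\sum_a v a i) ^+ 2 - 4 * (d ^+ 2 / rho ^+ 2) * (\sum_a `|v a i|) ^+ 2))) <= _); last first.
  apply: lerD.
    by rewrite !mulr_ge0 ?invr_ge0 ?mulr_ge0 ?pi_ge0// subr_ge0 lef_pV2.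
  apply: ler_sum => i _; rewrite ler_wpM2l//.
    by rewrite mulr_ge0 ?invr_ge0 ?mulr_ge0 ?pi_ge0// ltW.
  apply: le_trans (psd_inv_rdist_margin (fun a => v a i) d0 rho0 xr).
  rewrite ler_wpM2l//.
    by rewrite !divr_ge0 ?mulr_ge0 ?expR_ge0 ?pi_ge0// ltW.
  rewrite lerB// ler_wpM2r ?sqr_ge0// ler_wpM2l//.
  have y0 : 0 < 9 * rho ^+ 2 / d ^+ 2 by rewrite divr_gt0 ?mulr_gt0 ?exprn_gt0.
  rewrite expRN -[leRHS]invrK lef_pV2 ?posrE ?expR_gt0 ?invr_gt0 ?divr_gt0 ?exprn_gt0//.
  rewrite invf_div; apply: le_trans (expR_ge1Dx _).
  have : 0 <= rho ^+ 2 / d ^+ 2 by rewrite divr_ge0 ?exprn_ge0 ?ltW.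
  rewrite -mulrA; lra.
rewrite add0r mulr_sumr; apply: ler_sum => i _; rewrite /margin_const le_eqVlt; apply/orP; left.
apply/eqP; move: (pi_gt0 R); move: (expR (-3)) (pi : R) => e p p0.
by field; rewrite !gt_eqF.
Qed.

End kelvin_kernel.

(** * Energy estimates *)

Section integration_lemmas.
Context {d} {T : measurableType d} {R : realType}.
Variable mu : {measure set T -> \bar R}.

Lemma Rintegral_dominated_cvg (f_ : nat -> T -> R) (f g : T -> R) :
  (forall n, measurable_fun setT (f_ n)) -> measurable_fun setT f ->
  {ae mu, forall x, f_ n x @[n --> \oo] --> f x} ->
  mu.-integrable setT (EFin \o g) ->
  {ae mu, forall x, forall n, `|f_ n x| <= g x} ->
  mu.-integrable setT (EFin \o f) /\
  \int[mu]_x f_ n x @[n --> \oo] --> \int[mu]_x f x.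
Proof.
move=> mf_ mf ff ig fg.
have [intf _ C] : [/\ mu.-integrable setT (EFin \o f),
  [sequence \int[mu]_(x in setT) `|(EFin \o f_ n) x - (EFin \o f) x|]_n @ \oo --> 0%E &
  [sequence \int[mu]_(x in setT) ((EFin \o f_ n) x)]_n @ \oo --> \int[mu]_(x in setT) ((EFin \o f) x)]%E.
  apply: (@dominated_convergence _ _ _ mu setT measurableT _ _ (EFin \o g)) => //.
  - by move=> n; apply/measurable_EFinP.
  - exact/measurable_EFinP.
  - by apply: filterS ff => x fx _; apply: cvg_EFin => //; exact: nearW.
  - by apply: filterS fg => x fgx n _; rewrite /= lee_fin.
split => //; apply: fine_cvg.
by rewrite fineK//; exact: integrable_fin_num.
Qed.

End integration_lemmas.

Section product_integrals.
Context {d} {T : measurableType d} {R : realType}.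
Variable m : {finite_measure set T -> \bar R}.

Lemma has_integral_product (f g : T -> R) (F G : R) :
  has_integral m f F -> has_integral m g G ->
  has_integral (m \x m)%E (fun z => f z.1 * g z.2) (F * G).
Proof.
move=> [fi fF] [gi gG].
have mf : measurable_fun setT f by apply/measurable_EFinP; exact: measurable_int fi.
have mg : measurable_fun setT g by apply/measurable_EFinP; exact: measurable_int gi.
have mfg : measurable_fun setT (fun z : T * T => f z.1 * g z.2).
  by apply: measurable_funM; apply: measurableT_comp.
have ifg : (m \x m)%E.-integrable setT (EFin \o (fun z => f z.1 * g z.2)).
  apply/(integrable12ltyP m m); first exact/measurable_EFinP.
  under eq_integral => x _.
    under eq_integral => y _ do rewrite /= normrM EFinM.
    rewrite ge0_integralZl//; last by apply/measurable_EFinP; apply: measurableT_comp.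
    over.
  rewrite ge0_integralZr//; first last.
  - by apply: integral_ge0 => y _; rewrite lee_fin.
  - by apply/measurable_EFinP; apply: measurableT_comp.
  by have /integrableP[_ ?] := fi; have /integrableP[_ ?] := gi; rewrite lte_mul_pinfty// ?integral_ge0// ge0_fin_numE// integral_ge0.
have gE : (\int[m]_y (g y)%:E)%E = G%:E.
  by rewrite -gG /Rintegral fineK//; exact: integrable_fin_num.
split => //; rewrite /Rintegral -(integral12_prod_meas1 ifg) /fubini_F /=.
under eq_integral => x _.
  under eq_integral => y _ do rewrite /= EFinM.
  rewrite integralZl// gE; over.
rewrite -fF -/(\int[m]_x (f x * G)) RintegralZr//.
Qed.

End product_integrals.

Lemma cvg_bigsum (R : realType) (I : Type) (s : seq I) (u : I -> R^nat) (l : I -> R) :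
  (forall i, u i @ \oo --> l i) ->
  \sum_(i <- s) u i n @[n --> \oo] --> \sum_(i <- s) l i.
Proof.
move=> ul; elim: s => [|i s IH].
  by rewrite big_nil; under eq_fun do rewrite big_nil; exact: cvg_cst.
by rewrite big_cons; under eq_fun do rewrite big_cons; exact: cvgD.
Qed.

Lemma measurable_invr_ge0 d (T : measurableType d) (R : realType) (f : T -> R) :
  (forall x, 0 <= f x) -> measurable_fun setT f ->
  measurable_fun setT (fun x => (f x)^-1).
Proof.
move=> f0 mf; rewrite (_ : (fun x => _) = (fun x => f x `^ (-1))).
  exact: (measurableT_comp (measurable_powR (-1))).
by apply/funext => x; rewrite powR_inv1.
Qed.

(** * Discretization on a cubic grid *)

Section grid.
Context {R : realType} (rho : R) (n : nat).
Hypothesis rho0 : 0 < rho.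

Let h : R := 2 * rho / n.+1%:R.

Let h0 : 0 < h. Proof. by rewrite divr_gt0 ?mulr_gt0. Qed.

(** With half-open cells, n + 1 of them fill [-rho, rho[; the last one starts at rho and catches
    that endpoint. *)
Definition grid_value (k : 'I_n.+2) : R := - rho + k%:R * h.

Definition grid_cell (k : 'I_n.+2) (s : R) : R :=
  ((grid_value k <= s) && (s < grid_value k + h))%R%:R.

Lemma grid_value_le k : `|grid_value k| <= rho.
Proof.
have kh : 0 <= k%:R * h <= 2 * rho.
  rewrite mulr_ge0 ?(ltW h0)//= /h mulrC mulrAC ler_pdivrMr// ler_pM2l ?mulr_gt0//.
  by rewrite ler_nat -ltnS.
by rewrite /grid_value ler_norml; case/andP: kh => ? ?; apply/andP; split; lra.
Qed.

Lemma grid_cell_eq s : `|s| <= rho -> exists k : 'I_n.+2,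
  (forall l, grid_cell l s = (l == k)%:R) /\ `|grid_value k - s| <= h.
Proof.
rewrite ler_norml => /andP[s1 s2].
have x0 : 0 <= (s + rho) / h by rewrite divr_ge0 ?(ltW h0)//; lra.
have /andP[k1 k2] := truncn_itv x0; set k := Num.truncn _ in k1 k2.
have kn : (k < n.+2)%N.
  rewrite ltnS -(ler_nat R) (le_trans k1)// ler_pdivrMr// /h mulrCA divff ?pnatr_eq0// mulr1.
  lra.
rewrite ler_pdivlMr// in k1; rewrite ltr_pdivrMr// in k2.
have k2' : s + rho < k%:R * h + h by move: k2; rewrite -natr1 mulrDl mul1r.
exists (Ordinal kn); split => [l|]; last first.
  rewrite distrC /grid_value/= ger0_norm; last by lra.
  lra.
have [->|lk] := eqVneq l (Ordinal kn).
  rewrite /grid_cell /grid_value /=; case: andP => // -[]; split; lra.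
rewrite /grid_cell; case: andP => //= -[]; rewrite /grid_value => l1 l2; exfalso.
have lh : (l%:R - k%:R) * h < h by rewrite mulrBl; lra.
have kl : (k%:R - l%:R) * h < h by rewrite mulrBl; lra.
move: lh kl; rewrite -[X in _ < X -> _]mul1r ltr_pM2r// => lk1.
rewrite -[X in _ < X]mul1r ltr_pM2r// => kl1.
move/negP: lk; apply; apply/eqP/val_inj => /=; apply/eqP; rewrite eqn_leq.
by apply/andP; split; rewrite -ltnS -(ltr_nat R) -natr1; lra.
Qed.

Lemma measurable_grid_cell k : measurable_fun setT (grid_cell k).
Proof.
rewrite (_ : grid_cell k = \1_(`[grid_value k, grid_value k + h[%classic)).
  exact: measurable_indic.
by apply/funext => s; rewrite indicE mem_setE in_itv.
Qed.

End grid.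

Section energy.
Context {d} {X : measurableType d} {R : realType}.
Variables (m : {finite_measure set X -> \bar R}) (p : X -> 'rV[R]_3) (rho Q : R).
Hypothesis mp : forall i, measurable_fun setT (fun x => p x 0 i).
Hypothesis rho0 : 0 < rho.
Hypothesis p_le : forall x i, `|p x 0 i| <= rho.
Hypothesis potential_le :
  forall x, (\int[m]_y ((rdist 0 (p x - p y))^-1)%:E <= Q%:E)%E.
Hypothesis no_atom : forall x, m [set y | p y = p x] = 0%E.

Local Notation m2 := (m \x m)%E.
Implicit Types (f g : X -> R) (del mu lp : R).

Lemma rdist0_eq0 (u : 'rV[R]_3) : rdist 0 u = 0 -> u = 0.
Proof.
move=> r0; apply/rowP => i; rewrite mxE; apply/eqP; rewrite -normr_le0 -r0.
exact: norm_le_rdist.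
Qed.

Lemma rdistN del (u : 'rV[R]_3) : rdist del (- u) = rdist del u.
Proof. by rewrite /rdist /dot; under eq_bigr do rewrite !mxE mulrNN. Qed.

Lemma rdistB del (u v : 'rV[R]_3) : rdist del (u - v) = rdist del (v - u).
Proof. by rewrite -opprB rdistN. Qed.

Let m_coord i : measurable_fun setT (fun z : X * X => (p z.1 - p z.2) 0 i).
Proof.
rewrite (_ : (fun z => _) = (fun z => p z.1 0 i - p z.2 0 i)); last first.
  by apply/funext => z; rewrite !mxE.
by apply: measurable_funB; apply: (measurableT_comp (mp i)).
Qed.

Let m_dot : measurable_fun setT (fun z : X * X => dot (p z.1 - p z.2) (p z.1 - p z.2)).
Proof. by rewrite /dot; apply: measurable_sum => i; apply: measurable_funM. Qed.

Let m_rdist del : measurable_fun setT (fun z : X * X => rdist del (p z.1 - p z.2)).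
Proof.
have ms : measurable_fun setT (fun x : R => Num.sqrt x).
  by apply: continuous_measurable_fun; exact: sqrt_continuous.
by apply: (measurableT_comp ms); apply: measurable_funD.
Qed.

Let m_inv_rdist del : measurable_fun setT (fun z : X * X => (rdist del (p z.1 - p z.2))^-1).
Proof. by apply: measurable_invr_ge0 => // z; exact: rdist_ge0. Qed.

Let m_kelvin mu lp del i j :
  measurable_fun setT (fun z : X * X => kelvin_reg mu lp del (p z.1 - p z.2) i j).
Proof.
have m3 : measurable_fun setT (fun z : X * X => (rdist del (p z.1 - p z.2) ^+ 3)^-1).
  apply: measurable_invr_ge0; first by move=> z; rewrite exprn_ge0 ?rdist_ge0.
  exact: measurable_funX.
apply: measurable_funM => //; apply: measurable_funD; apply: measurable_funM => //.
- apply: measurable_funD; last by apply: measurable_funM => //; exact: measurable_funM.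
  by apply: measurable_funM => //; apply: measurable_funB; apply: measurable_funM.
- exact: measurable_funM.
Qed.

Definition square_integrable f : Prop :=
  measurable_fun setT f /\ m.-integrable setT (fun x => (f x ^+ 2)%:E).

Lemma square_integrable_cst c : square_integrable (cst c).
Proof. by split => //; exact: (finite_measure_integrable_cst m (c ^+ 2) measurableT). Qed.

Lemma square_integrableZ c f : square_integrable f -> square_integrable (fun x => c * f x).
Proof.
move=> [mf if2]; split; first exact: measurable_funM.
apply: eq_integrable (integrableZl measurableT (c ^+ 2) if2) => // x _.
by rewrite /= -EFinM -exprMn.
Qed.

Lemma square_integrableD f g : square_integrable f -> square_integrable g ->
  square_integrable (fun x => f x + g x).
Proof.
move=> [mf if2] [mg ig2]; split; first exact: measurable_funD.
have := integrableD measurableT (integrableZl measurableT 2 if2) (integrableZl measurableT 2 ig2).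
apply: le_integrable => //.
  by apply/measurable_EFinP; apply: measurable_funX; exact: measurable_funD.
move=> x _ /=; rewrite lee_fin !ger0_norm ?sqr_ge0//.
  have := sqr_ge0 (f x - g x); rewrite sqrrB sqrrD; lra.
by rewrite addr_ge0// mulr_ge0// sqr_ge0.
Qed.

Lemma square_integrable_integrable f : square_integrable f -> m.-integrable setT (EFin \o f).
Proof.
move=> [mf if2]; have i1 := finite_measure_integrable_cst m (1 : R) measurableT.
apply: le_integrable (integrableD measurableT if2 i1) => //; first exact/measurable_EFinP.
move=> x _ /=; rewrite lee_fin (ger0_norm (addr_ge0 (sqr_ge0 _) ler01)).
rewrite -[f x ^+ 2]real_normK ?num_real//.
have := sqr_ge0 (`|f x| - 1); have := normr_ge0 (f x); nra.
Qed.

(** Schur test: integrating first the variable absent from f costs a factor [Q] and leaves the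
    integral of f^2. *)
Let integrable_sqr_inv_rdist f : square_integrable f ->
  m2.-integrable setT (fun z => (f z.1 ^+ 2 / rdist 0 (p z.1 - p z.2))%:E) /\
  m2.-integrable setT (fun z => (f z.2 ^+ 2 / rdist 0 (p z.1 - p z.2))%:E).
Proof.
move=> [mf if2].
have bound : (\int[m]_x \int[m]_y `|(f x ^+ 2 / rdist 0 (p x - p y))%:E| < +oo)%E.
  apply: (@le_lt_trans _ _ (\int[m]_x ((f x ^+ 2)%:E * Q%:E))%E); last first.
    by apply: integrable_lty => //; exact: (integrableZr measurableT Q if2).
  apply: ge0_le_integral => //.
  - by move=> x _; apply: integral_ge0.
  - apply: (@measurable_fun_fubini_tonelli_F _ _ _ _ _ m
      (fun z => `|(f z.1 ^+ 2 / rdist 0 (p z.1 - p z.2))%:E|%E)) => //.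
    apply: measurableT_comp => //; apply/measurable_EFinP; apply: measurable_funM => //.
    by apply: measurable_funX; apply: measurableT_comp.
  - by apply/measurable_EFinP; apply: measurable_funM => //; exact: measurable_funX.
  move=> x _; under eq_integral => y _.
    rewrite /= normrM !ger0_norm ?sqr_ge0 ?invr_ge0 ?rdist_ge0// EFinM; over.
  rewrite ge0_integralZl//; first by rewrite lee_wpmul2l// lee_fin sqr_ge0.
  - apply/measurable_EFinP.
    exact: (measurableT_comp (m_inv_rdist 0) (pair1_measurable x)).
  - by move=> y _; rewrite lee_fin invr_ge0 rdist_ge0.
  - by rewrite lee_fin sqr_ge0.
split.
  apply/(integrable12ltyP m m) => //; apply/measurable_EFinP; apply: measurable_funM => //.
  by apply: measurable_funX; apply: measurableT_comp.
apply/(integrable21ltyP m m).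
  apply/measurable_EFinP; apply: measurable_funM => //.
  by apply: measurable_funX; apply: measurableT_comp.
apply: le_lt_trans bound; rewrite le_eqVlt; apply/orP; left; apply/eqP.
by apply: eq_integral => y _; apply: eq_integral => x _ /=; rewrite rdistB.
Qed.

Lemma integrable_inv_rdist f g : square_integrable f -> square_integrable g ->
  m2.-integrable setT (fun z => (`|f z.1| * `|g z.2| / rdist 0 (p z.1 - p z.2))%:E).
Proof.
move=> sf sg; have [if1 _] := integrable_sqr_inv_rdist sf.
have [_ ig2] := integrable_sqr_inv_rdist sg.
have mf := sf.1; have mg := sg.1.
apply: le_integrable (integrableD measurableT if1 ig2) => //.
  apply/measurable_EFinP; apply: measurable_funM => //.
  by apply: measurable_funM; do 2 apply: measurableT_comp => //.
move=> z _; rewrite /= lee_fin -mulrDl !normrM.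
rewrite ler_wpM2r// !normr_id ger0_norm ?addr_ge0 ?sqr_ge0//.
rewrite -(real_normK (num_real (f _))) -(real_normK (num_real (g _))).
have := sqr_ge0 (`|f z.1| - `|g z.2|).
have := normr_ge0 (f z.1); have := normr_ge0 (g z.2); nra.
Qed.

(** The sections of the diagonal are the level sets of [p], null by [no_atom]. *)
Let offdiag : {ae m2, forall z : X * X, rdist 0 (p z.1 - p z.2) != 0}.
Proof.
have mN : measurable [set z : X * X | rdist 0 (p z.1 - p z.2) = 0].
  rewrite -[X in measurable X]setTI; exact: (m_rdist 0 measurableT (measurable_set1 0)).
exists [set z : X * X | rdist 0 (p z.1 - p z.2) = 0]; split => //.
  rewrite /product_measure1 integral0_eq// => x _ /=.
  rewrite (_ : xsection _ _ = [set y | p y = p x]) ?no_atom//.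
  apply/seteqP; split => y; rewrite /xsection/= inE/=.
    by move/rdist0_eq0/eqP; rewrite subr_eq0 => /eqP.
  by move=> ->; rewrite subrr /rdist expr0n add0r /dot big1 ?sqrtr0// => i _; rewrite mxE mul0r.
by move=> z /= /negP; rewrite negbK => /eqP.
Qed.

Section discretization.
Variables (n : nat) (phi : X -> 'I_3 -> R).
Hypothesis phi2 : forall i, square_integrable (phi ^~ i).

Let I : finType := {ffun 'I_3 -> 'I_n.+2}.

Definition box_indicator (t : I) (x : X) : R := \prod_i grid_cell rho (t i) (p x 0 i).

Definition box_corner (t : I) : 'rV[R]_3 := \row_i grid_value rho (t i).

Lemma box_of_point x : exists t : I,
  (forall s, box_indicator s x = (s == t)%:R) /\
  forall i, `|box_corner t 0 i - p x 0 i| <= 2 * rho / n.+1%:R.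
Proof.
have /choice[t0 t0P] : forall i : 'I_3, exists k : 'I_n.+2,
    (forall l, grid_cell rho l (p x 0 i) = (l == k)%:R) /\
    `|grid_value rho k - p x 0 i| <= 2 * rho / n.+1%:R.
  by move=> i; exact: grid_cell_eq.
exists (finfun t0); split => [s|i]; last by rewrite mxE ffunE; exact: (t0P i).2.
rewrite /box_indicator; under eq_bigr do rewrite (t0P _).1.
have [->|/eqP st] := eqVneq s (finfun t0).
  by rewrite big1// => i _; rewrite ffunE eqxx.
have [i /eqP ti] : exists i, s i <> t0 i.
  by apply: contra_notP st => st; apply/ffunP => i; rewrite ffunE; apply: contrapT => ?; apply: st; exists i.
by rewrite (bigD1 i)//= (negbTE ti) mul0r.
Qed.

Definition box_index (x : X) : I := projT1 (cid (box_of_point x)).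

Lemma box_indicatorE s x : box_indicator s x = (s == box_index x)%:R.
Proof. by rewrite /box_index; case: cid => t []. Qed.

Lemma box_corner_close x i :
  `|box_corner (box_index x) 0 i - p x 0 i| <= 2 * rho / n.+1%:R.
Proof. by rewrite /box_index; case: cid => t []. Qed.

Lemma measurable_box_indicator t : measurable_fun setT (box_indicator t).
Proof.
rewrite /box_indicator.
under [X in measurable_fun _ X]eq_fun do rewrite !big_ord_recl big_ord0 mulr1.
do 2?[apply: measurable_funM]; exact: (measurableT_comp (measurable_grid_cell rho _) (mp _)).
Qed.

Lemma box_coefficient t i : has_integral m (fun x => phi x i * box_indicator t x)
  (\int[m]_x (phi x i * box_indicator t x)).
Proof.
split => //; apply: le_integrable (square_integrable_integrable (phi2 i)) => //.
  apply/measurable_EFinP; apply: measurable_funM; first exact: (phi2 i).1.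
  exact: measurable_box_indicator.
move=> x _; rewrite /= lee_fin box_indicatorE normrM ler_piMr//.
by case: eqP; rewrite ?normr1 ?normr0.
Qed.

Lemma sum_box_coefficient i : \sum_t \int[m]_x (phi x i * box_indicator t x) =
  \int[m]_x phi x i.
Proof.
rewrite -(has_integral_sum (index_enum I) (box_coefficient ^~ i)).2.
apply: eq_Rintegral => x _; under eq_bigr do rewrite box_indicatorE.
rewrite (bigD1 (box_index x))//= eqxx mulr1 big1 ?addr0// => t /negbTE ->.
by rewrite mulr0.
Qed.

(** Cancellation inside a box only lowers the L^1 mass, so the error term of [kelvin_reg_margin] is
    bounded uniformly in the grid. *)
Lemma sum_norm_box_coefficient i :
  \sum_t `|\int[m]_x (phi x i * box_indicator t x)| <= \int[m]_x `|phi x i|.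
Proof.
have B t : has_integral m (fun x => `|phi x i * box_indicator t x|)
    (\int[m]_x `|phi x i * box_indicator t x|).
  by split => //; exact: integrable_norm (box_coefficient t i).1.
apply: le_trans (_ : \sum_t \int[m]_x `|phi x i * box_indicator t x| <= _).
  by apply: ler_sum => t _; apply: le_normr_Rintegral => //; exact: (box_coefficient t i).1.
rewrite -(has_integral_sum (index_enum I) B).2 le_eqVlt; apply/orP; left; apply/eqP.
apply: eq_Rintegral => x _; under eq_bigr do rewrite box_indicatorE normrM.
rewrite (bigD1 (box_index x))//= eqxx normr1 mulr1 big1 ?addr0// => t /negbTE ->.
by rewrite normr0 mulr0.
Qed.

Definition discretized_energy mu lp del : R :=
  \int[m2]_z (\sum_i \sum_j phi z.1 i * phi z.2 j *
    kelvin_reg mu lp del (box_corner (box_index z.1) - box_corner (box_index z.2)) i j).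

(** With positions replaced by box corners, the double integral is the energy of point charges at
    the corners, each charge being the integral of [phi] over its box. Going through the indicators
    also gives measurability, since [box_index] comes from choice. *)
Lemma discretized_energyE mu lp del :
  has_integral m2 (fun z => \sum_i \sum_j phi z.1 i * phi z.2 j *
    kelvin_reg mu lp del (box_corner (box_index z.1) - box_corner (box_index z.2)) i j)
  (\sum_t \sum_s \sum_i \sum_j (\int[m]_x (phi x i * box_indicator t x)) *
    (\int[m]_x (phi x j * box_indicator s x)) *
    kelvin_reg mu lp del (box_corner t - box_corner s) i j).
Proof.
have -> : (fun z : X * X => \sum_i \sum_j phi z.1 i * phi z.2 j *
    kelvin_reg mu lp del (box_corner (box_index z.1) - box_corner (box_index z.2)) i j) =
  (fun z => \sum_t \sum_s \sum_i \sum_j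
    kelvin_reg mu lp del (box_corner t - box_corner s) i j *
    ((phi z.1 i * box_indicator t z.1) * (phi z.2 j * box_indicator s z.2))).
  apply/funext => z; rewrite (bigD1 (box_index z.1))//= [X in _ = _ + X]big1 ?addr0; last first.
    move=> t /negbTE tz; rewrite big1// => s _; rewrite big1// => i _; rewrite big1// => j _.
    by rewrite box_indicatorE tz !(mulr0, mul0r).
  rewrite (bigD1 (box_index z.2))//= [X in _ = _ + X]big1 ?addr0; last first.
    move=> s /negbTE sz; rewrite big1// => i _; rewrite big1// => j _.
    by rewrite (box_indicatorE s) sz !(mulr0, mul0r).
  apply: eq_bigr => i _; apply: eq_bigr => j _.
  by rewrite !box_indicatorE !eqxx !mulr1 mulrC.
apply: has_integral_sum => t; apply: has_integral_sum => s.
apply: has_integral_sum => i; apply: has_integral_sum => j.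
rewrite [X in has_integral _ _ X]mulrC; apply: has_integralZ.
exact: (has_integral_product (box_coefficient t i) (box_coefficient s j)).
Qed.

End discretization.

Section regularized_energy.
Variables (phi : X -> 'I_3 -> R) (mu lp : R).
Hypothesis phi2 : forall i, square_integrable (phi ^~ i).
Hypotheses (mu0 : 0 < mu) (mulp : mu <= lp).

Let lp0 : 0 < lp. Proof. exact: lt_le_trans mulp. Qed.

Definition energy_density del (z : X * X) : R :=
  \sum_i \sum_j phi z.1 i * phi z.2 j * kelvin_reg mu lp del (p z.1 - p z.2) i j.

Let dominant (z : X * X) : R :=
  \sum_i \sum_j mu^-1 * (`|phi z.1 i| * `|phi z.2 j| / rdist 0 (p z.1 - p z.2)).

Let dominant_reg del (z : X * X) : R :=
  \sum_i \sum_j mu^-1 / del * (`|phi z.1 i| * `|phi z.2 j|).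

Let integrable_dominant : m2.-integrable setT (EFin \o dominant).
Proof.
have H i j : has_integral m2 (fun z => `|phi z.1 i| * `|phi z.2 j| / rdist 0 (p z.1 - p z.2))
   (\int[m2]_z (`|phi z.1 i| * `|phi z.2 j| / rdist 0 (p z.1 - p z.2))).
  by split => //; exact: (integrable_inv_rdist (phi2 i) (phi2 j)).
by have [] := has_integral_sum (index_enum 'I_3) (fun i =>
  has_integral_sum (index_enum 'I_3) (fun j => has_integralZ mu^-1 (H i j))).
Qed.

Let integrable_dominant_reg del : m2.-integrable setT (EFin \o dominant_reg del).
Proof.
have H i : has_integral m (fun x => `|phi x i|) (\int[m]_x `|phi x i|).
  split => //; exact: (integrable_norm (square_integrable_integrable (phi2 i))).
by have [] := has_integral_sum (index_enum 'I_3) (fun i =>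
  has_integral_sum (index_enum 'I_3) (fun j => has_integralZ (mu^-1 / del)
   (has_integral_product (H i) (H j)))).
Qed.

Lemma measurable_energy_density del : measurable_fun setT (energy_density del).
Proof.
apply: measurable_sum => i; apply: measurable_sum => j; apply: measurable_funM => //.
by apply: measurable_funM;
  [exact: (measurableT_comp (phi2 i).1 measurable_fst)|
   exact: (measurableT_comp (phi2 j).1 measurable_snd)].
Qed.

Let reg_margin del := margin_const / (lp * rho) *
  \sum_i ((\int[m]_x phi x i) ^+ 2 -
     4 * (del ^+ 2 / rho ^+ 2) * (\int[m]_x `|phi x i|) ^+ 2).

Let le_term (k : R) (a b c : R) : `|c| <= k -> `|a * b * c| <= k * (`|a| * `|b|).
Proof. by move=> ck; rewrite !normrM mulrC ler_wpM2r// mulr_ge0. Qed.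

(** Refinement of the grid at fixed [del]: the kernel is at most 1 / (mu del), a domination that
    holds even when two corners coincide. *)
Let regularized_energy_margin del : 0 < del ->
  reg_margin del <= \int[m2]_z energy_density del z.
Proof.
move=> del0.
have C : discretized_energy n phi mu lp del @[n --> \oo] --> \int[m2]_z energy_density del z.
  apply: (@Rintegral_dominated_cvg _ _ _ m2 (fun n z => \sum_i \sum_j phi z.1 i * phi z.2 j *
    kelvin_reg mu lp del (box_corner (box_index n z.1) - box_corner (box_index n z.2)) i j)
    _ _ _ _ _ (integrable_dominant_reg del) _).2.
  - by move=> n; apply/measurable_EFinP; exact: measurable_int (discretized_energyE n phi2 mu lp del).1.
  - exact: measurable_energy_density.
  - apply: aeW => z; rewrite /energy_density.
    apply: cvg_bigsum => i; apply: cvg_bigsum => j.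
    apply: cvgM; first exact: cvg_cst.
    apply: cvg_kelvin_reg; [exact: cvg_cst| |by rewrite gt_eqF// rdist_gt0].
    have corner x k : box_corner (box_index n x) 0 k @[n --> \oo] --> p x 0 k.
      apply/cvgrPdist_le => e e0; near=> n.
      rewrite distrC (le_trans (box_corner_close _ _ _))//.
      rewrite ler_pdivrMr// -ler_pdivrMl//.
      apply: (le_trans (ltW (truncnS_gt (e^-1 * (2 * rho))))); rewrite ler_nat ltnS.
      by near: n; exact: nbhs_infty_ge.
    move=> k; rewrite !mxE; under eq_fun do rewrite !mxE.
    by apply: cvgB; have := corner _ k; [move=> /(_ z.1)|move=> /(_ z.2)]; under eq_fun do rewrite mxE.
  - apply: aeW => z n; rewrite /dominant_reg.
    apply: le_trans (ler_norm_sum _ _ _) _; apply: ler_sum => i _.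
    apply: le_trans (ler_norm_sum _ _ _) _; apply: ler_sum => j _.
    apply: le_term; apply: le_trans (norm_kelvin_reg_le _ _ _ _ mu0 mulp) _.
    rewrite ler_wpM2l ?invr_ge0 ?(ltW mu0)// lef_pV2 ?posrE ?rdist_gt0//.
    by rewrite rdist_ge_reg ?ltW.
apply: cvgr_to_ge C _; apply: nearW => n.
rewrite /discretized_energy (discretized_energyE n phi2 mu lp del).2.
apply: le_trans (kelvin_reg_margin (fun t i => \int[m]_x (phi x i * box_indicator t x)) mu0 mulp del0 rho0 _); last first.
  by move=> t i; rewrite mxE; exact: grid_value_le.
rewrite ler_wpM2l//.
  by rewrite ltW// divr_gt0 ?margin_const_gt0 ?mulr_gt0.
apply: ler_sum => i _; rewrite sum_box_coefficient// lerB// ler_wpM2l//.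
  by rewrite mulr_ge0// divr_ge0 ?sqr_ge0.
rewrite !expr2 ler_pM ?sum_norm_box_coefficient// sumr_ge0//.
Unshelve. all: by end_near. Qed.

(** The limit of vanishing regularization. Off the null diagonal the unregularized 1/|x - y|
    dominates, and the error is [del]^2 / rho^2 times a fixed L^1 mass. *)
Lemma energy_margin : margin_const / (lp * rho) * \sum_i (\int[m]_x phi x i) ^+ 2 <=
  \int[m2]_z energy_density 0 z.
Proof.
have C : \int[m2]_z energy_density (harmonic n) z @[n --> \oo] --> \int[m2]_z energy_density 0 z.
  apply: (@Rintegral_dominated_cvg _ _ _ m2 (fun n => energy_density (harmonic n))
    _ _ _ _ _ integrable_dominant _).2.
  - by move=> n; exact: measurable_energy_density.
  - exact: measurable_energy_density.
  - apply: filterS offdiag => z rz; rewrite /energy_density.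
    apply: cvg_bigsum => i; apply: cvg_bigsum => j.
    apply: cvgM; first exact: cvg_cst.
    by apply: cvg_kelvin_reg => [|k|//]; [exact: cvg_harmonic|exact: cvg_cst].
  - apply: filterS offdiag => z rz n; rewrite /dominant.
    apply: le_trans (ler_norm_sum _ _ _) _; apply: ler_sum => i _.
    apply: le_trans (ler_norm_sum _ _ _) _; apply: ler_sum => j _.
    rewrite [leRHS](_ : _ = mu^-1 / rdist 0 (p z.1 - p z.2) * (`|phi z.1 i| * `|phi z.2 j|)); last by ring.
    apply: le_term; apply: le_trans (norm_kelvin_reg_le _ _ _ _ mu0 mulp) _.
    rewrite ler_wpM2l ?invr_ge0 ?(ltW mu0)// lef_pV2 ?posrE.
    + exact: rdist_ge_rdist0.
    + by rewrite rdist_gt0// harmonic_gt0.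
    + by rewrite lt_neqAle eq_sym rz rdist_ge0.
have D : reg_margin (harmonic n) @[n --> \oo] -->
    margin_const / (lp * rho) * \sum_i (\int[m]_x phi x i) ^+ 2.
  have -> : margin_const / (lp * rho) * \sum_i (\int[m]_x phi x i) ^+ 2 = reg_margin 0.
    by rewrite /reg_margin expr0n/= mul0r mulr0; congr (_ * _); apply: eq_bigr => i _; rewrite mul0r subr0.
  apply: cvgM; first exact: cvg_cst.
  apply: cvg_bigsum => i; apply: cvgB; first exact: cvg_cst.
  apply: cvgM; last exact: cvg_cst.
  apply: cvgM; first exact: cvg_cst.
  apply: cvgM; last exact: cvg_cst.
  by rewrite expr2; under eq_fun do rewrite expr2; apply: cvgM; exact: cvg_harmonic.
apply: (ler_cvg_to D C); apply: nearW => n; apply: regularized_energy_margin.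
exact: harmonic_gt0.
Qed.

End regularized_energy.

(** * Energy of the equilibrium density and bounds on the capacitance form *)

Section capacitance.
Variables (mu lp : R).
Hypotheses (mu0 : 0 < mu) (mulp : mu <= lp) (Q_gt0 : 0 < Q).

Let G (z : X * X) (i j : 'I_3) : R := kelvin_reg mu lp 0 (p z.1 - p z.2) i j.

(** Interaction energy of the densities f e_i and g e_j. *)
Let mutual f g i j : R := \int[m2]_z (f z.1 * g z.2 * G z i j).

Let mutualE f g i j : square_integrable f -> square_integrable g ->
  has_integral m2 (fun z => f z.1 * g z.2 * G z i j) (mutual f g i j).
Proof.
move=> sf sg; split => //.
have := integrableZl measurableT mu^-1 (integrable_inv_rdist sf sg).
apply: le_integrable => //.
  apply/measurable_EFinP; apply: measurable_funM; last exact: m_kelvin.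
  apply: measurable_funM.
    exact: (measurableT_comp sf.1 measurable_fst).
  exact: (measurableT_comp sg.1 measurable_snd).
move=> z _; rewrite /= lee_fin.
have := norm_kelvin_reg_le 0 (p z.1 - p z.2) i j mu0 mulp; rewrite -/(G z i j).
move: (G z i j) => k kle; rewrite !normrM !normr_id [leRHS]mulrCA.
rewrite ler_wpM2l ?mulr_ge0//; apply: (le_trans kle).
by rewrite !ger0_norm ?invr_ge0 ?rdist_ge0 ?(ltW mu0).
Qed.

Let mutualC f g i j : square_integrable f -> square_integrable g ->
  mutual f g i j = mutual g f j i.
Proof.
move=> sf sg.
have Gsym x y : G (x, y) i j = G (y, x) j i.
  rewrite /G /kelvin_reg /= rdistB (_ : dot (p x - p y) _ = dot (p y - p x) (p y - p x)); last first.
    by rewrite !dotE !mxE; ring.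
  by rewrite eq_sym !mxE; congr (_ * (_ * (_ + _ / _) + _)); ring.
rewrite /mutual /Rintegral -(integral12_prod_meas1 (mutualE i j sf sg).1).
rewrite -(integral21_prod_meas1 (mutualE j i sg sf).1) /fubini_F /fubini_G /=.
apply: (congr1 fine). apply: eq_integral => x _. apply: eq_integral => y _.
by rewrite Gsym; move: (G _ _ _) => k; congr EFin; ring.
Qed.

(** Fubini with f = 1. It licenses exchanging finite sums with the inner integral at almost every x,
    which is also where the integral equation is known. *)
Let mutual_ae_integrable g i j : square_integrable g ->
  {ae m, forall x, m.-integrable setT (EFin \o (fun y => g y * G (x, y) i j))}.
Proof.
move=> sg; have := ae_integrable1 (mutualE i j (square_integrable_cst 1) sg).1.
apply: filterS => x; apply: eq_integrable => // y _.
by rewrite /= mul1r.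
Qed.

Let mutual1_le i j : `|mutual (cst 1) (cst 1) i j| <= mu^-1 * (Q * fine (m setT)).
Proof.
have I11 := integrable_inv_rdist (square_integrable_cst 1) (square_integrable_cst 1).
have s1 := square_integrable_cst 1.
rewrite /mutual; apply: le_trans (le_normr_Rintegral measurableT (mutualE i j s1 s1).1) _.
have H : has_integral m2 (fun z => `|1| * `|1| / rdist 0 (p z.1 - p z.2)) 
   (\int[m2]_z (`|1| * `|1| / rdist 0 (p z.1 - p z.2))) by split.
apply: le_trans (_ : mu^-1 * \int[m2]_z (`|1| * `|1| / rdist 0 (p z.1 - p z.2)) <= _).
  rewrite -(has_integralZ mu^-1 H).2; apply: le_Rintegral => //.
  - exact: integrable_norm (mutualE i j s1 s1).1.
  - exact: (has_integralZ mu^-1 H).1.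
  - by move=> z _; rewrite !mul1r normr1 !mul1r norm_kelvin_reg_le.
rewrite ler_wpM2l ?invr_ge0 ?(ltW mu0)// -lee_fin /Rintegral fineK; last exact: integrable_fin_num.
rewrite -(integral12_prod_meas1 I11) EFinM fineK ?fin_num_measure//.
rewrite -integral_cst//; apply: ge0_le_integral => //.
- by move=> x _; apply: integral_ge0 => y _; rewrite lee_fin !mulr_ge0// invr_ge0 rdist_ge0.
- apply: (@measurable_fun_fubini_tonelli_F _ _ _ _ _ m
      (fun z => (`|1| * `|1| / rdist 0 (p z.1 - p z.2))%:E)).
    by apply/measurable_EFinP; apply: measurable_funM.
  by move=> z; rewrite lee_fin !mulr_ge0// invr_ge0 rdist_ge0.
- move=> x _; rewrite /fubini_F; under eq_integral do rewrite /= normr1 !mul1r.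
  exact: potential_le.
Qed.

Variable sigma : X -> 'M[R]_3.
Hypothesis sigma2 : forall i j, square_integrable (fun x => sigma x i j).
Hypothesis sigma_eq : {ae m, forall x, forall i j,
  \int[m]_y (\sum_k kelvin_reg mu lp 0 (p x - p y) i k * sigma y k j) = (i == j)%:R}.

Let C : 'M[R]_3 := \matrix_(i, j) \int[m]_x sigma x i j.

Variable v : 'rV[R]_3.

Let phi x j : R := \sum_l v 0 l * sigma x j l.

Let phi2 j : square_integrable (phi ^~ j).
Proof.
rewrite /phi; elim: (index_enum _) => [|l s IH].
  under [X in square_integrable X]eq_fun do rewrite big_nil.
  exact: square_integrable_cst.
under [X in square_integrable X]eq_fun do rewrite big_cons.
by apply: square_integrableD => //; exact: square_integrableZ.
Qed.

Let int_phi j : \int[m]_x phi x j = \sum_l v 0 l * C j l.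
Proof.
rewrite /phi (has_integral_sum _ (fun l => has_integralZ (v 0 l) (_ : has_integral m (fun x => sigma x j l) (C j l)))).2//.
by move=> l; split; [exact: square_integrable_integrable|rewrite mxE].
Qed.

(** Combining the columns of [sigma] with weights v l combines those of the identity, so the
    potential of [phi] is the constant vector v. *)
Let phi_eq : {ae m, forall x, forall i, \int[m]_y (\sum_j phi y j * G (x, y) i j) = v 0 i}.
Proof.
have A : {ae m, forall x, forall i k j,
    m.-integrable setT (EFin \o (fun y => sigma y k j * G (x, y) i k))}.
  have H i k j := mutual_ae_integrable i k (sigma2 k j).
  have F : {ae m, forall x, forall i : 'I_3, forall k : 'I_3, forall j : 'I_3,
      m.-integrable setT (EFin \o (fun y => sigma y k j * G (x, y) i k))}.
    apply: filter_forall => i; apply: filter_forall => k; apply: filter_forall => j; exact: H.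
  exact: F.
apply: filterS2 A sigma_eq => x Ax eqx i.
have H l : has_integral m (fun y => \sum_k sigma y k l * G (x, y) i k) ((i == l)%:R).
  split; last by rewrite -(eqx i l); apply: eq_Rintegral => y _; apply: eq_bigr => k _; rewrite mulrC.
  exact: (has_integral_sum (index_enum 'I_3) (fun k => conj (Ax i k l) erefl)).1.
have := (has_integral_sum (index_enum 'I_3) (fun l => has_integralZ (v 0 l) (H l))).2.
rewrite (bigD1 i)//= eqxx mulr1 [X in _ = _ + X]big1 ?addr0; last first.
  by move=> l /negbTE; rewrite eq_sym => ->; rewrite mulr0.
move=> <-; apply: eq_Rintegral => y _.
under eq_bigr do rewrite /phi mulr_suml.
rewrite exchange_big; apply: eq_bigr => l _; rewrite mulr_sumr.
by apply: eq_bigr => j _; rewrite mulrA.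
Qed.

(** By Fubini, interaction with [phi] is integration against its constant potential, so only the
    total mass of f remains. With f = phi i, summing over i gives energy [q]. *)
Let mutual_phi f i : square_integrable f ->
  \sum_j mutual f (phi ^~ j) i j = v 0 i * \int[m]_x f x.
Proof.
move=> sf; have S := has_integral_sum (index_enum 'I_3) (fun j => mutualE i j sf (phi2 j)).
rewrite -S.2 /Rintegral -(integral12_prod_meas1 S.1) /fubini_F.
have if1 := square_integrable_integrable sf.
rewrite -/(Rintegral m setT _) -RintegralZl// /Rintegral; congr fine.
apply: ae_eq_integral => //.
- exact: measurable_fubini_F S.1.
- by apply/measurable_EFinP; apply: measurable_funM => //; exact: sf.1.
have A : {ae m, forall x, forall j : 'I_3,
    m.-integrable setT (EFin \o (fun y => phi y j * G (x, y) i j))}.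
  by apply: filter_forall => j; exact: (mutual_ae_integrable i j (phi2 j)).
apply: filterS2 A phi_eq => x Ax eqx _.
have H := has_integral_sum (index_enum 'I_3) (fun j => conj (Ax j) erefl).
rewrite mulrC -(eqx i) -RintegralZl//; last exact: H.1.
rewrite /Rintegral fineK; last first.
  apply: integrable_fin_num => //.
  rewrite [X in integrable _ _ X](_ : _ = (fun y => (f x)%:E * (EFin \o (fun y => \sum_j phi y j * G (x, y) i j)%R) y)%E)//.
  by apply: integrableZl => //; exact: H.1.
apply: eq_integral => y _; congr EFin; rewrite mulr_sumr; apply: eq_bigr => j _.
by rewrite mulrA.
Qed.

Let q : R := \sum_i v 0 i * \int[m]_x phi x i.

(** The energy of phi - t v, expanded. By [mutual_phi] and the symmetry of the kernel each of the
    two cross terms is - t |v|^2 times the total mass of [m]. *)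
Let energy_shift t : 0 <= q - 2 * t * (dot v v * fine (m setT)) +
  t ^+ 2 * \sum_i \sum_j v 0 i * v 0 j * mutual (cst 1) (cst 1) i j.
Proof.
pose psi x i := phi x i + - t * v 0 i.
have sc c : square_integrable (cst c) by exact: square_integrable_cst.
have psi2 i : square_integrable (psi ^~ i) by exact: (square_integrableD (phi2 i) (sc (- t * v 0 i))).
have lp0 : 0 < lp by exact: lt_le_trans mulp.
have : 0 <= \int[m2]_z energy_density psi mu lp 0 z.
  apply: le_trans (energy_margin psi2 mu0 mulp); rewrite mulr_ge0//.
    by rewrite ltW// divr_gt0 ?margin_const_gt0 ?mulr_gt0.
  by apply: sumr_ge0 => i _; rewrite sqr_ge0.
have T i j := has_integralD (mutualE i j (phi2 i) (phi2 j))
  (has_integralD (has_integralZ (- t * v 0 j) (mutualE i j (phi2 i) (sc 1)))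
  (has_integralD (has_integralZ (- t * v 0 i) (mutualE i j (sc 1) (phi2 j)))
    (has_integralZ (t ^+ 2 * v 0 i * v 0 j) (mutualE i j (sc 1) (sc 1))))).
have S := has_integral_sum (index_enum 'I_3) (fun i => has_integral_sum (index_enum 'I_3) (T i)).
rewrite (_ : \int[m2]_z energy_density psi mu lp 0 z = \sum_i \sum_j
   (mutual (phi ^~ i) (phi ^~ j) i j + (- t * v 0 j * mutual (phi ^~ i) (cst 1) i j +
   (- t * v 0 i * mutual (cst 1) (phi ^~ j) i j +
    t ^+ 2 * v 0 i * v 0 j * mutual (cst 1) (cst 1) i j)))); last first.
  rewrite -S.2; apply: eq_Rintegral => z _.
  apply: eq_bigr => i _; apply: eq_bigr => j _; rewrite /psi /G /=; ring.
have E1 : \sum_i \sum_j mutual (phi ^~ i) (phi ^~ j) i j = q.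
  by apply: eq_bigr => i _; rewrite mutual_phi.
have int1 : \int[m]_x (cst 1 x) = fine (m setT) by rewrite Rintegral_cst// mul1r.
have E2 : \sum_i \sum_j - t * v 0 i * mutual (cst 1) (phi ^~ j) i j =
    - t * (dot v v * fine (m setT)).
  rewrite mulrA /dot mulr_sumr mulr_suml; apply: eq_bigr => i _.
  by rewrite -mulr_sumr mutual_phi// int1 !mulrA.
have E3 : \sum_i \sum_j - t * v 0 j * mutual (phi ^~ i) (cst 1) i j =
    - t * (dot v v * fine (m setT)).
  rewrite exchange_big -E2; apply: eq_bigr => i _; apply: eq_bigr => j _.
  by rewrite mutualC.
under eq_bigr do rewrite !big_split; rewrite !big_split /= E1 E2 E3.
rewrite (_ : \sum_i \sum_j t ^+ 2 * v 0 i * v 0 j * _ =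
  t ^+ 2 * \sum_i \sum_j v 0 i * v 0 j * mutual (cst 1) (cst 1) i j); last first.
  rewrite mulr_sumr; apply: eq_bigr => i _; rewrite mulr_sumr; apply: eq_bigr => j _.
  by rewrite -!mulrA.
by move=> H; rewrite (le_trans H)// le_eqVlt; apply/orP; left; apply/eqP; ring.
Qed.

Lemma capacitance_form_ge : mu / (3 * Q) * fine (m setT) * dot v v <= q.
Proof.
set A := fine (m setT); have A0 : 0 <= A by rewrite fine_ge0.
have B : \sum_i \sum_j v 0 i * v 0 j * mutual (cst 1) (cst 1) i j <=
    3 * dot v v * (mu^-1 * (Q * A)).
  apply: le_trans (_ : \sum_i \sum_j (v 0 i ^+ 2 + v 0 j ^+ 2) / 2 * (mu^-1 * (Q * A)) <= _).
    apply: ler_sum => i _; apply: ler_sum => j _; apply: le_trans (ler_norm _) _.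
    rewrite normrM; apply: ler_pM => //; rewrite normrM.
    rewrite -[v 0 i ^+ 2]real_normK ?num_real// -[v 0 j ^+ 2]real_normK ?num_real//.
    have := sqr_ge0 (`|v 0 i| - `|v 0 j|); nra.
  rewrite le_eqVlt; apply/orP; left; apply/eqP.
  by rewrite !dotE !big_ord_recl !big_ord0; field; rewrite gt_eqF.
(* The minimizer of - 2 t A |v|^2 + t^2 (3 Q A / mu) |v|^2, where 3 comes from (sum of |v i|)^2 <= 3
   |v|^2. *)
pose t := mu / (3 * Q); have t0 : 0 <= t by rewrite divr_ge0 ?mulr_ge0 ?(ltW mu0) ?(ltW Q_gt0).
have := energy_shift t.
have : t ^+ 2 * \sum_i \sum_j v 0 i * v 0 j * mutual (cst 1) (cst 1) i j <=
    t ^+ 2 * (3 * dot v v * (mu^-1 * (Q * A))) by rewrite ler_wpM2l ?sqr_ge0.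
have -> : t ^+ 2 * (3 * dot v v * (mu^-1 * (Q * A))) = t * A * dot v v.
  by rewrite /t; field; rewrite !gt_eqF.
rewrite -/t -/A; lra.
Qed.

Lemma capacitance_form_le : q <= lp * rho / margin_const * dot v v.
Proof.
have lp0 : 0 < lp by exact: lt_le_trans mulp.
set k := margin_const / (lp * rho).
have k0 : 0 < k by rewrite divr_gt0 ?margin_const_gt0 ?mulr_gt0.
have := energy_shift 0; rewrite !(mulr0, mul0r) expr0n/= mul0r subr0 addr0 => q0.
have : k * \sum_i (\int[m]_x phi x i) ^+ 2 <= q.
  apply: le_trans (energy_margin phi2 mu0 mulp) _.
  have S := has_integral_sum (index_enum 'I_3) (fun i =>
    has_integral_sum (index_enum 'I_3) (fun j => mutualE i j (phi2 i) (phi2 j))).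
  rewrite le_eqVlt; apply/orP; left; apply/eqP; apply: etrans S.2 _.
  by apply: eq_bigr => i _; rewrite mutual_phi.
(* Expansion of |int phi - v/k|^2 >= 0: Cauchy-Schwarz for q = v . int phi, in a form free of square
   roots. *)
have : 2 * (k^-1 * q) - k^-1 ^+ 2 * dot v v <= \sum_i (\int[m]_x phi x i) ^+ 2.
  rewrite /q /dot !mulr_sumr -sumrB; apply: ler_sum => i _.
  have := sqr_ge0 (\int[m]_x phi x i - k^-1 * v 0 i).
  by rewrite sqrrB exprMn -mulr_natl expr2; lra.
move=> H1 H2; have H3 : k * (2 * (k^-1 * q) - k^-1 ^+ 2 * dot v v) <= q.
  by apply: le_trans H2; rewrite ler_pM2l.
have E : k * (2 * (k^-1 * q) - k^-1 ^+ 2 * dot v v) = 2 * q - k^-1 * dot v v.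
  by field; rewrite gt_eqF.
have -> : lp * rho / margin_const = k^-1 by rewrite -[LHS]invrK invf_div.
rewrite E in H3; lra.
Qed.

Lemma capacitance_eigenvalue_bounds l : v != 0 -> v *m C = l *: v ->
  mu / (3 * Q) * fine (m setT) <= l <= lp * rho / margin_const.
Proof.
move=> v0 vC; have v1 : 0 < dot v v.
  have /existsP[i vi] : [exists i, v 0 i != 0].
    apply: contraNT v0; rewrite negb_exists => /forallP H; apply/eqP/rowP => i.
    by have := H i; rewrite negbK mxE => /eqP.
  by apply: lt_le_trans (sqr_le_dot v i); rewrite exprn_even_gt0.
(* The integral of [phi] is C v^T while v is a left eigenvector; contracting with v makes both sides
   v C v^T. *)
have ql : q = l * dot v v.
  rewrite /q; under eq_bigr do rewrite int_phi mulr_sumr.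
  rewrite exchange_big /dot mulr_sumr; apply: eq_bigr => j _.
  have /rowP/(_ j) := vC; rewrite !mxE => H.
  by rewrite mulrA -H mulr_suml; apply: eq_bigr => i _; rewrite !mxE; ring.
apply/andP; split; rewrite -(ler_pM2r v1) -ql.
  exact: capacitance_form_ge.
exact: capacitance_form_le.
Qed.

End capacitance.

End energy.

(** * Hausdorff measure *)

Section euclidean_norm.
Context {R : realType} {n : nat}.
Implicit Types (x y z : 'rV[R]_n).

Lemma enorm_ge0 x : 0 <= enorm x. Proof. exact: sqrtr_ge0. Qed.

Lemma enorm0 : enorm (0 : 'rV[R]_n) = 0.
Proof. by rewrite /enorm big1 ?sqrtr0// => i _; rewrite mxE expr0n. Qed.

Lemma enorm2 x : enorm x ^+ 2 = \sum_i x 0 i ^+ 2.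
Proof. by rewrite sqr_sqrtr// sumr_ge0// => i _; rewrite sqr_ge0. Qed.

Lemma le_enorm_coord x i : `|x 0 i| <= enorm x.
Proof.
rewrite -sqrtr_sqr ler_wsqrtr// (bigD1 i)//= lerDl sumr_ge0// => j _.
by rewrite sqr_ge0.
Qed.

Lemma enormZ a x : enorm (a *: x) = `|a| * enorm x.
Proof.
rewrite -sqrtr_sqr -sqrtrM ?sqr_ge0// mulr_sumr; congr Num.sqrt.
by apply: eq_bigr => i _; rewrite mxE exprMn.
Qed.

Lemma enormN x : enorm (- x) = enorm x.
Proof. by rewrite -scaleN1r enormZ normrN1 mul1r. Qed.

Lemma enormB x y : enorm (x - y) = enorm (y - x).
Proof. by rewrite -opprB enormN. Qed.

Let cauchy_schwarz x y : \sum_i x 0 i * y 0 i <= enorm x * enorm y.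
Proof.
have [/eqP ex|ex] := eqVneq (enorm x) 0.
  rewrite (eqP ex) mul0r le_eqVlt big1 ?eqxx// => i _.
  have := le_enorm_coord x i; rewrite (eqP ex) normr_le0 => /eqP ->.
  by rewrite mul0r.
have [/eqP ey|ey] := eqVneq (enorm y) 0.
  rewrite (eqP ey) mulr0 le_eqVlt big1 ?eqxx// => i _.
  have := le_enorm_coord y i; rewrite (eqP ey) normr_le0 => /eqP ->.
  by rewrite mulr0.
have x0 : 0 < enorm x by rewrite lt_neqAle eq_sym ex enorm_ge0.
have y0 : 0 < enorm y by rewrite lt_neqAle eq_sym ey enorm_ge0.
have : 0 <= \sum_i (x 0 i / enorm x - y 0 i / enorm y) ^+ 2.
  by apply: sumr_ge0 => i _; rewrite sqr_ge0.
have -> : \sum_i (x 0 i / enorm x - y 0 i / enorm y) ^+ 2 =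
   (\sum_i x 0 i ^+ 2) / enorm x ^+ 2 + (\sum_i y 0 i ^+ 2) / enorm y ^+ 2
   - 2 / (enorm x * enorm y) * \sum_i x 0 i * y 0 i.
  rewrite !mulr_suml mulr_sumr -big_split -sumrB /=; apply: eq_bigr => i _.
  by field; rewrite ex ey.
rewrite -!enorm2 !divff ?expf_neq0// => H.
have {}H : 2 / (enorm x * enorm y) * (\sum_i x 0 i * y 0 i) <= 2 by lra.
move: H; rewrite mulrAC ler_pdivrMr ?mulr_gt0// ler_pM2l//.
Qed.

Lemma enormD x y : enorm (x + y) <= enorm x + enorm y.
Proof.
rewrite -(@ler_pXn2r _ 2)// ?nnegrE ?addr_ge0 ?enorm_ge0//.
rewrite sqrrD !enorm2.
have -> : \sum_i (x + y) 0 i ^+ 2 =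
    \sum_i x 0 i ^+ 2 + \sum_i x 0 i * y 0 i *+ 2 + \sum_i y 0 i ^+ 2.
  by rewrite -!big_split /=; apply: eq_bigr => i _; rewrite mxE sqrrD.
by rewrite lerD2r lerD2l sumrMnl lerMn2r /= cauchy_schwarz.
Qed.

Lemma enorm_triangle y x z : enorm (x - z) <= enorm (x - y) + enorm (y - z).
Proof. by rewrite -[x - z](subrKA y) enormD. Qed.

Lemma enorm_le_sum x : enorm x <= \sum_i `|x 0 i|.
Proof.
have S0 : 0 <= \sum_i `|x 0 i| by exact: sumr_ge0.
rewrite -[leRHS]ger0_norm// -sqrtr_sqr ler_wsqrtr// expr2 mulr_suml.
apply: ler_sum => i _; rewrite -real_normK ?num_real// expr2 ler_wpM2l//.
by rewrite (bigD1 i)//= lerDl sumr_ge0.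
Qed.

End euclidean_norm.

Section hausdorff_lemmas.
Context {R : realType}.
Local Open Scope ereal_scope.

Lemma ediam_le n (A : set 'rV[R]_n) (d : \bar R) : 0 <= d ->
  (forall x y, A x -> A y -> (enorm (x - y))%:E <= d) -> ediam A <= d.
Proof.
move=> d0 H; rewrite /ediam ge_max d0/=; apply: ge_ereal_sup => _ [[x y] [/= Ax Ay] <-].
exact: H.
Qed.

Lemma le_ediam n (A : set 'rV[R]_n) x y : A x -> A y -> (enorm (x - y))%:E <= ediam A.
Proof.
move=> Ax Ay; rewrite /ediam le_max; apply/orP; right; apply: ereal_sup_ubound.
by exists (x, y).
Qed.

Lemma ediam_ge0 n (A : set 'rV[R]_n) : 0 <= ediam A.
Proof. by rewrite /ediam le_max lexx. Qed.

Lemma ediam_set0 n : ediam (set0 : set 'rV[R]_n) = 0.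
Proof. by apply/eqP; rewrite eq_le ediam_ge0 andbT; apply: ediam_le. Qed.

Definition ediam_gauge n (A : set 'rV[R]_n) : \bar R := (pi / 4)%:E * ediam A ^+ 2.

Lemma ediam_gauge_ge0 n (A : set 'rV[R]_n) : 0 <= ediam_gauge A.
Proof.
by rewrite mule_ge0 ?expe_ge0 ?ediam_ge0// lee_fin divr_ge0 ?pi_ge0.
Qed.

Lemma ediam_gauge_le n (A : set 'rV[R]_n) (d : R) : (0 <= d)%R ->
  ediam A <= d%:E -> ediam_gauge A <= (pi / 4 * d ^+ 2)%:E.
Proof.
move=> d0 Ad; rewrite EFinM lee_wpmul2l//.
  by rewrite lee_fin divr_ge0 ?pi_ge0.
by rewrite EFin_expe lee_pmul ?ediam_ge0.
Qed.

Lemma hausdorff2_delta_le n (d : R) (A : set 'rV[R]_n) F : delta_cover d A F ->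
  hausdorff2_delta d A <= \sum_(k <oo) ediam_gauge (F k).
Proof. by move=> dF; apply: ereal_inf_lbound; exists F. Qed.

Lemma le_hausdorff2_delta n (d e : R) (A : set 'rV[R]_n) : (e <= d)%R ->
  hausdorff2_delta d A <= hausdorff2_delta e A.
Proof.
move=> ed; apply: ereal_inf_le_tmp => _ [F [Fe AF] <-]; exists F => //.
by split => // k; rewrite (le_trans (Fe k))// lee_fin.
Qed.

Lemma hausdorff2_delta_le_hausdorff2 n (d : R) (A : set 'rV[R]_n) : (0 < d)%R ->
  hausdorff2_delta d A <= hausdorff2 A.
Proof. by move=> d0; apply: ereal_sup_ubound; exists d. Qed.

(** Covers of A at scale d / l are mapped to covers of the image at scale d. Only F k [&] A is
    mapped, since f is controlled on A alone. *)
Lemma hausdorff2_lipschitz n p (f : 'rV[R]_n -> 'rV[R]_p) (A : set 'rV[R]_n) (l : R) :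
  (0 < l)%R -> (forall x y, A x -> A y -> (enorm (f x - f y) <= l * enorm (x - y))%R) ->
  hausdorff2 (f @` A) <= (l ^+ 2)%:E * hausdorff2 A.
Proof.
move=> l0 fl; have l2 : (0 < l ^+ 2)%R by rewrite exprn_gt0.
apply: ge_ereal_sup => _ [d /= d0 <-].
apply: (@le_trans _ _ ((l ^+ 2)%:E * hausdorff2_delta (d / l) A)); last first.
  rewrite lee_wpmul2l ?lee_fin ?(ltW l2)// hausdorff2_delta_le_hausdorff2//.
  by rewrite divr_gt0.
rewrite -lee_pdivrMl//; apply: le_ereal_inf_tmp => _ [F [Fd AF] <-].
rewrite lee_pdivrMl// -nneseriesZl//; last first.
  by move=> k _; exact: ediam_gauge_ge0.
apply: le_trans (hausdorff2_delta_le (F := fun k => f @` (F k `&` A)) _) _.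
  split=> [k|_ [x Ax <-]]; last first.
    by have [k _ Fkx] := AF x Ax; exists k => //; exists x.
  apply: ediam_le => [|_ _ [x [Fx Ax] <-] [y [Fy Ay] <-]]; first by rewrite lee_fin ltW.
  rewrite lee_fin (le_trans (fl _ _ Ax Ay))// mulrC -ler_pdivlMr// -lee_fin.
  exact: le_trans (le_ediam Fx Fy) (Fd k).
apply: lee_nneseries => k _; first by move=> _; exact: ediam_gauge_ge0.
have D : ediam (f @` (F k `&` A)) <= l%:E * ediam (F k).
  apply: ediam_le => [|_ _ [x [Fx Ax] <-] [y [Fy Ay] <-]].
    by rewrite mule_ge0 ?ediam_ge0// lee_fin ltW.
  apply: (@le_trans _ _ (l%:E * (enorm (x - y))%:E)); first by rewrite -EFinM lee_fin fl.
  by rewrite lee_wpmul2l ?lee_fin ?(ltW l0)// le_ediam.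
rewrite /ediam_gauge [leRHS]muleCA lee_wpmul2l//.
  by rewrite lee_fin divr_ge0 ?pi_ge0.
apply: (@le_trans _ _ ((l%:E * ediam (F k)) ^+ 2)).
  by rewrite !expe2 lee_pmul ?ediam_ge0.
by rewrite !expe2 EFinM muleACA.
Qed.

End hausdorff_lemmas.

(** * Caratheodory's criterion for metric outer measures *)

Section metric_outer_measure.
Context {R : realType} {n : nat}.
Implicit Types (A B T : set 'rV[R]_n) (f : 'rV[R]_n -> R).
Local Open Scope ereal_scope.

(** A set of diameter at most d < e cannot meet both A and B, so a cover of the union splits into
    covers of A and of B sharing no nonempty set. *)
Lemma hausdorff2_separated A B (e : R) : (0 < e)%R ->
  (forall x y, A x -> B y -> (e <= enorm (x - y))%R) ->
  hausdorff2 A + hausdorff2 B <= hausdorff2 (A `|` B).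
Proof.
move=> e0 AB.
have delta_add (d : R) : (0 < d)%R -> (d < e)%R ->
    hausdorff2_delta d A + hausdorff2_delta d B <= hausdorff2_delta d (A `|` B).
  move=> d0 de; apply: le_ereal_inf_tmp => _ [F [Fd ABF] <-].
  (* Sets missing A become empty, with zero gauge, instead of being removed: no reindexing of the
     cover is required. *)
  pose FA k := if pselect (F k `&` A !=set0) then F k else set0.
  pose FB k := if pselect (F k `&` B !=set0) then F k else set0.
  have d0' : 0 <= d%:E by rewrite lee_fin ltW.
  apply: (@le_trans _ _ (\sum_(k <oo) ediam_gauge (FA k) + \sum_(k <oo) ediam_gauge (FB k))).
    apply: leeD; apply: hausdorff2_delta_le; split.
    - by move=> k; rewrite /FA; case: pselect => ?; rewrite ?ediam_set0//; exact: Fd.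
    - move=> x Ax; have [k kT Fx] : (\bigcup_k F k) x by apply: ABF; left.
      exists k => //.
      by rewrite /FA; case: pselect => // -[]; exists x.
    - by move=> k; rewrite /FB; case: pselect => ?; rewrite ?ediam_set0//; exact: Fd.
    - move=> x Bx; have [k kT Fx] : (\bigcup_k F k) x by apply: ABF; right.
      exists k => //.
      by rewrite /FB; case: pselect => // -[]; exists x.
  rewrite -nneseriesD; [|by move=> k _ _; exact: ediam_gauge_ge0..].
  apply: lee_nneseries => k _; first by move=> _; rewrite adde_ge0 ?ediam_gauge_ge0.
  have g0 : ediam_gauge (set0 : set 'rV[R]_n) = 0.
    by rewrite /ediam_gauge ediam_set0 expe2 mul0e mule0.
  rewrite /FA /FB; case: pselect => hA /=; case: pselect => hB /=.
  - have [x [Fx Ax]] := hA; have [y [Fy By]] := hB; have := AB _ _ Ax By; rewrite leNgt => /negP[]; rewrite -lte_fin.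
    by apply: le_lt_trans (le_trans (le_ediam Fx Fy) (Fd k)) _; rewrite lte_fin.
  - by rewrite g0 adde0.
  - by rewrite g0 add0e.
  - by rewrite g0 adde0 ediam_gauge_ge0.
have [->|ABoo] := eqVneq (hausdorff2 (A `|` B)) +oo; first by rewrite leey.
have fin C : C `<=` A `|` B -> hausdorff2 C \is a fin_num.
  move=> CAB; rewrite ge0_fin_numE ?outer_measure_ge0//.
  by apply: le_lt_trans (le_outer_measure (@hausdorff2 R n) _ _ CAB) _; rewrite ltey.
have fA := fin A (@subsetUl _ _ _); have fB := fin B (@subsetUr _ _ _).
apply/lee_addgt0Pr => t t0.
have t2 : (0 < t / 2)%R by rewrite divr_gt0.
have [_ [d1 /= d10 <-] A1] := ub_ereal_sup_adherent t2 fA.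
have [_ [d2 /= d20 <-] B1] := ub_ereal_sup_adherent t2 fB.
pose d := Num.min (e / 2)%R (Num.min d1 d2).
have d0 : (0 < d)%R by rewrite !lt_min d10 d20 divr_gt0.
have de : (d < e)%R by rewrite gt_min ltr_pdivrMr// ltr_pMr ?ltr1n.
have dd1 : (d <= d1)%R by rewrite !ge_min lexx !orbT.
have dd2 : (d <= d2)%R by rewrite !ge_min lexx !orbT.
have A2 : hausdorff2 A <= hausdorff2_delta d A + (t / 2)%:E.
  rewrite -leeBlDr//; apply: le_trans (ltW A1) _; exact: le_hausdorff2_delta.
have B2 : hausdorff2 B <= hausdorff2_delta d B + (t / 2)%:E.
  rewrite -leeBlDr//; apply: le_trans (ltW B1) _; exact: le_hausdorff2_delta.
apply: le_trans (leeD A2 B2) _; rewrite addeACA -EFinD -splitr leeD2r//.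
by apply: le_trans (delta_add d d0 de) _; exact: hausdorff2_delta_le_hausdorff2.
Qed.

Section positive_set.
Variable f : 'rV[R]_n -> R.
Hypothesis f_lip : forall x y, (`|f x - f y| <= enorm (x - y))%R.

Let E (k : nat) : set 'rV[R]_n := [set x | (k.+1%:R^-1 < f x)%R].

Let layer_separated k l x y : (k < l)%N -> (k.+1%:R^-1 < f x)%R -> (f y <= l.+1%:R^-1)%R ->
  (k.+1%:R^-1 - l.+1%:R^-1 <= enorm (x - y))%R.
Proof.
move=> kl fx fy; apply: le_trans (f_lip x y); apply: le_trans (ler_norm _).
by rewrite lerB// ltW.
Qed.

Let gap k l : (k < l)%N -> (0 < k.+1%:R^-1 - l.+1%:R^-1 :> R)%R.
Proof. by move=> kl; rewrite subr_gt0 ltf_pV2 ?posrE// ltr_nat. Qed.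

Variable T : set 'rV[R]_n.
Hypothesis Tfin : hausdorff2 T < +oo.

Let ring (k : nat) : set 'rV[R]_n := T `&` (E k.+1 `\` E k).

(* Rings of the same parity are at positive distance of each other. *)
Let sum_rings (b : bool) N : \sum_(0 <= j < N) hausdorff2 (ring (b + j.*2)) <= hausdorff2 T.
Proof.
pose U N := \bigcup_(j in [set j | (j < N)%N]) ring (b + j.*2).
suff H : \sum_(0 <= j < N) hausdorff2 (ring (b + j.*2)) <= hausdorff2 (U N).
  apply: le_trans H _; apply: le_outer_measure => x [j _]; by case.
elim: N => [|N IH]; first by rewrite big_geq// outer_measure_ge0.
rewrite big_nat_recr//=.
apply: le_trans (leeD2r _ IH) _.
apply: (@le_trans _ _ (hausdorff2 (U N `|` ring (b + N.*2)))); last first.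
  apply: le_outer_measure => x [[j /= jN rx]|rx]; first by exists j => //=; exact: ltnW.
  by exists N => /=.
case: N {IH} => [|N].
  rewrite (_ : U 0%N = set0) ?outer_measure0 ?add0e ?set0U//.
  by apply/seteqP; split => // x [].
(* The earlier rings lie inside [E (b + N.*2.+1)], whereas the new one avoids [E (b + N.*2.+2)]; the
   gap between these consecutive levels separates them. *)
apply: (hausdorff2_separated (gap (ltnSn (b + N.*2.+1)))) => x y [j /= jN [_ [Ex _]]] [_ [_ Ey]].
apply: layer_separated => //.
  apply: le_lt_trans Ex; rewrite lef_pV2 ?posrE// ler_nat addnS !ltnS.
  by rewrite leq_add2l leq_double.
by move/negP : Ey; rewrite -leNgt doubleS !addnS.
Qed.

(** The set T [&] E k is at positive distance from the points where f <= 0, so additivity holds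
    there. The rest of the positive part is covered by the rings of index at least k, the tail of a
    convergent series: each parity class sums to at most the measure of T. *)
Lemma caratheodory_positive_set :
  hausdorff2 (T `&` [set x | (0 < f x)%R]) + hausdorff2 (T `&` ~` [set x | (0 < f x)%R]) <=
  hausdorff2 T.
Proof.
set P := [set x | _]; set a := hausdorff2 (T `&` P); set b := hausdorff2 (T `&` ~` P).
have h0 A : 0 <= hausdorff2 A by exact: outer_measure_ge0.
have inner k : hausdorff2 (T `&` E k) + b <= hausdorff2 T.
  apply: (@le_trans _ _ (hausdorff2 (T `&` E k `|` T `&` ~` P))).
    have k0 : (0 < k.+1%:R^-1 :> R)%R by rewrite invr_gt0.
    apply: (hausdorff2_separated k0) => x y [_ Ex] [_ /negP]; rewrite -leNgt => fy.
    apply: le_trans (f_lip x y); apply: le_trans (ler_norm _).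
    by rewrite lerBrDr (le_trans _ (ltW Ex))// gerDl.
  by apply: le_outer_measure => x [[]|[]].
have ring_sum : \sum_(j <oo) hausdorff2 (ring j) < +oo.
  apply: (@le_lt_trans _ _ (hausdorff2 T + hausdorff2 T)); last by rewrite lte_add_pinfty.
  apply: lime_le; first by apply: is_cvg_nneseries => *; exact: h0.
  apply: nearW => N.
  apply: (@le_trans _ _ (\sum_(0 <= j < N.*2) hausdorff2 (ring j))).
    by apply: lee_sum_nneg_natr => [k _ _|]; [exact: h0|rewrite -addnn leq_addr].
  rewrite (_ : \sum_(0 <= j < N.*2) hausdorff2 (ring j) =
     \sum_(0 <= j < N) hausdorff2 (ring (false + j.*2)) + \sum_(0 <= j < N) hausdorff2 (ring (true + j.*2))).
    by apply: leeD; exact: sum_rings.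
  elim: N => [|N IH]; first by rewrite !big_geq// adde0.
  rewrite doubleS !big_nat_recr//= IH add0n add1n -addeA.
  by rewrite addeACA.
have tail k : a <= hausdorff2 (T `&` E k) + \sum_(k <= j <oo) hausdorff2 (ring j).
  rewrite -(@nneseries_addn _ (fun j => hausdorff2 (ring j)) k (fun _ => h0 _)).
  apply: (@le_trans _ _ (hausdorff2 (T `&` E k `|` \bigcup_j ring (j + k)%N))).
    apply: le_outer_measure => x [Tx fx].
    have [l xl] : exists l, E l x.
      exists (Num.truncn (f x)^-1); rewrite /E /= -[ltRHS]invrK ltf_pV2 ?posrE ?invr_gt0//.
      exact: truncnS_gt.
    have [xk|nxk] := pselect (E k x); first by left.
    right; have [l0 lk] : exists l0, E (l0 + k)%N x.
      exists l; apply: le_lt_trans xl; rewrite lef_pV2 ?posrE// ler_nat ltnS.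
      exact: leq_addr.
    elim: l0 lk => [|l0 IH]; first by rewrite add0n.
    have [/IH//|nx] := pselect (E (l0 + k)%N x).
    by rewrite addSn => xS; exists l0 => //; split.
  apply: le_trans (outer_measureU2 _ _ _) _; rewrite leeD2l//.
  exact: outer_measure_sigma_subadditive.
have tail0 := nneseries_tail_cvg ring_sum (fun k _ => h0 _).
have bfin : b \is a fin_num.
  rewrite ge0_fin_numE ?h0//; apply: (@le_lt_trans _ _ (hausdorff2 T)) => //.
  by apply: le_outer_measure => x [].
apply: (@le_trans _ _ (hausdorff2 T + 0)); last by rewrite adde0.
have C : hausdorff2 T + \sum_(k <= j <oo) hausdorff2 (ring j) @[k --> \oo] --> hausdorff2 T + 0.
  apply: cvgeD => //; last exact: cvg_cst.
  by rewrite fin_num_adde_defl// ge0_fin_numE ?h0.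
rewrite -(cvg_lim _ C)//; apply: lime_ge; first by apply/cvg_ex; eexists; exact: C.
apply: nearW => k; apply: le_trans (leeD2r b (tail k)) _.
by rewrite addeAC leeD2r// inner.
Qed.

End positive_set.

Lemma caratheodory_lipschitz_gt0 f : (forall x y, (`|f x - f y| <= enorm (x - y))%R) ->
  (@hausdorff2 R n).-caratheodory [set x | (0 < f x)%R].
Proof.
move=> f_lip; apply: le_caratheodory_measurable => T.
have [e|Too] := eqVneq (hausdorff2 T) +oo.
  by rewrite -[leRHS]/(hausdorff2 T) e leey.
by apply: caratheodory_positive_set => //; rewrite ltey.
Qed.

End metric_outer_measure.

Section surface_measurability.
Context {R : realType}.

Lemma measurable_lipschitz_surface (f : 'rV[R]_3 -> R) :
  (forall x y, `|f x - f y| <= enorm (x - y)) ->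
  measurable_fun setT (f : surface_space R -> R).
Proof.
move=> f_lip mT; apply: (measurability _ (RGenOInfty.measurableE R)) => //= _ [_ [a ->] <-].
rewrite setTI [X in measurable X](_ : _ = [set x | 0 < f x - a]).
  apply: caratheodory_lipschitz_gt0 => x y.
  by rewrite opprB addrA subrK f_lip.
by apply/seteqP; split => x /=; rewrite in_itv/= andbT subr_gt0.
Qed.

Lemma measurable_coord_surface i :
  measurable_fun setT (fun x : surface_space R => (x : 'rV[R]_3) 0 i).
Proof.
apply: (measurable_lipschitz_surface (f := fun x => x 0 i)) => x y.
by have := le_enorm_coord (x - y) i; rewrite !mxE.
Qed.

(** The distance to A is 1-Lipschitz and is positive exactly off A. *)
Lemma measurable_closed_surface (A : set 'rV[R]_3) :
  closed A -> measurable (A : set (surface_space R)).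
Proof.
move=> cA; have [[a Aa]|/set0P/negP/negPn/eqP ->] := pselect (A !=set0); last exact: measurable0.
pose D x := [set enorm (x - y) | y in A].
have D0 x : D x !=set0 by exists (enorm (x - a)); exists a.
have Dlb x : has_lbound (D x) by exists 0 => _ [y _ <-]; exact: enorm_ge0.
pose f x := inf (D x).
have f_le x y : f x - f y <= enorm (x - y).
  rewrite lerBlDl -lerBlDr; apply: lb_le_inf => // _ [z Az <-].
  rewrite lerBlDr; apply: le_trans (_ : enorm (x - z) <= _); last first.
    by rewrite [leRHS]addrC enorm_triangle.
  by apply: ge_inf => //; exists z.
have f_lip x y : `|f x - f y| <= enorm (x - y).
  by rewrite ler_norml f_le lerNl opprB enormB f_le.
rewrite -[A]setCK; apply: measurableC; rewrite (_ : ~` A = [set x | 0 < f x]).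
  exact: caratheodory_lipschitz_gt0.
apply/seteqP; split => [x nAx|x /= fx Ax]; last first.
  have : f x <= 0; last by rewrite leNgt fx.
  by apply: ge_inf => //; exists x; rewrite // subrr enorm0.
have /nbhs_ballP[e /= e0 xe] : nbhs x (~` A) by apply: open_nbhs_nbhs; split => //; exact: closed_openC.
apply: (lt_le_trans e0); apply: lb_le_inf => // _ [y Ay <-].
rewrite leNgt; apply/negP => yx; apply: (xe y) Ay; split=> // i j; rewrite ord1 /ball/=.
by apply: le_lt_trans yx; have := le_enorm_coord (x - y) j; rewrite !mxE.
Qed.

End surface_measurability.

(** * Hausdorff measure of plane squares *)

Section plane_area.
Context {R : realType}.
Local Notation j1 := (lift ord0 ord0 : 'I_2).

Definition square (c : 'rV[R]_2) (r : R) : set 'rV[R]_2 :=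
  [set y | forall i, `|y 0 i - c 0 i| <= r].

Let enorm2_le (x : 'rV[R]_2) (h : R) : (forall i, `|x 0 i| <= h) -> enorm x <= 2 * h.
Proof.
move=> xh; apply: le_trans (enorm_le_sum x) _.
by rewrite !big_ord_recl big_ord0 addr0 mulr2n mulrDl !mul1r lerD.
Qed.

Lemma hausdorff2_square_le (c : 'rV[R]_2) (r : R) : 0 < r ->
  (hausdorff2 (square c r) <= (4 * pi * r ^+ 2)%:E)%E.
Proof.
move=> r0; apply: ge_ereal_sup => _ [d /= d0 <-].
(* Cells of side h = 2 r / n then have diameter at most 2 h <= d, and n^2 gauges (pi/4)(2 h)^2 add
   up to 4 pi r^2, whatever d. *)
pose n := (Num.truncn (4 * r / d)).+1.
have n0 : (0 : R) < n%:R by rewrite ltr0n.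
pose h := 2 * r / n%:R.
have h0 : 0 < h by rewrite divr_gt0 ?mulr_gt0.
have hd : 2 * h <= d.
  rewrite /h !mulrA ler_pdivrMr// [d * _]mulrC -ler_pdivrMr//.
  have := ltW (truncnS_gt (4 * r / d)); rewrite -/n.
  by rewrite (_ : 2 * 2 = 4 :> R)//; ring.
pose cell (a b : nat) : set 'rV[R]_2 :=
  [set y | (a%:R * h <= y 0 0 - c 0 0 + r <= a%:R * h + h) /\
           (b%:R * h <= y 0 j1 - c 0 j1 + r <= b%:R * h + h)].
have cell_diam a b : (ediam (cell a b) <= (2 * h)%:E)%E.
  apply: ediam_le => [|x y [/andP[x1 x2] /andP[x3 x4]] [/andP[y1 y2] /andP[y3 y4]]].
    by rewrite lee_fin mulr_ge0 ?(ltW h0).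
  rewrite lee_fin enorm2_le// => i; rewrite !mxE ler_norml.
  have [->|->] : i = 0 \/ i = j1.
    by case: i => -[|[|//]] ? ; [left|right]; exact: val_inj.
  - by apply/andP; split; lra.
  - by apply/andP; split; lra.
pose N := (n * n)%N; pose g := pi / 4 * (2 * h) ^+ 2.
have g0 : 0 <= g by rewrite mulr_ge0 ?sqr_ge0 ?divr_ge0 ?pi_ge0.
pose F k := if (k < N)%N then cell (k %/ n)%N (k %% n)%N else set0.
apply: le_trans (hausdorff2_delta_le (F := F) _) _.
  split => [k|y yc].
    rewrite /F; case: ifP => _; last by rewrite ediam_set0 lee_fin ltW.
    by apply: le_trans (cell_diam _ _) _; rewrite lee_fin.
  have index i : exists2 a, (a < n)%N & a%:R * h <= y 0 i - c 0 i + r <= a%:R * h + h.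
    have := yc i; rewrite ler_norml => /andP[yl yu].
    have s0 : 0 <= (y 0 i - c 0 i + r) / h by rewrite divr_ge0 ?(ltW h0)//; lra.
    have nh : n%:R * h = 2 * r by rewrite /h mulrC divfK// gt_eqF.
    have /andP[t1 t2] := truncn_itv s0; set a := Num.truncn _ in t1 t2.
    rewrite ler_pdivlMr// in t1; rewrite ltr_pdivrMr// -natr1 mulrDl mul1r in t2.
    have [an|na] := ltnP a n; first by exists a => //; rewrite t1 ltW.
    (* Points of the far edge get index n from the truncation; they belong to the closed last
       cell. *)
    exists n.-1 => //; have -> : n.-1%:R * h + h = n%:R * h.
      have n1 : n%:R = n.-1%:R + 1 :> R by rewrite natr1.
      by rewrite n1 mulrDl mul1r.
    apply/andP; split; last by rewrite nh; lra.
    apply: le_trans t1; rewrite ler_pM2r// ler_nat; exact: leq_trans (leq_pred _) na.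
  have [a an ay] := index 0; have [b bn yb] := index j1.
  exists (a * n + b)%N => //; rewrite /F.
  have abN : (a * n + b < N)%N.
    by apply: (@leq_trans (a * n + n)%N); rewrite ?ltn_add2l// /N -mulSnr leq_mul2r an orbT.
  by rewrite abN divnMDl// divn_small// addn0 modnMDl modn_small.
apply: lime_le; first by apply: is_cvg_nneseries => k _ _; exact: ediam_gauge_ge0.
apply: nearW => m; apply: (@le_trans _ _ ((minn m N)%:R * g)%:E).
  elim: m => [|m IH]; first by rewrite big_geq// min0n mul0r.
  rewrite big_nat_recr//=; have [mN|Nm] := ltnP m N.
    rewrite /F mN; apply: (@le_trans _ _ ((m%:R * g)%:E + g%:E)%E).
      rewrite leeD//; last by apply: ediam_gauge_le => //; rewrite mulr_ge0 ?(ltW h0).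
      by rewrite -[m in m%:R](minn_idPl (ltnW mN)).
    by rewrite -EFinD lee_fin (minn_idPl mN) -natr1 mulrDl mul1r.
  rewrite {2}/F ltnNge Nm /= (_ : ediam_gauge set0 = 0%E) ?adde0; last first.
    by rewrite /ediam_gauge ediam_set0 expe2 mul0e mule0.
  by apply: le_trans IH _; rewrite lee_fin ler_wpM2r// ler_nat !(minn_idPr _)// ltnW.
rewrite lee_fin; apply: (@le_trans _ _ (N%:R * g)).
  by rewrite ler_wpM2r// ler_nat geq_minr.
by rewrite /N /g /h natrM le_eqVlt; apply/orP; left; apply/eqP; field; rewrite gt_eqF.
Qed.

(** A covering set of diameter w lies in a square of half-side w around one of its points, of
    Lebesgue area 4 w^2. Subadditivity of Lebesgue measure concludes, a gauge being pi/16 times that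
    area. *)
Lemma hausdorff2_square_ge (r : R) : 0 < r ->
  ((pi / 4 * r ^+ 2)%:E <= hausdorff2 (square 0 r))%E.
Proof.
(* Any scale would do; 1 makes the diameters of the covering sets finite. *)
move=> r0; apply: le_trans (hausdorff2_delta_le_hausdorff2 _ (ltr01 : (0 < 1 :> R))).
apply: le_ereal_inf_tmp => _ [F [Fd QF] <-].
have fd k : ediam (F k) \is a fin_num.
  by rewrite ge0_fin_numE ?ediam_ge0// (le_lt_trans (Fd k))// ltry.
pose w k : R := fine (ediam (F k)).
have w0 k : 0 <= w k by rewrite fine_ge0 ?ediam_ge0.
have /choice[p pP] : forall k, exists p : 'rV[R]_2, F k !=set0 -> F k p.
  by move=> k; have [[x Fx]|nF] := pselect (F k !=set0); [exists x|exists 0].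
pose leb := @lebesgue_measure R.
pose box k : set (R * R) := `[p k 0 0 - w k, p k 0 0 + w k]%classic `*`
                            `[p k 0 j1 - w k, p k 0 j1 + w k]%classic.
have itv_len (a b : R) : a <= b -> leb `[a, b]%classic = (b - a)%:E.
  move=> ab; rewrite /leb lebesgue_measure_itv /= lte_fin.
  move: ab; rewrite le_eqVlt => /orP[/eqP->|ab]; first by rewrite ltxx subrr.
  by rewrite ab EFinB.
have square_len (a b l : R) : 0 <= l ->
    (leb \x leb)%E (`[a - l, a + l]%classic `*` `[b - l, b + l]%classic) = (4 * l ^+ 2)%:E.
  move=> l0; have ww (x : R) : x - l <= x + l by lra.
  transitivity (leb `[(a - l)%R, (a + l)%R]%classic * leb `[(b - l)%R, (b + l)%R]%classic)%E.
    exact: product_measure1E.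
  by rewrite !itv_len// -EFinM; congr EFin; ring.
have box_len k : (leb \x leb)%E (box k) = (4 * w k ^+ 2)%:E.
  exact: square_len.
have Q_len : (leb \x leb)%E (`[(- r), r]%classic `*` `[(- r), r]%classic) = (4 * r ^+ 2)%:E.
  by have := square_len 0 0 _ (ltW r0); rewrite !add0r.
have cover : `[(- r), r]%classic `*` `[(- r), r]%classic `<=` \bigcup_k box k.
  move=> [a b] [/=]; rewrite !in_itv/= => ar br.
  pose y : 'rV[R]_2 := \row_i (if i == 0 then a else b).
  have [k _ Fy] : (\bigcup_k F k) y.
    by apply: QF => i; rewrite !mxE subr0 ler_norml; case: ifP.
  have Fp : F k (p k) by apply: pP; exists y.
  have yp i : `|y 0 i - p k 0 i| <= w k.
    rewrite -lee_fin /w fineK//; apply: le_trans (le_ediam Fy Fp).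
    by rewrite lee_fin; have := le_enorm_coord (y - p k) i; rewrite !mxE.
  exists k => //; split; rewrite /= in_itv/=.
    by have := yp 0; rewrite !mxE/= ler_distl.
  by have := yp j1; rewrite !mxE/= ler_distl.
have : ((4 * r ^+ 2)%:E <= \sum_(k <oo) (4 * w k ^+ 2)%:E)%E.
  rewrite -Q_len; under eq_eseriesr do rewrite -box_len.
  apply: measure_sigma_subadditive => //.
  - by move=> k; apply: measurableX; exact: measurable_itv.
  - by apply: measurableX; exact: measurable_itv.
have c0 : 0 <= pi / 16 :> R by rewrite divr_ge0 ?pi_ge0.
have -> : (pi / 4 * r ^+ 2)%:E = ((pi / 16)%:E * (4 * r ^+ 2)%:E)%E :> \bar R.
  by rewrite -EFinM; congr EFin; field.
move=> /(lee_wpmul2l (_ : 0 <= (pi / 16)%:E)%E) H; apply: le_trans (H _) _; first by rewrite lee_fin.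
rewrite -nneseriesZl//; last by move=> k _; rewrite lee_fin mulr_ge0 ?sqr_ge0.
apply: lee_nneseries => [k _ _|k _].
  have ww := sqr_ge0 (w k).
  apply: mule_ge0; rewrite lee_fin//; apply: mulr_ge0 => //.
rewrite /ediam_gauge -(fineK (fd k)) -/(w k) -EFin_expe -!EFinM lee_fin.
by rewrite le_eqVlt; apply/orP; left; apply/eqP; field.
Qed.

End plane_area.

(** * Lipschitz domains *)

Section enorm_topology.
Context {R : realType} {n : nat}.
Implicit Types x y : 'rV[R]_n.

Lemma nbhs_enormP x (A : set 'rV[R]_n) :
  nbhs x A <-> exists2 e : R, 0 < e & forall y, enorm (y - x) < e -> A y.
Proof.
split=> [/nbhs_ballP[e /= e0 xe]|[e e0 xe]].
  exists e => // y yx; apply: xe; split=> // i j; rewrite ord1 /ball/=.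
  by apply: le_lt_trans yx; rewrite enormB; have := le_enorm_coord (x - y) j; rewrite !mxE.
have e'0 : 0 < e / n.+1%:R by rewrite divr_gt0.
apply/nbhs_ballP; exists (e / n.+1%:R) => //= y [_ xy]; apply: xe.
rewrite enormB; apply: le_lt_trans (enorm_le_sum _) _.
apply: (@le_lt_trans _ _ (\sum_(i < n) (e / n.+1%:R))).
  by apply: ler_sum => i _; have /ltW := xy 0 i; rewrite !mxE.
rewrite sumr_const card_ord -[_ *+ n]mulr_natr -mulrA gtr_pMr// mulrC ltr_pdivrMr//.
by rewrite mul1r ltr_nat.
Qed.

Lemma enorm_mulmx_frame x (F : 'M[R]_n) : F *m F^T = 1%:M -> enorm (x *m F) = enorm x.
Proof.
have enorm_dot z : enorm z = Num.sqrt ((z *m z^T) 0 0).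
  by rewrite mxE; congr Num.sqrt; apply: eq_bigr => i _; rewrite mxE expr2.
by move=> F1; rewrite !enorm_dot trmx_mul -mulmxA [F *m _]mulmxA F1 mul1mx.
Qed.

End enorm_topology.

Lemma enorm_submx (R : realType) m p (u : 'rV[R]_(m + p)) :
  enorm u ^+ 2 = enorm (lsubmx u) ^+ 2 + enorm (rsubmx u) ^+ 2.
Proof.
by rewrite !enorm2 big_split_ord /=; congr (_ + _); apply: eq_bigr => i _; rewrite mxE.
Qed.

Lemma enorm_rV1 (R : realType) (u : 'rV[R]_1) : enorm u = `|u 0 0|.
Proof. by rewrite /enorm big_ord_recl big_ord0 addr0 sqrtr_sqr. Qed.

Lemma boundary_closed (T : topologicalType) (A : set T) : closed (boundary A).
Proof.
rewrite /boundary setDE; apply: closedI; first exact: closed_closure.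
by apply: open_closedC; exact: open_interior.
Qed.

(** * Coordinate cylinders and graphs *)

Section chart.
Context {R : realType}.
Implicit Types (Z : graph_cylinder R) (x : 'rV[R]_3) (y : 'rV[R]_2) (t : R).

Definition chart Z y t : 'rV[R]_3 :=
  centre Z + (row_mx y (\row_(_ < 1) t) : 'rV[R]_3) *m (frame Z)^T.

Definition on_graph Z y := chart Z y (graph Z y).

Variable Z : graph_cylinder R.
Hypothesis frame1 : frame Z *m (frame Z)^T = 1%:M.

Let frame1' : (frame Z)^T *m frame Z = 1%:M.
Proof. exact: mulmx1C. Qed.

Let local_chart y t : local_coord Z (chart Z y t) = row_mx y (\row_(_ < 1) t).
Proof.
rewrite /local_coord /chart addrC addKr -mulmxA frame1'.
exact: (mulmx1 (row_mx y (\row_(_ < 1) t) : 'rV[R]_3)).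
Qed.

Lemma base_chart y t : base_coord Z (chart Z y t) = y.
Proof. by rewrite /base_coord local_chart row_mxKl. Qed.

Lemma axis_chart y t : axis_coord Z (chart Z y t) = t.
Proof. by rewrite /axis_coord local_chart row_mxKr mxE. Qed.

Lemma chart_coord x : chart Z (base_coord Z x) (axis_coord Z x) = x.
Proof.
rewrite /chart /base_coord /axis_coord.
have -> : \row_(_ < 1) (rsubmx (local_coord Z x) 0 0) = rsubmx (local_coord Z x).
  by apply/rowP => i; rewrite mxE ord1.
rewrite hsubmxK /local_coord -mulmxA frame1 mulmx1.
by rewrite addrC subrK.
Qed.

Let localB x x' : local_coord Z x - local_coord Z x' = (x - x') *m frame Z.
Proof. by rewrite /local_coord -mulmxBl opprB addrA subrK. Qed.

Let enorm_local x x' : enorm (x - x') ^+ 2 =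
  enorm (base_coord Z x - base_coord Z x') ^+ 2 + (axis_coord Z x - axis_coord Z x') ^+ 2.
Proof.
rewrite -(enorm_mulmx_frame (x - x') frame1) -localB.
rewrite (enorm_submx (m := 2) (p := 1)) !linearB/=; congr (_ + _).
by rewrite enorm_rV1 real_normK ?num_real// /axis_coord !mxE.
Qed.

Lemma enorm_base_coord x x' : enorm (base_coord Z x - base_coord Z x') <= enorm (x - x').
Proof.
by rewrite -(@ler_pXn2r _ 2)// ?nnegrE ?enorm_ge0// enorm_local lerDl sqr_ge0.
Qed.

Lemma enorm_axis_coord x x' : `|axis_coord Z x - axis_coord Z x'| <= enorm (x - x').
Proof.
by rewrite -(@ler_pXn2r _ 2)// ?nnegrE ?enorm_ge0// enorm_local real_normK ?num_real// lerDr sqr_ge0.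
Qed.

Lemma enorm_chart y y' t t' :
  enorm (chart Z y t - chart Z y' t') <= enorm (y - y') + `|t - t'|.
Proof.
rewrite -(@ler_pXn2r _ 2)// ?nnegrE ?addr_ge0 ?enorm_ge0// enorm_local !base_chart !axis_chart.
rewrite [leRHS]sqrrD real_normK ?num_real// lerD2r lerDl mulrn_wge0// mulr_ge0// enorm_ge0//.
Qed.

End chart.

Section coordinate_cylinder_theory.
Context {R : realType}.
Variables (r0 r1 L : R) (B : set 'rV[R]_3) (Z : graph_cylinder R).
Hypothesis r0_gt0 : 0 < r0.
Hypothesis B_open : open B.
Hypothesis BZ : coordinate_cylinder r0 r1 L B Z.
Let frame1 := cc_frame BZ.

(** The sign of L is not prescribed, hence |L| in all the constants. *)
Let lip (y y' : 'rV[R]_2) : `|graph Z y - graph Z y'| <= `|L| * enorm (y - y').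
Proof.
by apply: le_trans (cc_lipschitz BZ _ _) _; rewrite ler_wpM2r ?enorm_ge0// ler_norm.
Qed.

(** A boundary point strictly below the graph would have a neighbourhood free of B; strictly above,
    it would lie in the open set B. *)
Lemma boundary_on_graph x : boundary B x -> cylinder Z x ->
  axis_coord Z x = graph Z (base_coord Z x).
Proof.
move=> [clx nix] Zx; have [lt_x|gt_x|//] := ltgtP (axis_coord Z x) (graph Z (base_coord Z x)).
  have [cb ca] := Zx.
  (* The first two radii keep the ball inside the cylinder. With the third, the axis coordinate
     moves by less than e and the graph by at most |L| e, too little to close the gap. *)
  pose e := Num.min (base_radius Z - enorm (base_coord Z x))
    (Num.min (half_height Z - `|axis_coord Z x|)
      ((graph Z (base_coord Z x) - axis_coord Z x) / (1 + `|L|))).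
  have L1 : 0 < 1 + `|L| by rewrite ltr_wpDr.
  have e0 : 0 < e by rewrite !lt_min !subr_gt0 cb ca /= divr_gt0// subr_gt0.
  have /clx[x' [Bx' x'x]] : nbhs x [set x' | enorm (x' - x) < e].
    by apply/nbhs_enormP; exists e.
  have e1 : e <= base_radius Z - enorm (base_coord Z x) by rewrite ge_min lexx.
  have e2 : e <= half_height Z - `|axis_coord Z x| by rewrite !ge_min lexx orbT.
  have e3 : e <= (graph Z (base_coord Z x) - axis_coord Z x) / (1 + `|L|).
    by rewrite !ge_min lexx !orbT.
  have bx := enorm_base_coord frame1 x' x.
  have ax := enorm_axis_coord frame1 x' x.
  have Zx' : cylinder Z x'.
    split.
      have := enormD (base_coord Z x' - base_coord Z x) (base_coord Z x).
      by rewrite subrK; move: x'x => /=; lra.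
    have := ler_normD (axis_coord Z x' - axis_coord Z x) (axis_coord Z x).
    by rewrite subrK; move: x'x => /=; lra.
  exfalso; have : (cylinder Z `&` B) x' by [].
  rewrite (cc_above BZ) => -[_ /=]; apply/negP; rewrite -leNgt.
  have gx : `|graph Z (base_coord Z x') - graph Z (base_coord Z x)| <= `|L| * enorm (x' - x).
    by apply: le_trans (lip _ _) _; rewrite ler_wpM2l.
  rewrite ler_pdivlMr// mulrC in e3.
  have e4 : (1 + `|L|) * enorm (x' - x) < (1 + `|L|) * e by rewrite ltr_pM2l.
  rewrite mulrDl mul1r in e4.
  move: gx ax; rewrite !ler_norml => /andP[g1 _] /andP[_ a2].
  by move: (`|L| * _) g1 e4 => k g1 e4; lra.
exfalso; apply: nix; have : (cylinder Z `&` B) x by rewrite (cc_above BZ).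
by move=> [_ Bx]; move: B_open; rewrite openE => /(_ x Bx).
Qed.

Lemma on_graph_boundary y : enorm y < base_radius Z -> `|graph Z y| < half_height Z ->
  boundary B (on_graph Z y).
Proof.
move=> yr yh; set x := on_graph Z y.
have bx : base_coord Z x = y by rewrite base_chart.
have ax : axis_coord Z x = graph Z y by rewrite axis_chart.
have Zx : cylinder Z x by split; rewrite ?bx ?ax.
split.
  move=> A /nbhs_enormP[e e0 xA].
  pose t := Num.min e (half_height Z - `|graph Z y|) / 2.
  have m0 : 0 < Num.min e (half_height Z - `|graph Z y|) by rewrite lt_min e0 subr_gt0.
  have t0 : 0 < t by rewrite divr_gt0.
  have mt : Num.min e (half_height Z - `|graph Z y|) = 2 * t by rewrite /t mulrC divfK.
  have te : 2 * t <= e by rewrite -mt ge_min lexx.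
  have th : 2 * t <= half_height Z - `|graph Z y| by rewrite -mt ge_min lexx orbT.
  exists (chart Z y (graph Z y + t)); split; last first.
    apply: xA; apply: le_lt_trans (enorm_chart frame1 _ _ _ _) _.
    by rewrite subrr enorm0 add0r addrC addKr gtr0_norm//; lra.
  suff [] : (cylinder Z `&` B) (chart Z y (graph Z y + t)) by [].
  rewrite (cc_above BZ); split.
    split; rewrite ?base_chart ?axis_chart//.
    by have := ler_normD (graph Z y) t; rewrite (gtr0_norm t0); lra.
  by rewrite /= base_chart ?axis_chart// ltrDl.
move=> /interior_subset Bx; have : (cylinder Z `&` B) x by [].
by rewrite (cc_above BZ) => -[_ /=]; rewrite bx ax ltxx.
Qed.

Lemma area_cylinder_ball_le (x : 'rV[R]_3) (r : R) : 0 < r ->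
  (hausdorff2 (boundary B `&` cylinder Z `&` [set x' | (enorm (x' - x) <= r)%R]) <=
    ((1 + `|L|) ^+ 2 * (4 * pi * r ^+ 2))%:E)%E.
Proof.
move=> r_gt0; have L1 : 0 < 1 + `|L| by rewrite ltr_wpDr.
apply: (@le_trans _ _ (hausdorff2 (on_graph Z @` square (base_coord Z x) r))).
  apply: le_outer_measure => x' [[Bx' Zx'] xx'] /=.
  exists (base_coord Z x'); last first.
    by rewrite /on_graph -boundary_on_graph// chart_coord.
  move=> i; have := le_enorm_coord (base_coord Z x' - base_coord Z x) i; rewrite !mxE => h.
  by apply: le_trans h _; apply: le_trans (enorm_base_coord frame1 _ _) _.
apply: le_trans (hausdorff2_lipschitz L1 _) _ => [y y' _ _|].
  apply: le_trans (enorm_chart frame1 _ _ _ _) _.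
  by rewrite mulrDl mul1r lerD2l lip.
by rewrite [leRHS]EFinM lee_wpmul2l ?hausdorff2_square_le// lee_fin sqr_ge0.
Qed.

Lemma area_ge :
  ((pi / 4 * (r0 / (4 * (1 + `|L|))) ^+ 2)%:E <= hausdorff2 (boundary B))%E.
Proof.
have L1 : 0 < 1 + `|L| by rewrite ltr_wpDr.
(* Over the square of half-side s, |y| <= 2 s and, as the graph vanishes at 0, its height is at most
   2 |L| s. Both are below r0, so this part of the graph stays in the cylinder. *)
pose s := r0 / (4 * (1 + `|L|)).
have s0 : 0 < s by rewrite divr_gt0// mulr_gt0.
apply: le_trans (hausdorff2_square_ge s0) _.
apply: (@le_trans _ _ (hausdorff2 (base_coord Z @` boundary B))); last first.
  have := @hausdorff2_lipschitz R 3 2 (base_coord Z) (boundary B) 1 ltr01.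
  rewrite expr1n mul1e; apply => x y _ _.
  by rewrite mul1r enorm_base_coord.
apply: le_outer_measure => y sy.
have ey : enorm y <= 2 * s.
  apply: le_trans (enorm_le_sum y) _.
  rewrite !big_ord_recl big_ord0 addr0 mulr2n mulrDl !mul1r.
  by apply: lerD; [have := sy 0|have := sy (lift ord0 ord0)]; rewrite mxE subr0.
have sr : 4 * (1 + `|L|) * s = r0 by rewrite /s mulrC divfK// gt_eqF// mulr_gt0.
have Ls : 0 <= `|L| * s by rewrite mulr_ge0// ltW.
have sL : 4 * s + 4 * (`|L| * s) = r0 by rewrite -sr; ring.
have gy : `|graph Z y| <= `|L| * enorm y.
  by have := lip y 0; rewrite (cc_graph0 BZ) !subr0.
have Ly : `|L| * enorm y <= 2 * (`|L| * s) by rewrite mulrCA ler_wpM2l.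
have /andP[rb _] := cc_radius BZ; have /andP[rh _] := cc_height BZ.
exists (on_graph Z y); last by rewrite base_chart.
apply: on_graph_boundary; first by lra.
by move: (`|L| * enorm y) (`|L| * s) gy Ly Ls sL => a b; lra.
Qed.

End coordinate_cylinder_theory.

Section boundary_topology.

(** Otherwise A [&] B = A [&] closure B would be open and closed in A. *)
Lemma connected_meets_boundary (T : topologicalType) (A B : set T) :
  connected A -> open B -> A `&` B !=set0 -> ~ A `<=` B -> A `&` boundary B !=set0.
Proof.
move=> cA oB AB nAB; apply: contrapT => nAbB; apply: nAB.
suff -> : A = A `&` B by exact: subIsetr.
apply/esym/cA => //; first by exists B.
exists (closure B); first exact: closed_closure.
apply/seteqP; split => x [Ax Bx]; split => //; first exact: subset_closure.
apply: contrapT => nBx; apply: nAbB; exists x; split => //; split => //.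
by move=> /interior_subset.
Qed.

Context {R : realType} {n : nat}.
Implicit Types (A : set 'rV[R]_n) (x y : 'rV[R]_n).

Lemma boundary_enormP A x : boundary A x <-> forall e : R, 0 < e ->
  (exists2 y, A y & enorm (y - x) < e) /\ (exists2 y, ~ A y & enorm (y - x) < e).
Proof.
split=> [[clx nix] e e0|H].
  split.
    have /clx[y [Ay yx]] : nbhs x [set y | enorm (y - x) < e] by apply/nbhs_enormP; exists e.
    by exists y.
  apply: contrapT => nA; apply: nix; apply/nbhs_enormP; exists e => // y yx.
  by apply: contrapT => nAy; apply: nA; exists y.
split=> [V /nbhs_enormP[e e0 xV]|/nbhs_enormP[e e0 xA]].
  by have [[y Ay yx] _] := H e e0; exists y; split => //; exact: xV.
by have [_ [y nAy yx]] := H e e0; apply: nAy; exact: xA.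
Qed.

Lemma boundary_scale (eps : R) (z : 'rV[R]_n) A x : 0 < eps ->
  boundary A x -> boundary [set eps *: y + z | y in A] (eps *: x + z).
Proof.
move=> eps0 /boundary_enormP H; apply/boundary_enormP => e e0.
have dE y : enorm (eps *: y + z - (eps *: x + z)) = eps * enorm (y - x).
  by rewrite opprD addrACA subrr addr0 -scalerBr enormZ gtr0_norm.
have [[y Ay yx] [y' nAy y'x]] := H (e / eps) (divr_gt0 e0 eps0).
rewrite ltr_pdivlMr// mulrC -dE in yx; rewrite ltr_pdivlMr// mulrC -dE in y'x.
split; first by exists (eps *: y + z) => //; exists y.
exists (eps *: y' + z) => // -[w Aw] /addIr/(scalerI (lt0r_neq0 eps0)) wy'.
by rewrite -wy' in nAy.
Qed.

End boundary_topology.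

Section scaled_copy_boundary.
Context {R : realType}.
Implicit Types (B : set 'rV[R]_3) (x z : 'rV[R]_3) (eps : R).

Let scale_inv eps z x : 0 < eps -> eps^-1 *: (eps *: x + z) - eps^-1 *: z = x.
Proof. by move=> e0; rewrite scalerDr addrK scalerA mulVf ?scale1r// gt_eqF. Qed.

Lemma boundary_scaled_copy eps z B : 0 < eps ->
  boundary (scaled_copy eps z B) = [set eps *: x + z | x in boundary B].
Proof.
move=> eps0; have scaleK x : eps *: (eps^-1 *: x - eps^-1 *: z) + z = x.
  by rewrite scalerBr !scalerA mulfV ?gt_eqF// !scale1r subrK.
apply/seteqP; split => [x bx|_ [x bx <-]]; last exact: boundary_scale.
exists (eps^-1 *: x - eps^-1 *: z) => //.
have ei0 : 0 < eps^-1 by rewrite invr_gt0.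
have := boundary_scale (- (eps^-1 *: z)) ei0 bx.
rewrite (_ : [set _ | _ in _] = B)//; apply/seteqP; split => [_ [_ [y By <-] <-]|y By].
  by rewrite scale_inv.
by exists (eps *: y + z); [exists y|rewrite scale_inv].
Qed.

End scaled_copy_boundary.

Lemma interval_cover_le (R : realType) (k : nat) (c : 'I_k -> R) (l a b : R) : 0 <= l ->
  `[a, b]%classic `<=` \bigcup_i `[c i - l, c i + l]%classic -> b - a <= k%:R * (2 * l).
Proof.
move=> l0; case: k c => [c|k c cover].
  move=> cover; rewrite mul0r subr_le0 leNgt; apply/negP => ab.
  have : `[a, b]%classic a by rewrite /= in_itv/= lexx ltW.
  by move=> /cover[[]].
have [ab|/ltW ab] := leP b a.
  by apply: (@le_trans _ _ 0); rewrite ?subr_le0// !mulr_ge0.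
pose F j : set R := `[c (inord j) - l, c (inord j) + l]%classic.
have : (lebesgue_measure `[a, b]%classic <= \sum_(j < k.+1) lebesgue_measure (F j))%E.
  apply: content_subadditive => [j _|//|x /cover[i _ xi]]; first exact: measurable_itv.
  by rewrite -bigcup_mkord; exists i => //=; rewrite /F inord_val.
have len (x y : R) : x <= y -> lebesgue_measure `[x, y]%classic = (y - x)%:E.
  move=> xy; rewrite lebesgue_measure_itv /= lte_fin; move: xy.
  by rewrite le_eqVlt => /orP[/eqP->|->]; rewrite ?ltxx ?subrr ?EFinB.
rewrite len// (eq_bigr (fun=> (2 * l)%:E)) => [|j _]; last first.
  by rewrite len ?lerD2l ?ge0_cp//; congr EFin; ring.
by rewrite sumEFin lee_fin sumr_const card_ord -[_ *+ k.+1]mulr_natl.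
Qed.

Section lipschitz_domain_theory.
Context {R : realType}.
Variables (N : nat) (r0 r1 L : R) (B : set 'rV[R]_3).
Hypothesis r0_gt0 : 0 < r0.
Hypothesis B_open : open B.
Hypothesis B_bounded : bounded_set B.
Hypothesis B_simply_connected : simply_connected R B.
Hypothesis B0 : B 0.
Hypothesis B_lip : lipschitz_character_le N r0 r1 L B.

Lemma area_ball_le (x : 'rV[R]_3) (r : R) : 0 < r ->
  (hausdorff2 (boundary B `&` [set x' | (enorm (x' - x) <= r)%R]) <=
    (N%:R * ((1 + `|L|) ^+ 2 * (4 * pi * r ^+ 2)))%:E)%E.
Proof.
move=> r_gt0; have [k [Z [kN BZ cover]]] := B_lip.
set K := _ ^+ 2 * _; have K0 : 0 <= K.
  by rewrite mulr_ge0 ?sqr_ge0// mulr_ge0 ?sqr_ge0// mulr_ge0 ?pi_ge0.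
case: k Z kN BZ cover => [Z _ _ cover|k Z kN BZ cover].
  have -> : boundary B `&` [set x' | enorm (x' - x) <= r] = set0.
    by rewrite -subset0 => x' [/cover[[]]].
  rewrite (outer_measure0 (@hausdorff2 R 3)) lee_fin.
  by rewrite mulr_ge0.
pose F j := boundary B `&` cylinder (Z (inord j)) `&` [set x' | enorm (x' - x) <= r].
apply: (@le_trans _ _ (hausdorff2 (\big[setU/set0]_(j < k.+1) F j))).
  apply: le_outer_measure => x' [bx' x'x]; have [i _ Zx'] := cover _ bx'.
  by rewrite -bigcup_mkord; exists i => //=; rewrite /F inord_val.
apply: le_trans (outer_measure_subadditive _ _ _) _.
apply: (@le_trans _ _ (\sum_(j < k.+1) K%:E)%E).
  by apply: lee_sum => j _; exact: (area_cylinder_ball_le (B := B) B_open (BZ _)).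
by rewrite sumEFin lee_fin sumr_const card_ord -[K *+ _]mulr_natl ler_wpM2r// ler_nat.
Qed.

(** Boundedness is used qualitatively: T may depend on B, whereas the final bound must involve only
    N and r1. *)
Let B_escape (b : 'rV[R]_3) (j : 'I_3) : B b ->
  exists2 T, 0 <= T & ~ B (b + T *: delta_mx 0 j).
Proof.
move=> Bb; have [M0 [_ BM0]] := B_bounded.
have M01 : M0 < M0 + 1 by rewrite ltrDl.
have BM := BM0 _ M01; set M := M0 + 1 in BM.
have coord_le x : B x -> `|x 0 j| <= M.
  move=> Bx; apply: le_trans (BM x Bx).
  have -> : `|x| = \big[Num.max/0%R]_ij `|x ij.1 ij.2| by rewrite -mx_normrE.
  exact: (le_bigmax 0 (fun ij : 'I_1 * 'I_3 => `|x ij.1 ij.2|) (0, j)).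
have M_ge0 : 0 <= M by apply: le_trans (coord_le _ Bb).
exists (M - b 0 j + 1) => [|/coord_le].
  by have := coord_le _ Bb; rewrite ler_norml; lra.
rewrite !mxE !eqxx mulr1 (_ : b 0 j + _ = M + 1); last by ring.
by rewrite ger0_norm; lra.
Qed.

Let boundary_line (b : 'rV[R]_3) (j : 'I_3) : B b ->
  exists2 x, boundary B x & forall i, i != j -> x 0 i = b 0 i.
Proof.
move=> Bb; have [T T0 nB] := B_escape j Bb.
pose f (s : R) : 'rV[R]_3 := b + s *: delta_mx 0 j.
have cf : continuous f.
  by move=> s; apply: cvgD; [exact: cvg_cst|apply: cvgZr_tmp; exact: cvg_id].
have cA := connected_continuous_connected (@segment_connected R 0 T)
  (continuous_subspaceT cf).
have [||x [[s _ <-] bx]] := connected_meets_boundary cA B_open.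
- by exists b; split => //; exists 0; rewrite /f ?scale0r ?addr0// /= in_itv/= lexx.
- by move=> /(_ (f T)) fB; apply: nB; apply: fB; exists T; rewrite //= in_itv/= lexx T0.
by exists (f s) => // i /negPf ij; rewrite !mxE ij andbF mulr0 addr0.
Qed.

(** The path from 0 to x reaches height t in coordinate i; from that point a line in another
    direction j leaves B without changing coordinate i. *)
Let boundary_proj (x : 'rV[R]_3) (i : 'I_3) (t : R) : B x ->
  Num.min 0 (x 0 i) <= t <= Num.max 0 (x 0 i) -> exists2 b, boundary B b & b 0 i = t.
Proof.
move=> Bx tx; have [[_ /(_ 0 x B0 Bx)[g [cg gB g0 g1]]] _] := B_simply_connected.
have cA := connected_continuous_connected (@segment_connected R 0 1) cg.
have /connected_intervalP gi := connected_continuous_connected cA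
  (continuous_subspaceT (@coord_continuous R 1 3 0 i)).
have [_ [s s01 <-] <-] : [set y 0 i | y in [set g s | s in `[0, 1]]] t.
  have gi0 : [set y 0 i | y in [set g s | s in `[0, 1]]] 0.
    by exists (g 0); [exists 0; rewrite //= in_itv/= lexx ler01|rewrite g0 mxE].
  have gi1 : [set y 0 i | y in [set g s | s in `[0, 1]]] (x 0 i).
    by exists (g 1); [exists 1; rewrite //= in_itv/= lexx ler01|rewrite g1].
  move: tx; rewrite minEle maxEle; case: ifP => _ tx; first exact: gi tx.
  exact: gi tx.
have [j ij] : exists j : 'I_3, i != j.
  by have [->|i0] := eqVneq i ord0; [exists (lift ord0 ord0)|exists ord0].
have [b bb bE] := boundary_line j (gB _ (imageP _ s01)).
by exists b => //; exact: bE.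
Qed.

Lemma boundary_nonempty : boundary B !=set0.
Proof. by have [b bb _] := boundary_line 0 B0; exists b. Qed.

Lemma area_boundary_ge :
  ((pi / 4 * (r0 / (4 * (1 + `|L|))) ^+ 2)%:E <= hausdorff2 (boundary B))%E.
Proof.
have [k [Z [_ BZ cover]]] := B_lip; have [b /cover[i _ _]] := boundary_nonempty.
exact: area_ge r0_gt0 (BZ i).
Qed.

Let domain_coord_le (x : 'rV[R]_3) (i : 'I_3) : B x -> `|x 0 i| <= N%:R * (4 * `|r1|).
Proof.
move=> Bx; have [k [Z [kN BZ cover]]] := B_lip.
pose c j := chart (Z j) 0 0 0 i.
(* A point of the cylinder is within radius plus half-height, so within 2 |r1|, of the centre. *)
have Zc j b : cylinder (Z j) b -> `|b 0 i - c j| <= 2 * `|r1|.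
  move=> [bb ba]; have [F1 /andP[_ rr] /andP[_ hr] _ _ _ _ _] := BZ j.
  have := enorm_chart F1 (base_coord (Z j) b) 0 (axis_coord (Z j) b) 0.
  rewrite chart_coord// !subr0 /c; move: (chart _ _ _) => w bw.
  by have := le_enorm_coord (b - w) i; rewrite !mxE; have := ler_norm r1; lra.
suff : Num.max 0 (x 0 i) - Num.min 0 (x 0 i) <= k%:R * (2 * (2 * `|r1|)).
  have kr : k%:R * (4 * `|r1|) <= N%:R * (4 * `|r1|).
    by rewrite ler_wpM2r ?mulr_ge0// ler_nat.
  move=> h; apply: le_trans kr; rewrite (_ : 4 * `|r1| = 2 * (2 * `|r1|)); last by ring.
  apply: le_trans h.
  by rewrite minEle maxEle; case: (leP 0 (x 0 i)) => x0; [rewrite ger0_norm// subr0|rewrite ltr0_norm// sub0r].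
apply: (@interval_cover_le _ _ c); first by rewrite mulr_ge0.
move=> t /=; rewrite in_itv/= => tx; have [b bb <-] := boundary_proj Bx tx.
have [j _ Zb] := cover _ bb; exists j => //=; rewrite in_itv/= -ler_distl.
exact: Zc.
Qed.

Lemma boundary_coord_le (x : 'rV[R]_3) (i : 'I_3) : boundary B x ->
  `|x 0 i| <= N%:R * (4 * `|r1|).
Proof.
move=> /boundary_enormP bx; apply/ler_addgt0Pr => e e0.
have [[y By yx] _] := bx e e0.
have := domain_coord_le i By; have := le_enorm_coord (y - x) i; rewrite !mxE distrC => h1 h2.
by have := ler_normD (x 0 i - y 0 i) (y 0 i); rewrite subrK; lra.
Qed.

End lipschitz_domain_theory.

(** * Newtonian potential of a measure with quadratic growth *)

Section potential.
Context {d} {X : measurableType d} {R : realType}.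
Variables (m : {measure set X -> \bar R}) (f : X -> R) (K rho : R).
Hypothesis f_ge0 : forall y, 0 <= f y.
Hypothesis f_le : forall y, f y <= rho.
Hypothesis mf : measurable_fun setT f.
Hypothesis K_gt0 : 0 < K.
Hypothesis rho_gt0 : 0 < rho.
Hypothesis growth : forall r, 0 < r -> (m [set y | (f y <= r)%R] <= (K * r ^+ 2)%:E)%E.

Let shell n := [set y | f y <= rho / 2 ^+ n].

Let m_shell n : measurable (shell n).
Proof.
rewrite -[shell n]setTI (_ : shell n = f @^-1` `]-oo, (rho / 2 ^+ n)%R]).
  by apply: mf => //; exact: measurable_itv.
by apply/seteqP; split => y; rewrite /= in_itv.
Qed.

(* Dyadic shells: if [rho / 2 ^ n.+1 < f y <= rho / 2 ^ n] then the [n]-th term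
   alone dominates [(f y)^-1]; the case [f y = 0] holds because [0^-1 = 0]. *)
Let inv_le_shells y :
  (((f y)^-1)%:E <= \sum_(n <oo) (2 ^+ n.+1 / rho * \1_(shell n) y)%:E)%E.
Proof.
have g0 n : (0 <= (2 ^+ n.+1 / rho * \1_(shell n) y)%:E)%E.
  by rewrite lee_fin mulr_ge0// divr_ge0 ?exprn_ge0// ltW.
have [->|fy0] := eqVneq (f y) 0; first by rewrite invr0; exact: nneseries_ge0.
have fy : 0 < f y by rewrite lt_neqAle eq_sym fy0 f_ge0.
have q1 : 1 <= rho / f y by rewrite ler_pdivlMr// mul1r.
have /andP[t1 t2] := truncn_itv (le_trans ler01 q1); set t := Num.truncn _ in t1 t2.
have t0 : (0 < t)%N by rewrite -truncn_gt0 in q1.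
have /andP[n1 n2] := trunc_log_bounds (isT : (1 < 2)%N) t0; set n := trunc_log 2 t in n1 n2.
have p2 k : 0 < 2 ^+ k :> R by rewrite exprn_gt0.
have yn : shell n y.
  rewrite /shell/= ler_pdivlMr// mulrC -ler_pdivlMr//.
  by apply: le_trans t1; rewrite -natrX ler_nat.
have yn1 : (f y)^-1 <= 2 ^+ n.+1 / rho.
  rewrite ler_pdivlMr// mulrC; apply: le_trans (ltW t2) _.
  by rewrite -natrX ler_nat.
apply: (@le_trans _ _ (\sum_(0 <= k < n.+1) (2 ^+ k.+1 / rho * \1_(shell k) y)%:E)%E); last first.
  exact: nneseries_lim_ge.
rewrite big_nat_recr//= -[leLHS]add0e; apply: leeD; first exact: sume_ge0.
by rewrite lee_fin indicE mem_set// mulr1.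
Qed.

(** The n-th shell contributes at most (2^(n+1) / rho) K (rho / 2^n)^2 = 2 K rho / 2^n, a geometric
    series of sum 4 K rho. *)
Lemma integral_inv_le : (\int[m]_y ((f y)^-1)%:E <= (4 * K * rho)%:E)%E.
Proof.
have p2 k : 0 < 2 ^+ k :> R by rewrite exprn_gt0.
have c0 n : 0 <= 2 ^+ n.+1 / rho by rewrite divr_ge0 ?(ltW (p2 _)) ?(ltW rho_gt0).
have m_indic n : measurable_fun setT (fun y => (2 ^+ n.+1 / rho * \1_(shell n) y)%:E).
  by apply/measurable_EFinP; apply: measurable_funM => //; exact: measurable_indic.
apply: (@le_trans _ _ (\int[m]_y \sum_(n <oo) (2 ^+ n.+1 / rho * \1_(shell n) y)%:E)%E).
  apply: ge0_le_integral => //.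
  - by move=> y _; rewrite lee_fin invr_ge0.
  - by apply/measurable_EFinP; exact: measurable_invr_ge0.
  - apply: ge0_emeasurable_sum => // n y _ _; by rewrite lee_fin mulr_ge0.
rewrite integral_nneseries//; last by move=> n y _; rewrite lee_fin mulr_ge0.
apply: (@le_trans _ _ (\sum_(n <oo) (4 * K * rho / (2 ^ (n + 1))%:R)%:E)%E).
  apply: lee_nneseries => [n _ _|n _].
    by apply: integral_ge0 => y _; rewrite lee_fin mulr_ge0.
  under eq_integral do rewrite EFinM.
  rewrite ge0_integralZl_EFin//; last first.
    by apply/measurable_EFinP; exact: measurable_indic.
  rewrite integral_indic// setIT; apply: le_trans (lee_wpmul2l _ (growth _)) _.
  - by rewrite lee_fin.
  - by rewrite divr_gt0.
  rewrite -EFinM lee_fin le_eqVlt; apply/orP; left; apply/eqP.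
  rewrite natrX addn1 !exprS; have := p2 n; move: (2 ^+ n) => a a0; field.
  by rewrite !gt_eqF.
rewrite (cvg_lim _ (@cvg_geometric_eseries_half R (4 * K * rho) 0))//.
by rewrite expr0 divr1.
Qed.

Lemma growth_zero_level : m [set y | f y = 0] = 0%E.
Proof.
apply/eqP; rewrite eq_le measure_ge0 andbT; apply/lee_addgt0Pr => e e0; rewrite add0e.
pose r := Num.sqrt (e / K); have r0 : 0 < r by rewrite sqrtr_gt0 divr_gt0.
have := growth r0; rewrite sqr_sqrtr ?divr_ge0 ?(ltW e0) ?(ltW K_gt0)//.
rewrite mulrC divfK ?gt_eqF//; apply: le_trans; apply: le_measure; rewrite ?inE.
- rewrite -[X in measurable X]setTI; exact: (mf measurableT (measurable_set1 0)).
- rewrite -[X in measurable X]setTI (_ : [set y | f y <= r] = f @^-1` `]-oo, r]).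
    by apply: mf => //; exact: measurable_itv.
  by apply/seteqP; split => y; rewrite /= in_itv.
by move=> y /= ->; exact: ltW.
Qed.

End potential.

(** * Elastic capacitance *)

Section measure_restriction.
Context {d} {X : measurableType d} {R : realType}.
Variables (S : {measure set X -> \bar R}) (A : set X).
Hypotheses (mA : measurable A) (SA : (S A < +oo)%E).
Local Notation m := (mfrestr mA SA).

Let mE B : m B = S (B `&` A). Proof. by []. Qed.

(** The surface measure on the whole space is not sigma-finite. Restricting it to a set of finite
    area gives a finite measure, for which product measures and Fubini are available. *)
Lemma integral_mfrestr (f : X -> \bar R) :
  (\int[m]_x (f \_ A) x = \int[S]_(x in A) f x)%E.
Proof.
rewrite -integral_mkcond; apply: eq_measure_integral => B mB BA.
by rewrite /= /mfrestr /mrestr (setIidl BA).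
Qed.

Lemma Rintegral_mfrestr (f : X -> R) : \int[m]_x (f \_ A) x = \int[S]_(x in A) f x.
Proof.
rewrite -Rintegral_mkcond /Rintegral; congr fine.
apply: eq_measure_integral => B mB BA.
by rewrite /= /mfrestr /mrestr (setIidl BA).
Qed.

Lemma integrable_mfrestr (f : X -> \bar R) :
  S.-integrable A f -> m.-integrable setT (f \_ A).
Proof.
move=> /integrableP[mf ioo]; apply/integrableP; split.
  by apply/(measurable_restrictT _ mA).
rewrite (_ : (fun x => _) = (fun x => `|f x|%E) \_ A); first by rewrite integral_mfrestr.
by apply/funext => x; rewrite /patch; case: ifP => //; rewrite abse0.
Qed.

Lemma ae_mfrestr (P : X -> Prop) :
  {ae S, forall x, A x -> P x} -> {ae m, forall x, P x}.
Proof.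
move=> [N [mN SN PN]]; exists (N `|` ~` A); split.
- by apply: measurableU => //; exact: measurableC.
- rewrite mE setIUl setICl setU0; apply/eqP; rewrite eq_le measure_ge0 andbT -SN.
  by apply: le_measure; rewrite ?inE//; exact: measurableI.
move=> x /= nP; have [Ax|nAx] := pselect (A x); [left; apply: PN|by right].
by move=> /(_ Ax).
Qed.

End measure_restriction.

Section capacitance_bounds.
Context {R : realType}.
Local Notation S := (surface_measure R).

Lemma rdist0E (u : 'rV[R]_3) : rdist 0 u = enorm u.
Proof.
by rewrite /rdist expr0n add0r /dot; congr Num.sqrt; apply: eq_bigr => i _; rewrite expr2.
Qed.

Lemma kelvinE (lambda mu : R) (x y : 'rV[R]_3) i j :
  kelvin lambda mu x y i j = kelvin_reg mu (lambda + 2 * mu) 0 (x - y) i j.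
Proof.
rewrite /kelvin /kelvin_reg !mxE big_ord_recl big_ord0 addr0 !mxE rdist0E.
have -> : dot (x - y) (x - y) = enorm (x - y) ^+ 2.
  by rewrite enorm2; apply: eq_bigr => k _; rewrite expr2.
(* At x = y both matrices are 0 by the convention 0^-1 = 0; elsewhere |u|^2 / |u|^3 simplifies to 1
   / |u|. *)
have [->|e0] := eqVneq (enorm (x - y)) 0.
  by rewrite expr0n/= !invr0 !(mulr0, mul0r, subr0, addr0) mul0rn.
move: (enorm (x - y)) e0 (mu^-1) ((lambda + 2 * mu)^-1) => e e0 a b.
move: (gt_eqF (pi_gt0 R)); move: (pi : R) => P P0.
by case: (i == j); rewrite ?mulr1n ?mulr0n; field; rewrite e0 P0.
Qed.

Variables (D : set 'rV[R]_3) (z : 'rV[R]_3) (K rho lambda mu : R) (C : 'M[R]_3).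
Hypotheses (K_gt0 : 0 < K) (rho_gt0 : 0 < rho) (mu_gt0 : 0 < mu).
Hypothesis mu_le : mu <= lambda + 2 * mu.
Hypothesis growth : forall x r, 0 < r ->
  (hausdorff2 (boundary D `&` [set x' | (enorm (x' - x) <= r)%R]) <= (K * r ^+ 2)%:E)%E.
Hypothesis D_le : forall x i, boundary D x -> `|(x - z) 0 i| <= rho.
Hypothesis C_cap : elastic_capacitance lambda mu D C.

Let A : set (surface_space R) := boundary D.

Let mA : measurable A.
Proof. by apply: measurable_closed_surface; exact: boundary_closed. Qed.

Let enorm_le (u : 'rV[R]_3) (c : R) : (forall i, `|u 0 i| <= c) -> enorm u <= 3 * c.
Proof.
move=> uc; apply: le_trans (enorm_le_sum u) _.
apply: (@le_trans _ _ (\sum_(i < 3) c)); first by apply: ler_sum => i _.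
by rewrite sumr_const card_ord -[c *+ 3]mulr_natl.
Qed.

Lemma boundary_area_lty : (S A < +oo)%E.
Proof.
apply: le_lt_trans (_ : ((K * (3 * rho) ^+ 2)%:E < +oo)%E); last exact: ltry.
apply: le_trans (growth z (_ : 0 < 3 * rho)); last by rewrite mulr_gt0.
apply: (le_outer_measure (@hausdorff2 R 3)) => x Ax; split => //=.
by apply: enorm_le => i; exact: D_le.
Qed.

Local Notation m := (mfrestr mA boundary_area_lty).

(* Positions are taken relative to [z]; the value off the surface, a null set
   of [m], only has to satisfy the same bounds. *)
Let p (x : surface_space R) : 'rV[R]_3 := if x \in A then (x : 'rV[R]_3) - z else 0.

Let pE x : A x -> p x = (x : 'rV[R]_3) - z.
Proof. by move=> Ax; rewrite /p mem_set. Qed.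

Let mp i : measurable_fun setT (fun x => p x 0 i).
Proof.
have -> : (fun x => p x 0 i) = (fun x : surface_space R => (x : 'rV[R]_3) 0 i - z 0 i) \_ A.
  by apply/funext => x; rewrite /p /patch; case: ifP; rewrite !mxE.
apply/(measurable_restrictT _ mA); apply: measurable_funTS.
exact: (measurable_funB (@measurable_coord_surface R i) (measurable_cst (z 0 i))).
Qed.

Let p_le x i : `|p x 0 i| <= rho.
Proof.
rewrite /p; case: ifPn => [|_]; last by rewrite mxE normr0 ltW.
by rewrite inE => Ax; exact: D_le.
Qed.

Let dist_ge0 x y : 0 <= enorm (p x - p y). Proof. exact: enorm_ge0. Qed.

Let dist_le x y : enorm (p x - p y) <= 6 * rho.
Proof.
have -> : 6 * rho = 3 * (2 * rho) by ring.
apply: enorm_le => i; rewrite !mxE; apply: le_trans (ler_normB _ _) _.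
by have := p_le x i; have := p_le y i; lra.
Qed.

Let m_dist x : measurable_fun setT (fun y => enorm (p x - p y)).
Proof.
have ms : measurable_fun setT (fun x : R => Num.sqrt x).
  by apply: continuous_measurable_fun; exact: sqrt_continuous.
apply: (measurableT_comp ms); apply: measurable_sum => i; apply: measurable_funX.
rewrite (_ : (fun y => _) = (fun y => p x 0 i - p y 0 i)).
  exact: (measurable_funB (measurable_cst (p x 0 i)) (mp i)).
by apply/funext => y; rewrite !mxE.
Qed.

(** For x off the surface the centre p x + z is z, so the growth bound is assumed around every point
    of space. *)
Let m_growth x r : 0 < r -> (m [set y | (enorm (p x - p y) <= r)%R] <= (K * r ^+ 2)%:E)%E.
Proof.
move=> r0; apply: le_trans (growth (p x + z) r0).
apply: (le_outer_measure (@hausdorff2 R 3)) => y [/= yr Ay]; split => //=.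
by rewrite opprD [- p x + _]addrC addrA; move: yr; rewrite (pE Ay) enormB.
Qed.

(** 24 = 4 * 6: the factor 4 of [integral_inv_le] and the bound 6 rho on distances. *)
Let potential_le x : (\int[m]_y ((rdist 0 (p x - p y))^-1)%:E <= (24 * K * rho)%:E)%E.
Proof.
under eq_integral do rewrite rdist0E.
have -> : 24 * K * rho = 4 * K * (6 * rho) by ring.
apply: (integral_inv_le (m := m) (dist_ge0 x) (dist_le x) (m_dist x) _ (m_growth x)).
by rewrite mulr_gt0.
Qed.

Let no_atom x : m [set y | p y = p x] = 0%E.
Proof.
rewrite -[RHS](growth_zero_level (m := m) (m_dist x) K_gt0 (m_growth x)).
congr (m _); apply/seteqP; split => y /= => [->|]; first by rewrite subrr enorm0.
by rewrite -rdist0E => /rdist0_eq0/eqP; rewrite subr_eq0 => /eqP.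
Qed.

Lemma elastic_capacitance_eigenvalue_bounds l : eigenvalue C l ->
  mu / (3 * (24 * K * rho)) * fine (S A) <= l <=
  (lambda + 2 * mu) * rho / @margin_const R.
Proof.
move=> /eigenvalueP[v vC v0]; have [sigma [[sigma2 sigma_eq] CE]] := C_cap.
(* Extension by 0, so that integrals over the surface become integrals over the whole space against
   the restricted measure. *)
pose sigma' (x : surface_space R) : 'M[R]_3 := if x \in A then sigma x else 0.
have sigma'E i j : (fun x => sigma' x i j) = (fun x : surface_space R => sigma x i j) \_ A.
  by apply/funext => x; rewrite /sigma' /patch; case: ifP; rewrite ?mxE.
have sigma'2 i j : square_integrable m (fun x => sigma' x i j).
  have [ms is2] := sigma2 i j; split.
    by rewrite sigma'E; apply/(measurable_restrictT _ mA).
  rewrite (_ : (fun x => _) = (fun s : surface_space R => (sigma s i j ^+ 2)%:E) \_ A).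
    exact: integrable_mfrestr.
  apply/funext => x; rewrite /sigma' /patch; case: ifP => //.
  by rewrite mxE expr0n.
have sigma'_eq : {ae m, forall x, forall i j,
    \int[m]_y (\sum_k kelvin_reg mu (lambda + 2 * mu) 0 (p x - p y) i k * sigma' y k j) =
    (i == j)%:R}.
  apply: ae_mfrestr; apply: filterS sigma_eq => x + Ax => /(_ Ax)/matrixP xE i j.
  have := xE i j; rewrite !mxE => <-.
  apply: (etrans _ (Rintegral_mfrestr mA boundary_area_lty
    (fun y : surface_space R => (kelvin lambda mu x y *m sigma y) i j))).
  apply: eq_Rintegral => y _; rewrite /patch /sigma'; case: ifPn => [|nAy].
    rewrite inE => Ay; rewrite mxE; apply: eq_bigr => k _.
    by rewrite kelvinE (pE Ax) (pE Ay) opprB addrA subrK.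
  by rewrite big1// => k _; rewrite mxE mulr0.
have C'E : C = \matrix_(i, j) \int[m]_x sigma' x i j.
  rewrite CE; apply/matrixP => i j; rewrite [LHS]mxE [RHS]mxE.
  apply: (etrans (esym (Rintegral_mfrestr mA boundary_area_lty
    (fun x : surface_space R => sigma x i j)))).
  by apply: eq_Rintegral => x _; rewrite /patch /sigma'; case: ifP => // _; rewrite mxE.
rewrite C'E in vC.
have Q0 : 0 < 24 * K * rho by rewrite !mulr_gt0.
have -> : S A = m setT by rewrite /= /mfrestr /mrestr setTI.
exact: (capacitance_eigenvalue_bounds mp rho_gt0 p_le potential_le no_atom mu_gt0 mu_le Q0
  sigma'2 sigma'_eq v0 vC).
Qed.

End capacitance_bounds.

Theorem theorem3p5 (R : realType) (N : nat) (r0 r1 L : R) (hr0 : 0 < r0) :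
  exists c C : R, [/\ 0 < c, 0 < C &
    forall (M : nat) (B : 'I_M -> set 'rV[R]_3),
      (forall m, [/\ open (B m), bounded_set (B m), simply_connected R (B m),
                     B m 0 & lipschitz_character_le N r0 r1 L (B m)]) ->
    forall (eps : R) (z : 'I_M -> 'rV[R]_3) (lambda mu : R),
      0 < eps -> 0 < mu -> 0 < 3 * lambda + 2 * mu ->
    forall (m : 'I_M) (Cm : 'M[R]_3) (lmin lmax : R),
      let Dm := scaled_copy eps (z m) (B m) in
      elastic_capacitance lambda mu Dm Cm ->
      min_eigenvalue Cm lmin ->
      max_eigenvalue Cm lmax ->
      ((c * (lambda + 2 * mu)^-1 * lmax)%:E
         <= surface_measure R (boundary Dm) * (eps^-1)%:E)%E /\
      (surface_measure R (boundary Dm) * (eps^-1)%:E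
         <= (C * mu^-1 * lmin)%:E)%E].
Proof.
(* For the reference bodies, [a] bounds the boundary area from below, [rho] the boundary coordinates
   from above, and [K] is the quadratic growth constant. N + 1 and |r1| + r0 keep [rho] and [K]
   positive when N = 0 or r1 <= 0. *)
pose a := pi / 4 * (r0 / (4 * (1 + `|L|))) ^+ 2.
pose rho := N.+1%:R * (4 * (`|r1| + r0)).
pose K := N.+1%:R * ((1 + `|L|) ^+ 2 * (4 * pi)).
have L1 : 0 < 1 + `|L| by rewrite ltr_wpDr.
have a0 : 0 < a by rewrite mulr_gt0 ?exprn_gt0 ?divr_gt0 ?pi_gt0// mulr_gt0.
have rho0 : 0 < rho by rewrite !mulr_gt0 ?ltr0n// ltr_wpDl.
have K0 : 0 < K.
  by rewrite mulr_gt0 ?ltr0n// mulr_gt0 ?exprn_gt0// mulr_gt0 ?pi_gt0.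
have g0 := @margin_const_gt0 R.
(* The first comes from area >= a eps^2 and lmax <= l' eps rho / [margin_const]; in the second, 72 =
   3 * 24 is the constant of the lower eigenvalue bound. *)
exists (a * @margin_const R / rho), (72 * K * rho).
split; [by rewrite divr_gt0// mulr_gt0|by rewrite mulr_gt0// mulr_gt0|].
move=> M B BP eps z lambda mu eps0 mu0 lmu m Cm lmin lmax D Ccap [eigmin _] [eigmax _].
have [oB bB scB B0 lipB] := BP m.
have DE : boundary D = [set eps *: x + z m | x in boundary (B m)].
  exact: boundary_scaled_copy.
have growth x r : 0 < r ->
    (hausdorff2 (boundary D `&` [set x' | (enorm (x' - x) <= r)%R]) <= (K * r ^+ 2)%:E)%E.
  (* Pulled back to the reference body the ball has radius r / eps, and the factor eps^2 of area
     restores r^2: [K] is scale invariant. *)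
  move=> r_gt0; set b := eps^-1 *: (x - z m).
  pose E := boundary (B m) `&` [set y | enorm (y - b) <= r / eps].
  apply: (@le_trans _ _ (hausdorff2 [set eps *: y + z m | y in E])).
    apply: (le_outer_measure (@hausdorff2 R 3)); rewrite DE => _ [[y By <-] /= yx].
    exists y => //; split => //=; rewrite ler_pdivlMr// mulrC -[X in X * _](gtr0_norm eps0) -enormZ.
    by rewrite scalerBr scalerA mulfV ?gt_eqF// scale1r opprB addrA.
  apply: le_trans (hausdorff2_lipschitz eps0 _) _ => [y y' _ _|].
    by rewrite opprD addrACA subrr addr0 -scalerBr enormZ gtr0_norm.
  have := area_ball_le oB lipB b (divr_gt0 r_gt0 eps0).
  move=> /(lee_wpmul2l (_ : 0 <= (eps ^+ 2)%:E)%E) H.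
  apply: le_trans (H _) _; first by rewrite lee_fin sqr_ge0.
  rewrite -EFinM lee_fin; apply: (@le_trans _ _ (N%:R * ((1 + `|L|) ^+ 2 * (4 * pi)) * r ^+ 2)).
    rewrite le_eqVlt; apply/orP; left; apply/eqP; move: (pi : R) (1 + `|L|) => P k.
    by field; rewrite gt_eqF.
  rewrite ler_wpM2r ?sqr_ge0// ler_wpM2r ?ler_nat//.
  by rewrite mulr_ge0 ?sqr_ge0// mulr_ge0 ?pi_ge0.
have D_le x i : boundary D x -> `|(x - z m) 0 i| <= eps * rho.
  rewrite DE => -[y By <-]; rewrite addrK mxE normrM gtr0_norm// ler_pM2l//.
  apply: le_trans (boundary_coord_le oB bB scB B0 lipB i By) _.
  rewrite ler_pM ?mulr_ge0// ?ler_nat// ler_pM2l// lerDl ltW//.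
have area : ((eps ^+ 2 * a)%:E <= hausdorff2 (boundary D))%E.
  (* The lower bound is transported by the inverse homothety, which is 1/eps-Lipschitz from the
     boundary of D onto that of the reference body. *)
  have := area_boundary_ge hr0 oB bB B0 lipB; rewrite -/a => aB.
  have BE : boundary (B m) = [set eps^-1 *: x - eps^-1 *: z m | x in boundary D].
    rewrite DE; apply/seteqP; split => [y By|_ [_ [y By <-] <-]].
      exists (eps *: y + z m); first by exists y.
      by rewrite scalerDr addrK scalerA mulVf ?scale1r// gt_eqF.
    by rewrite scalerDr addrK scalerA mulVf ?scale1r// gt_eqF.
  have ei0 : 0 < eps^-1 by rewrite invr_gt0.
  have : (hausdorff2 (boundary (B m)) <= (eps^-1 ^+ 2)%:E * hausdorff2 (boundary D))%E.
    rewrite {1}BE; apply: hausdorff2_lipschitz => // x y _ _.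
    by rewrite opprB addrA subrK -scalerBr enormZ gtr0_norm.
  move=> /(le_trans aB)/(lee_wpmul2l (_ : 0 <= (eps ^+ 2)%:E)%E) H.
  have {H} := H _; rewrite lee_fin sqr_ge0 => /(_ isT).
  by rewrite muleA -!EFinM -exprMn divff ?gt_eqF// expr1n mul1e.
(* From 3 (lambda + mu) = (3 lambda + 2 mu) + mu > 0. *)
have mu_le : mu <= lambda + 2 * mu by lra.
have epsrho0 : 0 < eps * rho by rewrite mulr_gt0.
have bounds l := elastic_capacitance_eigenvalue_bounds K0 epsrho0 mu0 mu_le growth D_le Ccap (l := l).
have fin := boundary_area_lty epsrho0 growth D_le.
have areaE : surface_measure R (boundary D) = (fine (surface_measure R (boundary D)))%:E.
  by rewrite fineK// ge0_fin_numE.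
have := area; rewrite -[hausdorff2 _]/(surface_measure R (boundary D)) areaE lee_fin => aD.
have /andP[lmin_ge _] := bounds _ eigmin; have /andP[_ lmax_le] := bounds _ eigmax.
rewrite -!EFinM !lee_fin; set s := fine _ in aD lmin_ge *.
have lp0 : 0 < lambda + 2 * mu by exact: lt_le_trans mu_le.
split.
  rewrite ler_pdivlMr//; apply: le_trans aD.
  have := lmax_le; move: (@margin_const R) g0 => g g0.
  move=> /(ler_wpM2l (_ : 0 <= a * g / rho * (lambda + 2 * mu)^-1 * eps)) H.
  apply: (@le_trans _ _ (a * g / rho * (lambda + 2 * mu)^-1 * eps * lmax)).
    by rewrite le_eqVlt; apply/orP; left; apply/eqP; ring.
  apply: le_trans (H _) _.
    by rewrite mulr_ge0 ?(ltW eps0)// divr_ge0 ?(ltW lp0)// divr_ge0 ?(ltW rho0)// mulr_ge0 ?(ltW a0) ?(ltW g0).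
  rewrite le_eqVlt; apply/orP; left; apply/eqP; move: (a) => a'.
  by field; rewrite !gt_eqF.
rewrite ler_pdivrMr//.
have -> : s = 72 * K * rho * mu^-1 * eps * (mu / (3 * (24 * K * (eps * rho))) * s).
  by field; rewrite !gt_eqF.
apply: (@le_trans _ _ (72 * K * rho * mu^-1 * eps * lmin)).
  by rewrite ler_pM2l// mulr_gt0// mulr_gt0 ?invr_gt0// mulr_gt0// mulr_gt0.
by rewrite le_eqVlt; apply/orP; left; apply/eqP; ring.
Qed.
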